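(* Let $n$ and $k\ge 2$ be integers. The graph $\mathrm{PTC}(n,k)$ uniquely maximizes the subpath number among all cacti on $n$ vertices with $k$ cycles; that is, for every $G\in\mathcal{C}_{n,k}$ we have $\mathrm{pn}(G)\le \mathrm{pn}(\mathrm{PTC}(n,k))$, with equality if and only if $G$ is isomorphic to $\mathrm{PTC}(n,k)$.
   Context: All graphs are finite, simple and undirected. The subpath number $\mathrm{pn}(G)$ of a graph $G$ is the total number of paths that are subgraphs of $G$ (undirected, so a path and its reversal are the same), including the trivial paths of length $0$ (single vertices). A cactus graph is a connected graph in which every edge lies in at most one cycle. $\mathcal{C}_{n,k}$ denotes the class of all cactus graphs on $n$ vertices with exactly $k$ cycles (for $k\ge 1$ this class is non-empty exactly when $n\ge 2k+1$). A bridge is an edge $e$ such that $G-e$ has more connected components than $G$; a graph is bridgeless if it has no bridges. In a bridgeless cactus graph $G$, an intersection vertex is a vertex belonging to at least two cycles of $G$. Let $\mathcal{V}$ be the set of intersection vertices and $\mathcal{C}$ the set of cycles of $G$. The cycle-incidence graph $T_G$ has vertex set $\mathcal{V}\cup\mathcal{C}$, where $v\in\mathcal{V}$ and $C\in\mathcal{C}$ are adjacent if and only if $v$ belongs to $C$ (there are no other edges). A cactus chain is a bridgeless cactus graph $G$ such that $T_G$ is a path. A cycle $C$ of a bridgeless cactus graph $G$ is an end-cycle if at most one of its vertices has degree greater than two in $G$; otherwise $C$ is an interior cycle. A cactus chain with $k\ge 2$ cycles has precisely two end-cycles. For $k\ge 2$, the pseudo triangle chain $\mathrm{PTC}(n,k)$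 is the cactus chain from $\mathcal{C}_{n,k}$ (unique up to isomorphism) in which every interior cycle is a triangle and the numbers of vertices of the two end-cycles differ by at most one. *)

(* Defs.v *)
From mathcomp Require Import all_boot.

Set Implicit Arguments.
Unset Strict Implicit.
Unset Printing Implicit Defensive.

Record sgraph := SGraph {
  svertex :> finType;
  adj : rel svertex;
  adj_sym : symmetric adj;
  adj_irr : irreflexive adj
}.

Definition graph_iso (G H : sgraph) : Prop :=
  exists2 f : G -> H, bijective f & forall x y, adj (f x) (f y) = adj x y.

Section Graph.
Variable G : sgraph.
Implicit Types (x y v : G) (e : {set G}).

Definition edges : {set {set G}} :=
  [set [set p.1; p.2] | p : G * G & adj p.1 p.2].

Definition degree v : nat := #|[set y | adj v y]|.

(* A connected graph is nonempty: it has exactly one component. *)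
Definition connected : bool := n_comp (@adj G) G == 1.

Definition del_edge e : rel G := fun x y => adj x y && ([set x; y] != e).

Definition bridge e : bool :=
  (e \in edges) && (n_comp (@adj G) G < n_comp (del_edge e) G).

Definition bridgeless : bool := [forall e, ~~ bridge e].

(* A subgraph is a pair (vertex set, edge set).  Traversals of a path or of a
   cycle that differ by reversal or rotation give the same pair, so the
   predicates below identify them. *)
Definition subgraph : finType := ({set G} * {set {set G}})%type.

Definition path_edges (s : seq G) : {set {set G}} :=
  [set [set p.1; p.2] | p in zip s (behead s)].

Definition cycle_edges (s : seq G) : {set {set G}} :=
  [set [set p.1; p.2] | p in zip s (rot 1 s)].

Definition is_path (H : subgraph) : bool :=
  (0 < #|H.1|) &&
  [exists s : #|H.1|.-tuple G,
    [&& uniq s, sorted (@adj G) s, H.1 == [set x in s]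
      & H.2 == path_edges s]].

Definition is_cycle (H : subgraph) : bool :=
  (2 < #|H.1|) &&
  [exists s : #|H.1|.-tuple G,
    [&& uniq s, cycle (@adj G) s, H.1 == [set x in s]
      & H.2 == cycle_edges s]].

Definition pn : nat := #|[set H | is_path H]|.

Definition cycles : {set subgraph} := [set H | is_cycle H].

Definition cactus : bool :=
  connected &&
  [forall e in edges, #|[set C in cycles | e \in C.2]| <= 1].

Definition in_class (n k : nat) : bool :=
  [&& cactus, #|G| == n & #|cycles| == k].

Definition inter_vertices : {set G} :=
  [set v | 2 <= #|[set C in cycles | v \in C.1]|].

Definition path_graph : bool := is_path ([set: G], edges).

Definition end_cycle (C : subgraph) : bool :=
  (C \in cycles) && (#|[set v in C.1 | 2 < degree v]| <= 1).

Definition interior_cycle (C : subgraph) : bool :=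
  (C \in cycles) && ~~ end_cycle C.

Definition inc_vertex : finType :=
  ({v : G | v \in inter_vertices} + {C : subgraph | C \in cycles})%type.

Definition inc_adj : rel inc_vertex := fun a b =>
  match a, b with
  | inl v, inr C | inr C, inl v => val v \in (val C).1
  | _, _ => false
  end.

Lemma inc_adj_sym : symmetric inc_adj.
Proof. by case=> a [] b. Qed.

Lemma inc_adj_irr : irreflexive inc_adj.
Proof. by case. Qed.

Definition incidence_graph : sgraph := SGraph inc_adj_sym inc_adj_irr.

End Graph.

Definition cactus_chain (G : sgraph) : bool :=
  [&& cactus G, bridgeless G & path_graph (incidence_graph G)].

(* The description of PTC(n, k); for 2 <= k it determines G up to isomorphism.
   A chain then has exactly two end-cycles, and the last clause, being stated
   for both orders of C and D, bounds the difference of their sizes. *)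
Definition is_PTC (n k : nat) (G : sgraph) : Prop :=
  [/\ cactus_chain G,
      in_class G n k,
      forall C : subgraph G, interior_cycle C -> #|C.1| = 3
    & forall C D : subgraph G, end_cycle C -> end_cycle D ->
        #|C.1| <= #|D.1| + 1].

(* Main.v *)
Require Import Defs.
From mathcomp Require Import all_boot.
From mathcomp Require Import zify.

(** A simple path between two vertices of a cactus has two ways around every
    cycle that it crosses, so two vertices separated by [c] cycles are joined by
    [2 ^ c] simple paths, and the subpath number adds up these numbers
    ([pn_double]). The problem is to place [n] vertices so that as many pairs as
    possible are separated by as many cycles as possible.

    A cactus grows from a vertex of a cycle by hanging blocks, cycles or bridges,
    on vertices already present ([grow_from]), and its cycles are exactly the
    cycle blocks ([cyc_seq_block]). With [k] cycles, [2 * k + 1] vertices are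
    needed for triangles; the other [F] are extra, and an extra vertex is charged
    to a cycle: its own, or one near it if it hangs on a bridge. Along the growth
    the subpath number stays below a constant, plus a linear term in [F], plus a
    quadratic form in the numbers of extra vertices of the cycles
    ([growth_bound], [inv_cycle], [inv_bridge]). The coefficient of two cycles in
    the form is the number of paths between generic vertices of them. It is
    [2 ^ k] for at most one pair, the end cycles of a path that crosses all cycles,
    and at most half of that for the others; hence the form is largest when the
    extra vertices are divided evenly between these two cycles ([quad_bound]).
    This gives the upper bound [pn_top], which is strict unless the cactus is
    bridgeless and some simple path crosses all cycles.

    In the remaining case, growing from an end of such a path hangs every cycle on
    a vertex of the cycle just before it ([chain_of_full], [regrow]). The subpath
    number of a chain is an explicit function of the sizes of its cycles, and the
    bound is attained exactly if all middle cycles are triangles and the end cycles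
    differ by at most one vertex ([chain_top_eq], [chain_top_zero]). The sizes
    determine a chain up to isomorphism ([normalize], [normal_iso]). Finally the
    pseudo triangle chains are exactly these balanced chains ([ptc_chain],
    [chain_ptc]), and they exist as soon as [2 * k + 1 <= n] ([exists_ptc]). *)

Set Implicit Arguments.
Unset Strict Implicit.
Unset Printing Implicit Defensive.

(** * Adjacency along a cyclic sequence *)

Section CycleAdjacency.
Variable T : eqType.
Implicit Types (c q a t : seq T) (x y u v : T).

(** On two entries this is a single edge, so that a bridge [[:: p; x]] can be
    handled as a degenerate cycle. *)
Definition cadj c : rel T := fun x y => (y == next c x) || (x == next c y).

Lemma cadj_sym c : symmetric (cadj c).
Proof. by move=> x y; rewrite /cadj orbC. Qed.

Lemma cadj_rot c i : uniq c -> cadj (rot i c) =2 cadj c.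
Proof. by move=> Uc x y; rewrite /cadj !next_rot. Qed.

Lemma cadj_rev c : uniq c -> cadj (rev c) =2 cadj c.
Proof.
have prevE u v : uniq c -> (u == prev c v) = (v == next c u).
  by move=> Uc; apply/eqP/eqP => ->; rewrite ?next_prev ?prev_next.
by move=> Uc x y; rewrite /cadj !next_rev // !prevE // orbC.
Qed.

Lemma cadj_mem c x y : cadj c x y -> x != y -> (x \in c) && (y \in c).
Proof.
have mem u v : v == next c u -> u != v -> (u \in c) && (v \in c).
  move=> /eqP ->; rewrite next_nth; case: ifP => [u_c _|]; last by rewrite eqxx.
  by have := mem_next c u; rewrite next_nth u_c => ->.
by case/orP => [/mem//|/mem h]; rewrite eq_sym andbC.
Qed.

Lemma cadj_irr c x : uniq c -> 1 < size c -> x \in c -> cadj c x x = false.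
Proof.
move=> Uc sz xc; rewrite /cadj orbb; case/rot_to: xc => i t def.
rewrite -(next_rot i Uc) def /=.
have := Uc; rewrite -(rot_uniq i) def.
have := size_rot i c; rewrite def /=; case: t {def} => [|y t] /=; first by lia.
by rewrite inE eqxx => _ /andP[/norP[/negPf-> _] _].
Qed.

Lemma next_cat a u t : uniq (a ++ u :: t) ->
  next (a ++ u :: t) u = head (head u a) t.
Proof.
move=> Uc; rewrite -(next_rot (size a) Uc) rot_size_cat /=.
by case: t {Uc} => [|y t]; case: a => [|z a] //=; rewrite eqxx.
Qed.

Lemma prev_cat a u t : uniq (a ++ u :: t) ->
  prev (a ++ u :: t) u = last (last u t) a.
Proof.
move=> Uc; rewrite -next_rev // rev_cat rev_cons -cats1 -catA /= next_cat.
  by case/lastP: a Uc => [|a z] _; rewrite ?rev_rcons ?last_rcons //=;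
     case/lastP: t => [|t w]; rewrite ?rev_rcons ?last_rcons.
by move: Uc; rewrite -rev_uniq rev_cat rev_cons -cats1 -catA.
Qed.

Lemma cadj_cat a u t x : uniq (a ++ u :: t) -> cadj (a ++ u :: t) u x ->
  x = head (head u a) t \/ x = last (last u t) a.
Proof.
move=> Uc /orP[/eqP->|/eqP e]; first by left; rewrite next_cat.
by right; have := prev_next Uc x; rewrite -e prev_cat.
Qed.

(** A vertex of a cycle has two neighbours only. A simple path that came to [u]
    through the visited part [a] cannot go back into [a], so it has to follow
    the cyclic order. *)
Lemma cadj_path_prefix a u t q : uniq (a ++ u :: t) -> a != [::] ->
    path (cadj (a ++ u :: t)) u q -> uniq (u :: q) ->
    all (fun x => x \notin a) q ->
  exists t', t = q ++ t'.
Proof.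
elim: q a u t => [|x q IH] a u t Uc na; first by exists t.
rewrite /= => /andP[ux pq] /andP[uxq Uq] /andP[xa qa].
have [e|e] := cadj_cat Uc ux; last first.
  by case/lastP: a na Uc {pq} ux qa xa e => // a z _ _ _ _;
    rewrite last_rcons mem_rcons inE => /[swap] ->; rewrite eqxx.
case: t Uc ux pq e => [|y t] Uc ux pq /= e.
  by move: na xa; rewrite e; case: (a) => // z a' _; rewrite inE eqxx.
subst y; rewrite -cat_rcons in Uc pq.
have [|//|//||t' ->] := IH _ _ _ Uc; [by case: (a)| | by exists t'].
apply/allP => z zq; rewrite mem_rcons inE negb_or (allP qa) // andbT.
by apply: contraNneq uxq => <-; rewrite inE zq orbT.
Qed.

End CycleAdjacency.

(** * Paths and cycles as subgraphs *)

Lemma set2_eq (T : finType) (x y a b : T) :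
  [set x; y] = [set a; b] -> (x = a /\ y = b) \/ (x = b /\ y = a).
Proof.
move=> e.
have xs : x \in [set a; b] by rewrite -e set21.
have ys : y \in [set a; b] by rewrite -e set22.
have as_ : a \in [set x; y] by rewrite e set21.
have bs : b \in [set x; y] by rewrite e set22.
move: xs ys as_ bs; rewrite !inE.
by move=> /orP[]/eqP-> /orP[]/eqP-> /orP[]/eqP ? /orP[]/eqP ?; subst; auto.
Qed.

Section Sub.
Variable G : sgraph.
Implicit Types (c q : seq G) (x y : G).

Definition cycle_sub c : subgraph G := ([set x in c], cycle_edges c).
Definition path_sub q : subgraph G := ([set x in q], path_edges q).

Lemma is_cycleP (H : subgraph G) :
  reflect (exists c, [/\ uniq c, cycle (@adj G) c, 2 < size c & H = cycle_sub c]) (is_cycle H).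
Proof.
apply: (iffP andP) => [[sz /existsP[c /and4P[Uc Cc /eqP e1 /eqP e2]]]|[c [Uc Cc sz ->]]].
  exists c; split=> //; first by rewrite size_tuple.
  by rewrite /cycle_sub -e1 -e2; case: (H).
have e : size c == #|[set x in c]| by rewrite cardsE (card_uniqP Uc).
split; first by rewrite /= -(eqP e).
by apply/existsP; exists (Tuple e); rewrite /= Uc Cc !eqxx.
Qed.

Lemma is_pathP (H : subgraph G) :
  reflect (exists q, [/\ uniq q, sorted (@adj G) q, 0 < size q & H = path_sub q]) (is_path H).
Proof.
apply: (iffP andP) => [[sz /existsP[c /and4P[Uc Cc /eqP e1 /eqP e2]]]|[c [Uc Cc sz ->]]].
  exists c; split=> //; first by rewrite size_tuple.
  by rewrite /path_sub -e1 -e2; case: (H).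
have e : size c == #|[set x in c]| by rewrite cardsE (card_uniqP Uc).
split; first by rewrite /= -(eqP e).
by apply/existsP; exists (Tuple e); rewrite /= Uc Cc !eqxx.
Qed.

Lemma zip_rot1 c : uniq c -> zip c (rot 1 c) = [seq (x, next c x) | x <- c].
Proof.
suff h a t x0 : uniq (a ++ t) -> head x0 (a ++ t) = x0 ->
    zip t (rcons (behead t) x0) = [seq (x, next (a ++ t) x) | x <- t].
  by case: c => [|x0 t] // Uc; rewrite rot1_cons; apply: (h [::] (x0 :: t)).
elim: t a => [|u t IH] a //= Uc hx.
rewrite next_cat //.
case: t IH Uc hx => [|w t] IH Uc hx /=.
  by congr [:: (_, _)]; rewrite -hx; case: (a).
by congr (_ :: _); have := IH (rcons a u); rewrite cat_rcons => /(_ Uc hx).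
Qed.

Lemma mem_cycle_edges c x y : uniq c ->
  ([set x; y] \in cycle_edges c) = (x \in c) && cadj c x y.
Proof.
move=> Uc; rewrite /cycle_edges zip_rot1 //.
apply/imsetP/idP => [[p /mapP[z zc -> /= e]]|/andP[xc /orP[]/eqP e]].
- case: (set2_eq e) => [[-> ->]|[-> ->]]; first by rewrite zc /cadj eqxx.
  by rewrite mem_next zc /cadj eqxx orbT.
- by exists (x, next c x); rewrite ?e //; apply/mapP; exists x.
exists (y, next c y); last by rewrite /= -e setUC.
by apply/mapP; exists y => //; rewrite -mem_next -e.
Qed.

Lemma cycle_edgesP c e : uniq c -> e \in cycle_edges c ->
  exists x y, [/\ e = [set x; y], x \in c, y \in c & cadj c x y].
Proof.
move=> Uc; rewrite /cycle_edges zip_rot1 // => /imsetP[p /mapP[z zc -> /= ->]].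
by exists z, (next c z); split; rewrite ?mem_next // /cadj eqxx.
Qed.

Lemma cycle_sub_eq c c' : uniq c -> uniq c' -> c =i c' ->
  {in c &, cadj c =2 cadj c'} -> cycle_sub c = cycle_sub c'.
Proof.
move=> Uc Uc' e h; congr (_, _); first by apply/setP => x; rewrite !inE e.
apply/setP => f; apply/idP/idP => /cycle_edgesP[] // x [y [-> xc yc a]].
  by rewrite mem_cycle_edges // -e xc -h.
by rewrite -e in xc; rewrite -e in yc; rewrite mem_cycle_edges // xc h.
Qed.

Lemma cycle_sub_rot i c : uniq c -> cycle_sub (rot i c) = cycle_sub c.
Proof.
move=> Uc; apply: cycle_sub_eq; rewrite ?rot_uniq //; first by move=> x; rewrite mem_rot.
by move=> x y _ _; rewrite cadj_rot.
Qed.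

Lemma cycle_sub_rev c : uniq c -> cycle_sub (rev c) = cycle_sub c.
Proof.
move=> Uc; apply: cycle_sub_eq; rewrite ?rev_uniq //; first by move=> x; rewrite mem_rev.
by move=> x y _ _; rewrite cadj_rev.
Qed.

Lemma path_edges_cons x y q : path_edges [:: x, y & q] = [set x; y] |: path_edges (y :: q).
Proof.
apply/setP => e; rewrite /path_edges inE [zip _ _]/=.
apply/imsetP/orP => [[p]|].
  rewrite !inE => /orP[/eqP-> ->|h ->]; first by left.
  by right; apply/imsetP; exists p.
case=> [/set1P->|/imsetP[p h ->]]; first by exists (x, y); first exact: mem_head.
by exists p => //; rewrite inE h orbT.
Qed.

Lemma path_edges1 x : path_edges [:: x] = set0.
Proof. by apply/setP => e; rewrite inE; apply/imsetP => [[p]]. Qed.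

Lemma path_edges_sub q e x : e \in path_edges q -> x \in e -> x \in q.
Proof.
elim: q => [|y [|z q] IH]; first by case/imsetP.
  by rewrite path_edges1 inE.
rewrite path_edges_cons inE => /orP[/set1P->|h].
  by rewrite !inE => /orP[]->; rewrite ?orbT.
by move=> /(IH h) xq; rewrite in_cons xq orbT.
Qed.

Lemma path_edges_rcons x y q : path_edges (rcons (rcons q x) y) = [set x;
  y] |: path_edges (rcons q x).
Proof.
elim: q => [|z q IH]; first by rewrite /= path_edges_cons.
by case: q IH => [|w q] /= IH; rewrite path_edges_cons IH [in RHS]path_edges_cons setUCA.
Qed.

Lemma path_edges_rev q : path_edges (rev q) = path_edges q.
Proof.
elim: q => [|x [|y q] IH] //.
by rewrite path_edges_cons -IH !rev_cons path_edges_rcons setUC setUC [X in X |: _ = _]setUC.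
Qed.

Lemma path_sub_rev q : path_sub (rev q) = path_sub q.
Proof. by rewrite /path_sub path_edges_rev; congr (_, _); apply/setP=> x; rewrite !inE mem_rev. Qed.

(** The first vertex of a path lies on a single edge of the path subgraph, which
    reveals the second vertex; removing the first vertex and this edge leaves
    the subgraph of the rest. *)
Lemma path_sub_inj_head x q q' : uniq (x :: q) -> uniq (x :: q') ->
  path_sub (x :: q) = path_sub (x :: q') -> q = q'.
Proof.
elim: q x q' => [|y q IH] x [|y' q'] //=.
- by move=> _ /andP[h _] [/setP/(_ y')]; rewrite !inE eqxx orbT => /eqP e; move: h;
  rewrite inE e eqxx.
- by move=> /andP[h _] _ [/setP/(_ y)]; rewrite !inE eqxx orbT => /esym/eqP e; move: h;
  rewrite inE e eqxx.
move=> /andP[xq Uq] /andP[xq' Uq'] [ev]; rewrite !path_edges_cons => ee.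
have ne s z : uniq (z :: s) -> x \notin z :: s -> forall u, [set x; u] \notin path_edges (z :: s).
  by move=> _ h u; apply: contra h => /path_edges_sub; apply; rewrite !inE eqxx.
have eyy : y = y'.
  have : [set x; y] \in [set x; y'] |: path_edges (y' :: q') by rewrite -ee !inE eqxx.
  rewrite inE (negPf (ne _ _ Uq' xq' _)) orbF inE => /eqP /set2_eq[[]|[ex eyx]] //.
  by move: xq; rewrite eyx inE eqxx.
subst y'; congr (_ :: _); apply: (IH y) => //; congr (_, _).
  apply/setP => z; move/setP/(_ z): ev; rewrite !inE.
  case: (eqVneq z x) => // -> _; move: xq xq'; rewrite !inE !negb_or.
  by case: (x == y) => //= /negPf-> /negPf->.
apply/setP => f; move/setP/(_ f): ee; rewrite !in_setU1.
by case: eqP => // -> _; rewrite (negPf (ne _ _ Uq xq _)) (negPf (ne _ _ Uq' xq' _)).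
Qed.

Lemma path_edges_mid a x y b : [set x; y] \in path_edges (a ++ [:: x, y & b]).
Proof.
elim: a => [|z [|w a] IH]; rewrite /= path_edges_cons inE ?inE ?eqxx //.
  by rewrite IH orbT.
by rewrite [X in _ || X]IH orbT.
Qed.

(** An end of the first path has only one neighbour in the common subgraph, so
    it cannot be an inner vertex of the second one: after a reversal both
    traversals start at the same vertex. *)
Lemma path_sub_inj q q' : uniq q -> uniq q' -> path_sub q = path_sub q' -> q' = q \/ q' = rev q.
Proof.
case: q => [|x t] Uq Uq' e.
  left; case: q' Uq' e => // y q' _ [/setP/(_ y)].
  by rewrite !inE eqxx.
have xq' : x \in q' by case: e => /setP/(_ x); rewrite !inE eqxx.
case/splitPr: xq' Uq' e => [a b].
case: a => [|y a] Uq' e; first by left; rewrite /= (path_sub_inj_head Uq Uq' e).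
right; case: b Uq' e => [|z b] Uq' e.
  rewrite cats1 in Uq' e *; rewrite -[RHS]path_sub_rev rev_rcons in e.
  have U2 : uniq (x :: rev (y :: a)) by rewrite -rev_rcons rev_uniq.
  by rewrite (path_sub_inj_head Uq U2 e) -rev_rcons revK.
exfalso; have nb u : [set x; u] \in path_edges (x :: t) -> u = head x t.
  case: t Uq {e} => [|w t] /andP[xt _]; first by rewrite path_edges1 inE.
  rewrite path_edges_cons inE => /orP[|/path_edges_sub/(_ (set21 _ _))]; last by rewrite (negPf xt).
  by move=> /set1P/set2_eq [[]|[e _]] //; move: xt; rewrite -e inE eqxx.
have := Uq'; rewrite lastI cat_rcons /=.
case: e => _ ee.
have h1 : z = head x t by apply: nb; rewrite ee (path_edges_mid (y :: a)).
have h2 : last y a = head x t.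
  by apply: nb; rewrite ee setUC -cat_cons lastI cat_rcons path_edges_mid.
rewrite h1 -h2 cat_uniq => /and3P[_ _ /=].
by rewrite !inE eqxx orbT.
Qed.
End Sub.

(** * Simple paths and cut vertices *)

Lemma uniq_split (T : eqType) (v : T) a b a' b' : uniq (a ++ v :: b) ->
  a ++ v :: b = a' ++ v :: b' -> a = a' /\ b = b'.
Proof.
move=> U e.
have idx (s t : seq T) : uniq (s ++ v :: t) -> index v (s ++ v :: t) = size s.
  rewrite cat_uniq => /and3P[_ /norP[/= h _] _].
  by rewrite index_cat (negPf h) /= eqxx addn0.
have es : size a = size a' by rewrite -(idx _ _ U) e idx // -e.
by move/eqP: e; rewrite eqseq_cat // => /andP[/eqP-> /eqP[->]].
Qed.

Section SimplePaths.
Variable G : sgraph.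
Local Notation e := (@adj G).
Implicit Types (A B C : seq G) (t : seq G) (u v p x y : G).

(** A simple path is represented by its vertices after the start [u]: then
    joining two paths at a cut vertex is concatenation. *)
Definition spath A u v t : bool :=
  [&& path e u t, last u t == v, uniq (u :: t) & all (mem A) (u :: t)].

(** An enumeration of candidates, to make the simple paths a finite list. *)
Definition short_seqs : seq (seq G) :=
  flatten [seq [seq tval w | w <- enum {: i.-tuple G}] | i <- iota 0 #|G|].

Lemma mem_short_seqs t : (t \in short_seqs) = (size t < #|G|).
Proof.
apply/flatten_mapP/idP => [[i]|h].
  by rewrite mem_iota => /andP[_ h] /mapP[w _ ->]; rewrite size_tuple.
exists (size t); first by rewrite mem_iota.
by apply/mapP; exists (in_tuple t) => //; rewrite mem_enum.
Qed.

Definition spaths A u v := undup (filter (spath A u v) short_seqs).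

Lemma mem_spaths A u v t : (t \in spaths A u v) = spath A u v t.
Proof.
rewrite mem_undup mem_filter mem_short_seqs andb_idr // => /and4P[_ _ U _].
by have := max_card (mem (u :: t)); rewrite (card_uniqP U).
Qed.

Definition npaths A u v := size (spaths A u v).

Lemma npaths_list A u v L : uniq L -> (forall t, (t \in L) = spath A u v t) ->
  npaths A u v = size L.
Proof.
move=> UL h; apply/perm_size/uniq_perm => //; first exact: undup_uniq.
by move=> t; rewrite mem_spaths h.
Qed.

Lemma npaths_uniq A u v : uniq (spaths A u v).
Proof. exact: undup_uniq. Qed.

Lemma npaths_eq_mem A B u v : A =i B -> npaths A u v = npaths B u v.
Proof.
move=> h; apply: npaths_list => [|t]; first exact: npaths_uniq.
by rewrite mem_spaths /spath (eq_all (a2 := mem A)) // => x; rewrite /= h.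
Qed.

Lemma npaths_self A u : u \in A -> npaths A u u = 1.
Proof.
move=> uA; apply: (@npaths_list _ _ _ [:: [::]]) => // t; rewrite inE /spath.
case: t => [|x t]; first by rewrite /= !eqxx uA.
symmetry; apply/negbTE/negP => /and4P[_ /eqP l /andP[/negP h _] _]; apply: h.
by rewrite -[X in X \in _]l /= mem_last.
Qed.

Lemma spath_rev A u v t : spath A u v t -> spath A v u (rev (belast u t)).
Proof.
move=> /and4P[pt /eqP lt U a]; have hv : v :: rev (belast u t) = rev (u :: t).
  by rewrite [in RHS]lastI rev_rcons lt.
apply/and4P; split; rewrite ?hv ?rev_uniq ?all_rev //.
  by rewrite -lt rev_path (eq_path (e' := e)) // => x y; rewrite adj_sym.
by case: t lt {pt U a hv} => [|x t] /= lt; rewrite ?rev_cons ?last_rcons ?eqxx // lt.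
Qed.

Lemma npaths_sym A u v : npaths A u v = npaths A v u.
Proof.
rewrite /npaths -[RHS](size_map (fun t => rev (belast v t))).
have key x y t : spath A x y t -> rev (belast y (rev (belast x t))) = t.
  move=> h; have /and4P[_ /eqP l _ _] := h.
  have := spath_rev h => /and4P[_ /eqP l2 _ _].
  have e1 : rev (x :: t) = y :: rev (belast x t) by rewrite lastI rev_rcons l.
  have : rev (rev (x :: t)) = x :: t by rewrite revK.
  by rewrite e1 lastI l2 rev_rcons => -[].
apply/perm_size/uniq_perm; first exact: npaths_uniq.
  rewrite map_inj_in_uniq ?npaths_uniq // => t t'.
  rewrite !mem_spaths => h h' /(congr1 (fun t => rev (belast u t))).
  by rewrite !(key v u).
move=> t; rewrite mem_spaths; apply/idP/mapP => [h|[t' h ->]].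
  by exists (rev (belast u t)); rewrite ?mem_spaths ?spath_rev ?(key u v).
by rewrite mem_spaths in h; apply: spath_rev.
Qed.

Section Cut.
Variables (A B C : seq G) (p : G).
Hypotheses (pA : p \in A) (pB : p \in B).
Hypothesis CE : forall x, (x \in C) = (x \in A) || (x \in B).
Hypothesis sep : forall x y, x \in A -> y \in B -> x != p -> y != p -> ~~ e x y /\ x != y.

Lemma cut_step x y : e x y -> x \in C -> y \in C -> x != p -> y != p -> (x \in A) = (y \in A).
Proof.
rewrite !CE => xy xC yC xp yp.
apply/idP/idP => h; apply: contraTT isT => h'.
  by move: yC; rewrite (negPf h') /= => yB; case: (sep h yB xp yp); rewrite xy.
by move: xC; rewrite (negPf h') /= => xB; case: (sep h xB yp xp); rewrite adj_sym xy.
Qed.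

(** No edge joins [A] to [B] outside the common vertex [p], so a path that
    avoids [p] never changes side. *)
Lemma cut_stay x t : path e x t -> all (mem C) (x :: t) -> p \notin x :: t ->
  (x \in A) = (last x t \in A) /\ (x \in A -> all (mem A) (x :: t)).
Proof.
elim: t x => [|y t IH] x /=; first by move=> _ _ _; split=> // ->.
move=> /andP[xy pt] /andP[xC /andP[yC tC]].
rewrite !inE !negb_or => /and3P[px py pt'].
have [|||h1 h2] := IH y => //; first by rewrite /= yC.
  by rewrite inE negb_or py.
have E : (x \in A) = (y \in A) by rewrite (cut_step xy) // eq_sym.
by split; rewrite E // => yA; have := h2 yA; rewrite /= yA.
Qed.

Lemma cut_stay_last x t : path e x t -> all (mem C) (x :: t) -> p \notin x :: t ->
  last x t \in A -> all (mem A) (x :: t).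
Proof. by move=> h1 h2 h3; case: (cut_stay h1 h2 h3) => [<- h]. Qed.

(** A simple path that left [A] through [p] would need [p] again to return. *)
Lemma spath_cut_same u v t : u \in A -> v \in A -> spath C u v t = spath A u v t.
Proof.
move=> uA vA; apply/and4P/and4P => -[h1 h2 h3 h4]; split=> //; last first.
  by apply: sub_all h4 => x /= xA; rewrite CE xA.
have [pt|npt] := boolP (p \in u :: t); last by case: (cut_stay h1 h4 npt) => _; apply.
have tail t2 : path e p t2 -> uniq (p :: t2) -> all (mem C) t2 -> last p t2 \in A -> all (mem A) t2.
  case: t2 => [|x t2] //= /andP[_ pa] /andP[npaths _] aC l.
  exact: cut_stay_last.
rewrite inE in pt; case/orP: pt => [/eqP e1|pt].
  subst u; rewrite /= pA; apply: tail => //; first by case/andP: h4.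
  by rewrite (eqP h2).
case/splitPr: pt h1 h2 h3 h4 => t1 t2.
rewrite cat_path last_cat -cat_cons cat_uniq all_cat /=.
move=> /andP[p1 /andP[lp p2]] l2 /and3P[/andP[ut1 Ut1] /norP[/=
  pn _] Ut2] /andP[/andP[uC C1] /andP[_ C2]].
case: (cut_stay p1 _ pn); first by rewrite /= uC.
move=> _ /(_ uA) a1; rewrite all_cat andbA; move: a1; rewrite /= => ->.
by rewrite /= pA; apply: tail => //; rewrite (eqP l2).
Qed.

Lemma npaths_cut_same u v : u \in A -> v \in A -> npaths C u v = npaths A u v.
Proof.
move=> uA vA; apply: npaths_list => [|t]; first exact: npaths_uniq.
by rewrite mem_spaths spath_cut_same.
Qed.
End Cut.

Section CutProduct.
Variables (A B C : seq G) (p : G).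
Hypotheses (pA : p \in A) (pB : p \in B).
Hypothesis CE : forall x, (x \in C) = (x \in A) || (x \in B).
Hypothesis sep : forall x y, x \in A -> y \in B -> x != p -> y != p -> ~~ e x y /\ x != y.

Lemma spath_cut_split u v t : u \in A -> v \in B -> spath C u v t ->
  exists t1 t2, [/\ t = t1 ++ t2, spath A u p t1 & spath B p v t2].
Proof.
move=> uA vB ht; have /and4P[h1 h2 h3 h4] := ht.
have CE' x : (x \in C) = (x \in B) || (x \in A) by rewrite orbC.
have sep' x y : x \in B -> y \in A -> x != p -> y != p -> ~~ e x y /\ x != y.
  by move=> xB yA xp yp; rewrite adj_sym eq_sym; apply: sep.
have pt : p \in u :: t.
  apply: contraT => npt; have [] := cut_stay CE sep h1 h4 npt.
  rewrite uA (eqP h2) => /esym vA _.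
  have vp : v != p by apply: contraNneq npt => <-; rewrite -(eqP h2) mem_last.
  by case: (sep vA vB vp vp); rewrite eqxx.
rewrite inE in pt; case/orP: pt => [/eqP e1|pt].
  subst u; exists [::], t; split=> //; first by rewrite /spath /= eqxx pA.
  by rewrite -(spath_cut_same pB CE' sep').
case/splitPr: pt ht h1 h2 h3 h4 => t1 t2 ht.
rewrite cat_path last_cat -cat_cons cat_uniq all_cat /=.
move=> /andP[p1 /andP[lp p2]] l2 /and3P[/andP[ut1 Ut1] /norP[/=
  pn hn] /andP[pt2 Ut2]] /andP[/andP[uC C1] /andP[pC C2]].
exists (rcons t1 p), t2; split; first by rewrite cat_rcons.
  rewrite -(spath_cut_same pA CE sep) // /spath /=
    rcons_path p1 lp last_rcons eqxx all_rcons uC C1 /= mem_rcons.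
  rewrite rcons_uniq Ut1 !andbT; move: pn; rewrite !inE !negb_or => /andP[pu ->].
  by rewrite eq_sym pu ut1 pC.
rewrite -(spath_cut_same pB CE' sep') // /spath /= p2 l2 pt2 Ut2 C2 /=.
by rewrite pC.
Qed.

Lemma spath_cut_join u v t1 t2 : spath A u p t1 -> spath B p v t2 -> spath C u v (t1 ++ t2).
Proof.
move=> /and4P[p1 /eqP l1 U1 a1] /and4P[p2 /eqP l2 U2 a2].
rewrite /spath cat_path p1 l1 p2 last_cat l1 l2 eqxx -cat_cons all_cat cat_uniq U1 /=.
have -> : uniq t2 by case/andP: U2.
have : all (mem C) (u :: t1) by apply: sub_all a1 => x /= xA; rewrite CE xA.
rewrite /= => ->.
have -> /= : all (mem C) t2 by case/andP: a2 => _; apply: sub_all => x /= xA; rewrite CE xA orbT.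
rewrite !andbT; apply/hasPn => x xt2; apply/negP => xt1.
have xp : x != p by case/andP: U2 => h _; apply: contraNneq h => <-.
have xB : x \in B by apply: (allP a2); rewrite inE xt2 orbT.
by case: (sep (allP a1 _ xt1) xB xp xp); rewrite eqxx.
Qed.

(** A simple path from [A] to [B] meets the cut vertex [p] exactly once, and the
    two halves can be chosen independently. *)
Lemma npaths_cut_prod u v : u \in A -> v \in B -> npaths C u v = npaths A u p * npaths B p v.
Proof.
move=> uA vB.
rewrite -(@size_allpairs _ _ _ (@cat G)).
apply: npaths_list => [|t].
  apply: allpairs_uniq; rewrite ?npaths_uniq // => -[t1 t2] [t1' t2'].
  move=> /allpairsP[[a b] /= [ha hb [-> ->]]] /allpairsP[[a' b'] /= [ha' hb' [->
    ->]]] {t1 t2 t1' t2'}.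
  rewrite !mem_spaths in ha hb ha' hb'.
  wlog le : a b a' b' ha hb ha' hb' / size a <= size a'.
    by move=> H; case: (leqP (size a) (size a')) => [|/ltnW] h e1; [apply: H | symmetry; apply: H].
  move=> E; suff s0 : size a = size a'.
    by move/eqP: E; rewrite eqseq_cat // => /andP[/eqP-> /eqP->].
  apply/eqP; rewrite eqn_leq le /= leqNgt; apply/negP => lt.
  have [w ea] : exists w, a' = a ++ w.
    exists (drop (size a) a'); rewrite -{1}(cat_take_drop (size a) a'); congr (_ ++ _).
    by move/(congr1 (take (size a))): E; rewrite take_size_cat // takel_cat.
  subst a'; have /and4P[_ /eqP l1 _ _] := ha; have /and4P[_ /eqP l2 U _] := ha'.
  move: lt l2 U; rewrite size_cat last_cat l1; case: w {ha' E le} => [|x w] /=; first by lia.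
  move=> _ lw U.
  have : uniq ((u :: a) ++ x :: w) by [].
  rewrite cat_uniq => /and3P[_ /hasPn h _].
  by have := h p; rewrite -{1}lw mem_last -{1}l1 mem_last => /(_ isT).
apply/allpairsP/idP => [[[a b] /= [ha hb ->]]|h].
  by rewrite !mem_spaths in ha hb; apply: spath_cut_join.
have [a [b [-> ha hb]]] := spath_cut_split uA vB h.
by exists (a, b); rewrite !mem_spaths.
Qed.
End CutProduct.

Lemma path_sub_rel (r r' : rel G) A x t : {in A &, subrel r r'} -> all (mem A) (x :: t) ->
  path r x t -> path r' x t.
Proof.
move=> h; elim: t x => [|y t IH] x //= /and3P[xA yA tA] /andP[xy pt].
by rewrite (h _ _ xA yA xy) IH //= yA.
Qed.

Lemma cycle_prefix u w t : uniq (u :: w) -> path (cadj (u :: w)) u t -> uniq (u :: t) ->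
  head u t = head u w -> exists w', w = t ++ w'.
Proof.
case: w t => [|x w] [|y t] //=.
- by exists [::].
- by move=> _ _ /andP[h _] e1; move: h; rewrite inE e1 eqxx.
- by exists (x :: w).
move=> U /andP[_ pt] /andP[ut Ut] e1; subst y.
have [||w' ->] := @cadj_path_prefix _ [:: u] x w t U _ pt Ut; [by []| |by exists w'].
by apply/allP => z zt; rewrite inE; apply: contraNneq ut => <-; rewrite inE zt orbT.
Qed.

(** The first step decides the direction, and from then on the path has to
    follow the cycle: there are two paths, one for each direction. *)
Lemma npaths_cycle c u v : uniq c -> 2 < size c ->
  {in c &, e =2 cadj c} -> u \in c -> v \in c -> u != v -> npaths c u v = 2.
Proof.
move=> Uc sz ec uc vc uv.
have [i w def] := rot_to uc.
have Uw : uniq (u :: w) by rewrite -def rot_uniq.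
have ew : {in u :: w &, e =2 cadj (u :: w)}.
  by move=> x y; rewrite -def !mem_rot cadj_rot //; apply: ec.
have cw : c =i u :: w by move=> x; rewrite -def mem_rot.
have vw : v \in w by move: vc; rewrite cw inE eq_sym (negPf uv).
rewrite (npaths_eq_mem _ _ cw).
have szw : 2 < size (u :: w) by rewrite -def size_rot.
clear def cw uc vc sz ec Uc c i; case/splitPr: vw Uw ew szw => a b Uw ew sz.
set c := u :: a ++ v :: b in Uw ew sz *.
have ac : rcons a v ++ b = a ++ v :: b by rewrite cat_rcons.
have neq : rcons a v != rcons (rev b) v.
  rewrite eqseq_rcons eqxx andbT; apply/negP => /eqP ea; move: Uw sz; rewrite /c ea.
  case/lastP: b {ea ac c ew} => [|b z] //; rewrite rev_rcons /= => /and3P[_ /negP h _]; case: h.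
  by rewrite mem_cat !inE mem_rcons inE eqxx !orbT.
apply: (@npaths_list _ _ _ [:: rcons a v; rcons (rev b) v]) => [|t].
  by rewrite /= inE neq.
(* the same cycle, listed from [u] in the opposite direction *)
pose c' := u :: rev b ++ v :: rev a.
have revc : rot 1 c = rev c'.
  by rewrite /c' rev_cons rev_cat rev_cons !revK cat_rcons rot1_cons.
have Uc' : uniq c' by rewrite -rev_uniq -revc rot_uniq.
have cc' : c =i c' by move=> x; rewrite -[RHS]mem_rev -revc mem_rot.
have ec' : cadj c' =2 cadj c by move=> x y; rewrite -(cadj_rev Uc') -revc cadj_rot.
have fwd a' b' : uniq (u :: a' ++ v :: b') -> {in u :: a' ++ v :: b' &,
  e =2 cadj (u :: a' ++ v :: b')} ->
    spath (u :: a' ++ v :: b') u v (rcons a' v).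
  move=> U h; have sub : {subset u :: rcons a' v <= u :: a' ++ v :: b'}.
    by move=> x; rewrite -cat_rcons -cat_cons mem_cat => ->.
  apply/and4P; split; rewrite ?last_rcons //; last exact/allP.
    apply: (@path_sub_rel (cadj (u :: a' ++ v :: b')) e (u :: a' ++ v :: b')).
    - by move=> x y xc yc; rewrite -h.
    - exact/allP.
    have : cycle (cadj (u :: a' ++ v :: b')) (u :: a' ++ v :: b').
      by apply: cycle_from_next => // x xc; rewrite /cadj eqxx.
    by rewrite /= -cat_rcons -!cats1 -!catA !cat_path => /and3P[-> ->].
  by move: U; rewrite -cat_rcons -cat_cons cat_uniq => /andP[].
have bwd a' b' s : uniq (u :: a' ++ v :: b') -> path (cadj (u :: a' ++ v :: b')) u s ->
  uniq (u :: s) ->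
    last u s = v -> head u s = head u (a' ++ v :: b') -> s = rcons a' v.
  move=> U ps Us ls hs; have [w' E] := cycle_prefix U ps Us hs.
  case/lastP: s ls E {ps Us hs} => [uv'|s z]; first by move: uv; rewrite -uv' eqxx.
  rewrite last_rcons => ->; rewrite cat_rcons => E.
  by have [|-> _ //] := uniq_split _ E; case/andP: U.
rewrite !inE; apply/orP/idP => [[/eqP->|/eqP->]|/and4P[pt lt Ut At]].
- exact: fwd.
- have := fwd (rev b) (rev a) Uc'; rewrite -/c' => H.
  rewrite /spath (eq_all (a2 := mem c')); last by move=> x; rewrite /= cc'.
  by apply: H => x y; rewrite -!cc' ec'; apply: ew.
have pc : path (cadj c) u t.
  by apply: path_sub_rel At pt => x y xc yc; rewrite ew.
have hx : head u t = head u (a ++ v :: b) \/ head u t = head u (rev b ++ v :: rev a).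
  case: t pt lt Ut At pc => [|x t] /=; first by rewrite (negPf uv).
  move=> _ _ _ _ /andP[ux _]; have [->|->] := @cadj_cat _ [::] u _ _ Uw ux; first by left.
  right=> /=; rewrite last_cat /=.
  by case/lastP: (b) => [|b' z] //; rewrite last_rcons rev_rcons.
case: hx => hx; [left|right]; apply/eqP.
  exact: (bwd a b _ Uw pc Ut (eqP lt) hx).
apply: (bwd (rev b) (rev a) _ Uc' _ Ut (eqP lt) hx).
by rewrite (eq_path ec').
Qed.

End SimplePaths.

(** * The subpath number counts traversals *)

Section CountPaths.
Variable G : sgraph.
Local Notation e := (@adj G).
Implicit Types (u v : G) (q t : seq G).

Definition simple_seq q := [&& uniq q, sorted e q & 0 < size q].
Implicit Types (A : seq G).

Definition simple_seqs := undup (filter simple_seq [seq u :: t | u <- enum G, t <- short_seqs G]).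

Lemma mem_simple_seqs q : (q \in simple_seqs) = simple_seq q.
Proof.
rewrite mem_undup mem_filter; case Sq: (simple_seq q) => //=.
case: q Sq => [|u t] /and3P[U _ _] //; apply/allpairsP; exists (u, t).
rewrite mem_enum mem_short_seqs; split=> //=.
by have := max_card (mem (u :: t)); rewrite (card_uniqP U).
Qed.

Definition ends (q : seq G) : option (G * G) := if q is u :: t then Some (u, last u t) else None.

Definition ends_rel (r : nat -> nat -> bool) q :=
  if ends q is Some (u, v) then r (enum_rank u) (enum_rank v) else false.

Lemma ends_rev q : ends (rev q) = omap (fun p => (p.2, p.1)) (ends q).
Proof.
case: q => [|u t] //=; rewrite lastI rev_rcons /= -[in RHS]/(last u t).
by case: t => [|v t] //=; rewrite rev_cons last_rcons.
Qed.

Lemma count_ends A u v : A =i predT -> count (fun q => ends q == Some (u,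
  v)) simple_seqs = npaths A u v.
Proof.
move=> hA; rewrite -size_filter /npaths -[RHS](size_map (cons u)).
apply/perm_size/uniq_perm; first by rewrite filter_uniq ?undup_uniq.
  by rewrite map_inj_uniq ?npaths_uniq // => t t' [].
have allA q : all (mem A) q by apply/allP => z _; rewrite /= hA.
move=> q; rewrite mem_filter mem_simple_seqs.
apply/andP/mapP => [[/eqP E Sq]|[t]].
  case: q E Sq => [|x t] // [-> <-] /and3P[U S _]; exists t => //.
  by rewrite mem_spaths /spath eqxx U allA /= andbT; exact: S.
rewrite mem_spaths => /and4P[p1 /eqP l1 U _] ->.
by rewrite /simple_seq U /= p1 l1.
Qed.

Lemma sum_npaths A : uniq A -> A =i predT ->
  \sum_(u <- A) \sum_(v <- A) npaths A u v = size simple_seqs.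
Proof.
move=> UA hA.
transitivity (\sum_(q <- simple_seqs) \sum_(u <- A) \sum_(v <- A) (ends q == Some (u, v))).
  rewrite [RHS]exchange_big /=; apply: eq_bigr => u _; rewrite [RHS]exchange_big /=;
    apply: eq_bigr => v _.
  by rewrite -(count_ends u v hA) -sum1_count big_mkcond; apply: eq_bigr => q _; case: (_ == _).
rewrite -sum1_size big_seq [RHS]big_seq; apply: eq_bigr => q; rewrite mem_simple_seqs.
case: q => [|u t] //= _.
have one (x : G) (F : G -> nat) : \sum_(y <- A) (x == y) * F y = F x.
  rewrite (bigD1_seq x) ?hA //= eqxx mul1n big1 ?addn0 // => y /negPf.
  by rewrite eq_sym => ->.
transitivity (\sum_(x <- A) (u == x) * \sum_(v <- A) (last u t == v) * 1); last by rewrite !one.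
apply: eq_bigr => x _; rewrite big_distrr /=; apply: eq_bigr => v _.
by rewrite muln1 mulnb.
Qed.

(** A path with an edge has two traversals and a single vertex has one.
    Reversal matches the traversals whose ends decrease in [enum_rank] with those
    whose ends increase, and the traversals with nondecreasing ends represent
    each path subgraph once. *)
Lemma pn_simple_seqs : 2 * pn G = size simple_seqs + #|G|.
Proof.
have Us : uniq simple_seqs by apply: undup_uniq.
have hrev : count (ends_rel (fun a b => b < a)) simple_seqs = count (ends_rel ltn) simple_seqs.
  rewrite -!size_filter -[RHS](size_map rev); apply/perm_size/uniq_perm.
  - by rewrite filter_uniq.
  - by rewrite (map_inj_uniq (can_inj revK)) filter_uniq.
  move=> q; rewrite -{2}[q]revK (mem_map (can_inj revK)) !mem_filter !mem_simple_seqs.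
  rewrite /ends_rel ends_rev; case: (ends q) => [[a b]|] //=; congr (_ && _).
  rewrite /simple_seq rev_uniq rev_sorted size_rev; congr [&& _, _ & _].
  by apply: eq_sorted => x y; rewrite adj_sym.
have heq : count (ends_rel eq_op) simple_seqs = #|G|.
  rewrite cardE -size_filter -(size_map (fun u => [:: u])); apply/perm_size/uniq_perm.
  - by rewrite filter_uniq.
  - by rewrite map_inj_uniq ?enum_uniq // => x y [].
  move=> q; rewrite mem_filter mem_simple_seqs; apply/andP/mapP => [[]|[x _ ->]];
    last by rewrite /ends_rel /= eqxx.
  case: q => [|x [|y t]] //; first by exists x; rewrite ?mem_enum.
  rewrite /ends_rel /= => /eqP/val_inj/enum_rank_inj E /and3P[/andP[h _] _ _].
  by case/negP: h; rewrite [X in X \in _]E mem_last.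
have hle : pn G = count (ends_rel leq) simple_seqs.
  have UL : uniq [seq path_sub q | q <- simple_seqs & ends_rel leq q].
    rewrite map_inj_in_uniq ?filter_uniq // => q q'; rewrite !mem_filter !mem_simple_seqs.
    move=> /andP[l /and3P[U _ _]] /andP[l' /and3P[U' _ _]] E.
    case: (path_sub_inj U U' E) => // E'; subst q'.
    case: q U {U' E} l l' => [|u [|w t]] // U; rewrite /ends_rel ends_rev /= => l l'.
    have /val_inj/enum_rank_inj E : val (enum_rank u) = val (enum_rank (last w t)).
      by apply/eqP; rewrite eqn_leq l l'.
    by case/andP: U => /negP[]; rewrite [X in X \in _]E mem_last.
  rewrite -size_filter -(size_map (@path_sub G)) -(card_uniqP UL).
  apply: eq_card => H; rewrite inE; apply/is_pathP/mapP => [[q [U S Z ->]]|[q]].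
    have Sq : simple_seq q by rewrite /simple_seq U S Z.
    case: (boolP (ends_rel leq q)) => h; first by exists q; rewrite ?mem_filter ?mem_simple_seqs ?h.
    exists (rev q); last by rewrite path_sub_rev.
    rewrite mem_filter mem_simple_seqs /simple_seq rev_uniq U rev_sorted size_rev Z andbT /=.
    rewrite [sorted _ q](eq_sorted (e' := e)) ?S; last by move=> x y; rewrite adj_sym.
    rewrite andbT; move: h; rewrite /ends_rel ends_rev; case: q Z {U S Sq} => [|u t] //= _.
    by rewrite -ltnNge => /ltnW.
  by rewrite mem_filter mem_simple_seqs => /andP[_ /and3P[U S Z]] ->; exists q.
have split_le : count (ends_rel leq) simple_seqs =
  count (ends_rel ltn) simple_seqs + count (ends_rel eq_op) simple_seqs.
  rewrite -count_predUI [X in _ + X](_ : _ = 0) ?addn0; last first.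
    apply/eqP; rewrite -leqn0 leqNgt -has_count; apply/hasPn => q _ /=; rewrite /ends_rel.
    case: (ends q) => [[a b]|] //; apply/negP => /andP[h /eqP h2]; by move: h; rewrite /= h2 ltnn.
  apply: eq_count => q /=; rewrite /ends_rel; case: (ends q) => [[a b]|] //=.
  by rewrite leq_eqVlt orbC.
have split_all : size simple_seqs = count (ends_rel leq) simple_seqs + count (ends_rel (fun a b
  => b < a)) simple_seqs.
  rewrite -(count_predC (ends_rel leq)); congr (_ + _); apply: eq_in_count => q.
  rewrite mem_simple_seqs /= /ends_rel; case: q => [|u t] //= _.
  by rewrite ltnNge.
by rewrite hle split_all hrev split_le heq; lia.
Qed.
Lemma pn_double A : uniq A -> A =i predT ->
  2 * pn G = \sum_(u <- A) \sum_(v <- A) npaths A u v + #|G|.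
Proof. by move=> UA hA; rewrite sum_npaths // pn_simple_seqs. Qed.
End CountPaths.

(** * Block decompositions *)

Section Blocks.
Variable T : Type.
Implicit Types (D : seq (T * seq T)) (r : T).

Fixpoint verts r D := if D is b :: D' then b.2 ++ verts r D' else [:: r].
Definition is_cycle_block (b : T * seq T) := 1 < size b.2.
Definition ncycles D := count is_cycle_block D.
Definition block_verts (b : T * seq T) := b.1 :: b.2.
End Blocks.

Section Decomposition.
Variable G : sgraph.
Local Notation e := (@adj G).
Implicit Types (D : seq (G * seq G)) (r p u v x y : G) (s : seq G).

(** Blocks are listed with the latest first. A block [(p, s)] hangs the new
    vertices [s] on an old vertex [p]: the cycle [p :: s], or a bridge if [s] has
    one entry. Fixing the adjacency of new vertices with all vertices present
    makes [D] describe the subgraph induced on [verts r D]. *)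
Fixpoint decomp r D : Prop := if D is b :: D' then
  decomp r D' /\
  [/\ b.1 \in verts r D', b.2 != [::], uniq b.2, ~~ has (mem (verts r D')) b.2 &
     forall x y, x \in b.2 -> y \in b.2 ++ verts r D' ->
       e x y = (y \in b.1 :: b.2) && cadj (b.1 :: b.2) x y]
  else True.

Lemma verts_uniq r D : decomp r D -> uniq (verts r D).
Proof.
elim: D => [|[p s] D IH] //= [dD [pD s0 Us dis _]].
by rewrite cat_uniq Us IH // andbT; apply: contra dis => /hasP[x xD xs]; apply/hasP; exists x.
Qed.

Lemma root_mem r D : r \in verts r D.
Proof. by elim: D => [|b D IH]; rewrite /= ?inE ?mem_cat ?IH ?orbT. Qed.

Section Step.
Variables (r p : G) (s : seq G) (D : seq (G * seq G)).
Hypothesis dD : decomp r ((p, s) :: D).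
Local Notation V := (verts r D).
Local Notation V' := (verts r ((p, s) :: D)).

Lemma step_p : p \in V. Proof. by case: dD => _ []. Qed.
Lemma step_decomp : decomp r D. Proof. by case: dD. Qed.
Lemma step_new x : x \in s -> x \notin V.
Proof. by case: dD => _ [_ _ _ h _] xs; apply: contra h => xV; apply/hasP; exists x. Qed.
Lemma step_uniq : uniq (p :: s).
Proof.
case: dD => _ [_ _ Us _ _]; rewrite /= Us andbT.
by apply/negP => /step_new; rewrite step_p.
Qed.
Lemma step_size : 0 < size s.
Proof. by case: dD => _ [_ s0 _ _ _]; case: (s) s0. Qed.

Lemma step_adj : {in p :: s &, e =2 cadj (p :: s)}.
Proof.
have h x y : x \in s -> y \in p :: s -> e x y = cadj (p :: s) x y.
  case: dD => _ [pV _ _ _ h] xs ys; rewrite h ?ys //=.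
  by move: ys; rewrite inE mem_cat => /orP[/eqP->|->//]; rewrite pV orbT.
move=> x y; rewrite inE => /orP[/eqP->|xs]; last exact: h.
rewrite inE => /orP[/eqP->|ys].
  by rewrite adj_irr cadj_irr ?step_uniq ?mem_head //= ltnS step_size.
by rewrite adj_sym cadj_sym h ?mem_head.
Qed.

Lemma step_memE x : (x \in V') = (x \in V) || (x \in p :: s).
Proof.
rewrite /= mem_cat inE orbC; case: (eqVneq x p) => [->|] //=.
by rewrite step_p.
Qed.

Lemma step_sep x y : x \in V -> y \in p :: s -> x != p -> y != p -> ~~ e x y /\ x != y.
Proof.
move=> xV; rewrite inE => /orP[/eqP->|ys xp yp]; first by rewrite eqxx.
case: dD => _ [pV _ _ _ h]; split; last by apply: contraTneq xV => ->; apply: step_new.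
rewrite adj_sym h ?mem_cat ?xV ?orbT // inE (negPf xp) /=.
by apply: contraTN xV => /andP[/step_new].
Qed.

Lemma step_sep' x y : x \in p :: s -> y \in V -> x != p -> y != p -> ~~ e x y /\ x != y.
Proof. by move=> xs yV xp yp; rewrite adj_sym eq_sym; apply: step_sep. Qed.

Definition block_npaths := if 1 < size s then 2 else 1.

(** The attachment vertex separates the new vertices from the old ones. *)
Lemma npaths_old u v : u \in V -> v \in V -> npaths V' u v = npaths V u v.
Proof. exact: (npaths_cut_same step_p step_memE step_sep). Qed.

Lemma npaths_block u v : u \in p :: s -> v \in p :: s -> npaths V' u v = npaths (p :: s) u v.
Proof.
apply: (@npaths_cut_same _ _ V _ p); rewrite ?mem_head //; last exact: step_sep'.
by move=> x; rewrite step_memE orbC.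
Qed.

Lemma npaths_block_neq u v : u \in p :: s -> v \in p :: s -> u != v ->
  npaths (p :: s) u v = block_npaths.
Proof.
move=> us vs uv; rewrite /block_npaths; case: ifP => sz.
  by rewrite (@npaths_cycle _ (p :: s)) ?step_uniq //; apply: step_adj.
have U := step_uniq; have A := step_adj; have s0 := step_size.
have h a b : uniq [:: a; b] -> e a b -> npaths [:: a; b] a b = 1.
  rewrite /= inE andbT => ab eab; apply: (@npaths_list _ _ _ _ [:: [:: b]]) => // t; rewrite inE.
  apply/eqP/and4P => [->|[pt lt Ut At]]; first by rewrite /= inE eab eqxx ab !inE !eqxx orbT.
  have := uniq_leq_size Ut (allP At).
  case: t pt lt Ut At => [|x [|y t]] //=; first by rewrite (negPf ab).
  by move=> _ /eqP->.
have [w sw] : exists w, s = [:: w] by case: s s0 sz => [|w [|]] // _ _; exists w.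
rewrite sw in U A us vs *.
have epw : e p w by rewrite A ?inE ?eqxx ?orbT // /cadj /= !eqxx.
move: us vs uv; rewrite !inE => /orP[]/eqP-> /orP[]/eqP->; rewrite ?eqxx // => _; first exact: h.
by rewrite npaths_sym h.
Qed.

Lemma npaths_new u v : u \in V -> v \in s -> npaths V' u v = npaths V u p * block_npaths.
Proof.
move=> uV vs; rewrite (npaths_cut_prod step_p (mem_head p s) step_memE step_sep) ?inE ?vs ?orbT //.
rewrite npaths_block_neq ?mem_head // ?inE ?vs ?orbT //.
by apply: contraTneq vs => <-; case/andP: step_uniq.
Qed.

Lemma npaths_new2 u v : u \in s -> v \in s -> npaths V' u v = if u == v then 1 else block_npaths.
Proof.
move=> us vs; case: eqVneq => [->|uv].
  by rewrite npaths_self //= mem_cat vs.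
by rewrite npaths_block ?npaths_block_neq // ?inE ?us ?vs ?orbT.
Qed.

End Step.

Definition npaths_from r D u := \sum_(v <- verts r D) npaths (verts r D) u v.
Definition npaths_total r D := \sum_(u <- verts r D) npaths_from r D u.

Lemma npaths_from_old r p s D u : decomp r ((p, s) :: D) -> u \in verts r D ->
  npaths_from r ((p, s) :: D) u = npaths_from r D u + block_npaths s * size s * npaths (verts r
    D) u p.
Proof.
move=> d uV; rewrite /npaths_from [verts r (_ :: _)]/= big_cat /= addnC; congr (_ + _).
  by rewrite big_seq [RHS]big_seq; apply: eq_bigr => v vV; rewrite (npaths_old d).
rewrite big_seq (eq_bigr (fun _ => npaths (verts r D) u p * block_npaths s));
  last by move=> v vs; rewrite (npaths_new d).
by rewrite -big_seq big_const_seq count_predT iter_addn_0 -mulnA mulnC.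
Qed.

Lemma npaths_from_new r p s D u : decomp r ((p, s) :: D) -> u \in s ->
  npaths_from r ((p, s) :: D) u = block_npaths s * npaths_from r D p + block_npaths s * (size s -
    1) + 1.
Proof.
move=> d us; rewrite /npaths_from [verts r (_ :: _)]/= big_cat /= addnC -addnA; congr (_ + _).
  rewrite big_distrr /= big_seq [RHS]big_seq; apply: eq_bigr => v vV.
  by rewrite npaths_sym (npaths_new d) // npaths_sym mulnC.
have Us : uniq s by case: d => _ [].
rewrite (bigD1_seq u) //= (npaths_new2 d) // eqxx addnC; congr (_ + _).
rewrite big_seq_cond (eq_bigr (fun _ => block_npaths s)); last first.
  by move=> v /andP[vs vu]; rewrite (npaths_new2 d) // eq_sym (negPf vu).
rewrite -big_seq_cond big_const_seq iter_addn_0; congr (_ * _).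
have := count_predC (pred1 u) s; rewrite (count_uniq_mem _ Us) us /= => <-.
by rewrite addnC addnK.
Qed.

Lemma npaths_total_step r p s D : decomp r ((p, s) :: D) ->
  npaths_total r ((p, s) :: D) = npaths_total r D + 2 * block_npaths s * size s * npaths_from r D
    p + size s * (block_npaths s * (size s - 1) + 1).
Proof.
move=> d; rewrite /npaths_total [verts r (_ :: _)]/= big_cat /=.
rewrite big_seq (eq_bigr (fun _ => block_npaths s * npaths_from r D p + block_npaths s * (size s
  - 1) + 1)); last by move=> u us; rewrite npaths_from_new.
rewrite -big_seq big_const_seq count_predT iter_addn_0.
have -> : \sum_(u <- verts r D) npaths_from r ((p, s) :: D) u =
    \sum_(u <- verts r D) npaths_from r D u + block_npaths s * size s * npaths_from r D p.
  rewrite {3}/npaths_from big_distrr -big_split /= big_seq [RHS]big_seq; apply: eq_bigr => u uV.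
  by rewrite npaths_from_old // npaths_sym.
move: (size s - 1) (size s) (\sum_(i <- verts r D) _) (npaths_from r D p) (block_npaths s) =>
  w m a b c; nia.
Qed.

Lemma npaths_gt0 r D u v : decomp r D -> u \in verts r D -> v \in verts r D ->
  0 < npaths (verts r D) u v.
Proof.
elim: D u v => [|[p s] D IH] u v; first by move=> _; rewrite !inE => /eqP->
  /eqP->; rewrite npaths_self ?inE.
move=> d; have dD := step_decomp d; have pV := step_p d.
have b0 : 0 < block_npaths s by rewrite /block_npaths; case: ifP.
rewrite /= !mem_cat => /orP[us|uV] /orP[vs|vV].
- by rewrite (npaths_new2 d) //; case: ifP.
- by rewrite npaths_sym (npaths_new d) // muln_gt0 IH.
- by rewrite (npaths_new d) // muln_gt0 IH.
- by rewrite (npaths_old d) // IH.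
Qed.

Lemma npaths_le r D u v : decomp r D -> u \in verts r D -> v \in verts r D ->
  npaths (verts r D) u v <= 2 ^ ncycles D.
Proof.
elim: D u v => [|[p s] D IH] u v; first by move=> _; rewrite !inE => /eqP->
  /eqP->; rewrite npaths_self ?inE.
move=> d; have dD := step_decomp d; have pV := step_p d.
have E : 2 ^ ncycles ((p, s) :: D) = 2 ^ ncycles D * block_npaths s.
  by rewrite /ncycles /= /is_cycle_block /block_npaths expnD mulnC; case: ifP.
have b0 : 0 < block_npaths s by rewrite /block_npaths; case: ifP.
have e0 : 0 < 2 ^ ncycles D by rewrite expn_gt0.
rewrite /= E !mem_cat => /orP[us|uV] /orP[vs|vV].
- by rewrite (npaths_new2 d) //; case: ifP; nia.
- by rewrite npaths_sym (npaths_new d) // leq_mul2r IH // orbT.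
- by rewrite (npaths_new d) // leq_mul2r IH // orbT.
- by rewrite (npaths_old d) //; have := IH u v dD uV vV; nia.
Qed.

Lemma decomp_connect r D u v : decomp r D -> u \in verts r D -> v \in verts r D ->
  exists t, spath (verts r D) u v t.
Proof.
move=> d uV vV; have := npaths_gt0 d uV vV; rewrite /npaths.
case E: spaths => [|t w] // _; exists t; by rewrite -mem_spaths E inE eqxx.
Qed.

End Decomposition.

(** * The cycles are the cycle blocks *)

Section Cycles.
Variable G : sgraph.
Local Notation e := (@adj G).
Implicit Types (c t w : seq G) (x y u v : G) (D : seq (G * seq G)).

Definition is_cycle_seq c := [&& uniq c, cycle e c & 2 < size c].

Lemma mem_cycles (H : subgraph G) : reflect (exists2 c,
  is_cycle_seq c & H = cycle_sub c) (H \in cycles G).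
Proof.
rewrite inE; apply: (iffP (is_cycleP H)) => [[c [U C S ->]]|[c /and3P[U C S] ->]].
  by exists c; rewrite // /is_cycle_seq U C S.
by exists c.
Qed.

Lemma cyc_seq_adj c x y : is_cycle_seq c -> x \in c -> cadj c x y -> e x y.
Proof.
move=> /and3P[U C _] xc /orP[]/eqP h; first by rewrite h next_cycle.
by rewrite h adj_sym next_cycle // -mem_next -h.
Qed.

Lemma cyc_seq_rot i c : is_cycle_seq c -> is_cycle_seq (rot i c).
Proof. by rewrite /is_cycle_seq rot_uniq rot_cycle size_rot. Qed.

Lemma cyc_seq_rev c : is_cycle_seq c -> is_cycle_seq (rev c).
Proof.
move=> Cc; have /and3P[U C S] := Cc; rewrite /is_cycle_seq rev_uniq U size_rev S andbT /=.
apply: cycle_from_next; rewrite ?rev_uniq // => x; rewrite mem_rev => xc.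
by apply: (cyc_seq_adj Cc xc); rewrite -cadj_rev // /cadj eqxx.
Qed.

Lemma cyc_of_cadj c : uniq c -> 2 < size c -> {in c &, e =2 cadj c} -> is_cycle_seq c.
Proof.
move=> U S h; rewrite /is_cycle_seq U S andbT; apply: cycle_from_next => // x xc.
by rewrite h ?mem_next // /cadj eqxx.
Qed.

Lemma cyc_seq_edge c x y : is_cycle_seq c -> x \in c -> cadj c x y ->
  exists w, [/\ is_cycle_seq [:: x, y & w], cycle_sub [:: x, y & w] = cycle_sub c & c =i [:: x,
    y & w]].
Proof.
move=> Cc xc; have [i w def] := rot_to xc; have /and3P[U _ _] := Cc.
rewrite -(cadj_rot i U) def => xy.
have Cw : is_cycle_seq (x :: w) by rewrite -def cyc_seq_rot.
have Ew : cycle_sub (x :: w) = cycle_sub c by rewrite -def cycle_sub_rot.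
have mw : c =i x :: w by move=> z; rewrite -def mem_rot.
clear def U xc; have /and3P[Uw _ Sw] := Cw.
have [h|h] := @cadj_cat _ [::] x w y Uw xy.
  by case: w Sw h Cw Ew mw {xy Uw} => [|z w] //= _ -> *; exists w.
have E : rev (rot 1 (x :: w)) = x :: rev w by rewrite rot1_cons rev_rcons.
case/lastP: w h Cw Ew mw Uw Sw E {xy} => [|w z] //=; rewrite last_rcons => -> {y} Cw Ew mw Uw Sw E.
exists (rev w); rewrite -rev_rcons -E; split.
- by apply/cyc_seq_rev/cyc_seq_rot.
- by rewrite cycle_sub_rev ?cycle_sub_rot // rot_uniq.
- by move=> u; rewrite mem_rev mem_rot mw.
Qed.

(** A cycle inside a cycle graph starts as one of the two simple paths around it,
    and its closing edge shows that it goes all the way round. *)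
Lemma cycle_in_cycle (B c : seq G) : uniq B -> uniq c -> 2 < size c -> {subset c <= B} ->
  cycle (cadj B) c -> cycle_sub c = cycle_sub B.
Proof.
case: c => [|u t] // UB Uc Sc sub.
have uB : u \in B by apply: sub; rewrite mem_head.
have [i w def] := rot_to uB.
rewrite -(cycle_sub_rot i UB) def; have Uw : uniq (u :: w) by rewrite -def rot_uniq.
rewrite /= => pc.
have : path (cadj (u :: w)) u (rcons t u) by rewrite -(eq_path (cadj_rot i UB)) def in pc.
clear def uB sub pc i UB B.
suff gen w' : uniq (u :: w') -> path (cadj (u :: w')) u (rcons t u) -> head u t = head u w' ->
  w' = t.
  move=> pt; have := pt; case: t Uc Sc gen pt => [|x t] // Uc Sc gen pt /= /andP[ux _].
  have [/= h|/= h] := @cadj_cat _ [::] u w x Uw ux; first by rewrite (gen w Uw pt).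
  have E : rev (rot 1 (u :: w)) = u :: rev w by rewrite rot1_cons rev_rcons.
  have Ur : uniq (u :: rev w) by rewrite -E rev_uniq rot_uniq.
  rewrite -(gen (rev w) Ur).
  - by rewrite -E cycle_sub_rev ?rot_uniq // cycle_sub_rot.
  - rewrite -(eq_path (e := cadj (u :: w))) // => a b.
    by rewrite -E cadj_rev ?rot_uniq // cadj_rot.
  by rewrite h; case/lastP: (w) => [|w1 z] //; rewrite rev_rcons last_rcons.
clear Uw w => Uw; rewrite rcons_path => /andP[pt lt] hw.
have [w'' E] := cycle_prefix Uw pt Uc hw.
rewrite E in Uw lt *; case: w'' Uw lt {E hw} => [|z w''] Uw lt; first by rewrite cats0.
exfalso; rewrite cadj_sym in lt.
case: t pt Uc Sc Uw lt => [|x [|y t]] // pt Uc Sc Uw lt.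
have [/= h|/= h] := @cadj_cat _ [::] u _ _ Uw lt.
  by case/and3P: Uc => _ /negP[]; rewrite -h mem_last.
move: Uw; rewrite -cat_cons cat_uniq => /and3P[_ /hasPn/(_ (last z w'')) H _].
move: (H (mem_last _ _)) => /negP; apply.
by rewrite last_cat /= in h; rewrite -h !inE -in_cons mem_last !orbT.
Qed.

Lemma block_facts r D b : decomp r D -> b \in D ->
  [/\ uniq (block_verts b), {in block_verts b &, e =2 cadj (block_verts b)},
    {subset block_verts b <= verts r D} & 0 < size b.2].
Proof.
elim: D => [|[p s] D IH] // d; rewrite inE => /orP[/eqP->|bD].
  split; [exact: (step_uniq d)|exact: (step_adj d)| |exact: (step_size d)].
  by move=> x xs; rewrite (step_memE d) [x \in p :: s]xs orbT.
have [h1 h2 h3 h4] := IH (step_decomp d) bD; split=> // x /h3 xD.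
by rewrite (step_memE d) xD.
Qed.

Lemma block_cyc_seq r D b : decomp r D -> b \in D -> is_cycle_block b ->
  is_cycle_seq (block_verts b).
Proof. by move=> d /(block_facts d)[U A _ _] S; apply: cyc_of_cadj. Qed.

(** A cycle that meets the new vertices [s] stays in [p :: s], since it cannot
    pass the cut vertex [p] twice. *)
Lemma cyc_seq_block r D c : decomp r D -> is_cycle_seq c -> {subset c <= verts r D} ->
  exists b, [/\ b \in D, is_cycle_block b & cycle_sub c = cycle_sub (block_verts b)].
Proof.
elim: D c => [|[p s] D IH] c.
  move=> _ /and3P[U _ S] sub; have := uniq_leq_size U sub; rewrite /=; lia.
move=> d Cc sub; case: (boolP (has (mem s) c)) => [/hasP[x xc xs]|/hasPn h]; last first.
  have [|b [bD bc E]] := IH c (step_decomp d) Cc; last by exists b; rewrite inE bD orbT.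
  by move=> x xc; have := sub x xc; rewrite mem_cat; have := h x xc => /= /negPf->.
have xps : x \in p :: s by rewrite inE orbC [x \in s]xs.
have [i t def] := rot_to xc.
have Ct : is_cycle_seq (x :: t) by rewrite -def cyc_seq_rot.
have Uc : uniq c by case/and3P: Cc.
have E0 : cycle_sub (x :: t) = cycle_sub c by rewrite -def cycle_sub_rot.
have subt : {subset x :: t <= verts r ((p, s) :: D)} by move=> z; rewrite -def mem_rot; apply: sub.
rewrite -E0; clear sub Cc Uc E0 def xc c i.
have /and3P[Ut Pt St] := Ct.
pose C := verts r ((p, s) :: D).
have CE z : (z \in C) = (z \in p :: s) || (z \in verts r D) by rewrite (step_memE d) orbC.
have stay := cut_stay CE (step_sep' d).
have stayl := cut_stay_last CE (step_sep' d).
have suball : all (mem (p :: s)) (x :: t).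
  have [pt|npt] := boolP (p \in x :: t); last first.
    have pxt : path e x t by move: Pt; rewrite /= rcons_path => /andP[].
    by case: (stay _ _ pxt _ npt) => [|_]; [exact/allP|apply].
  have px : p != x by apply: contraTneq xs => <-; case/andP: (step_uniq d).
  rewrite inE (negPf px) /= in pt.
  case/splitPr: pt Ut Pt {St Ct} subt => t1 t2 Ut Pt subt.
  move: Pt; rewrite /= rcons_cat cat_path /= => /and3P[p1 lp p2].
  move: Ut; rewrite -cat_cons cat_uniq => /and3P[U1 /norP[/= npt1 _] /andP[npt2 _]].
  have a1 : all (mem (p :: s)) (x :: t1).
    case: (stay _ _ p1 _ npt1) => [|_]; last by apply.
    by apply/allP => z zt; apply: subt; rewrite -cat_cons mem_cat zt.
  rewrite all_cat andbA; move: a1; rewrite /= => ->; rewrite /= mem_head /=.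
  case: t2 npt2 p2 subt => [|y t2] // npt2 /= /andP[_ p2] subt.
  have : all (mem (p :: s)) (y :: rcons t2 x).
    apply: stayl => //; last by rewrite last_rcons.
    - apply/allP => z; rewrite -rcons_cons mem_rcons inE => /orP[/eqP->|zt];
      first by apply: subt; rewrite mem_head.
      by apply: subt; rewrite inE mem_cat inE zt !orbT.
    - by rewrite -rcons_cons mem_rcons inE negb_or px.
  by rewrite -rcons_cons all_rcons => /andP[].
have sub : {subset x :: t <= p :: s} by apply/allP.
exists (p, s); split; first exact: mem_head.
  by have := uniq_leq_size Ut sub; rewrite /is_cycle_block /=; move: St => /=; lia.
apply: cycle_in_cycle => //; first exact: (step_uniq d).
have ar : all (mem (p :: s)) (x :: rcons t x) by rewrite -rcons_cons all_rcons; apply/andP.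
by apply: (@path_sub_rel _ e (cadj (p :: s)) (p :: s)) ar Pt => a b ap bp; rewrite (step_adj d).
Qed.

Lemma cycle_sub_block_uniq r D : decomp r D -> uniq [seq cycle_sub (block_verts b) | b <- D].
Proof.
elim: D => [|[p s] D IH] // d; rewrite map_cons cons_uniq (IH (step_decomp d)) andbT.
apply/mapP => -[b bD [E _]]; have [_ _ sub _] := block_facts (step_decomp d) bD.
have [x xs] : exists x, x \in s by case: (s) (step_size d) => [|x w] // _; exists x;
  rewrite mem_head.
have := step_new d xs => /negP; apply; apply: sub.
by move/setP/(_ x): E; rewrite !inE xs orbT => /esym.
Qed.

Lemma ncycles_card r D : decomp r D -> (forall x, x \in verts r D) -> #|cycles G| = ncycles D.
Proof.
move=> d full; rewrite /ncycles -size_filter -(size_map (fun b => cycle_sub (block_verts b))).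
have U : uniq [seq cycle_sub (block_verts b) | b <- [seq x <- D | is_cycle_block x]].
  by apply: (subseq_uniq _ (cycle_sub_block_uniq d)); apply: map_subseq; apply: filter_subseq.
rewrite -(card_uniqP U); apply: eq_card => H; apply/mem_cycles/mapP => [[c Cc ->]|[b]].
  have [b [bD bc E]] := cyc_seq_block d Cc (fun x _ => full x).
  by exists b; rewrite // mem_filter bc.
by rewrite mem_filter => /andP[bc bD] ->; exists (block_verts b) => //;
  apply: block_cyc_seq d bD bc.
Qed.

Lemma edge_block r D x y : decomp r D -> x \in verts r D -> y \in verts r D -> e x y ->
  exists b, [/\ b \in D, x \in block_verts b, y \in block_verts b & cadj (block_verts b) x y].
Proof.
elim: D x y => [|[p s] D IH] x y; first by move=> _; rewrite !inE => /eqP-> /eqP->; rewrite adj_irr.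
move=> d xV yV xy.
have old a b : a \in verts r D -> b \in verts r D -> e a b ->
    exists b', [/\ b' \in (p, s) :: D, a \in block_verts b',
      b \in block_verts b' & cadj (block_verts b') a b].
  move=> aD bD ab; have [b' [h1 h2 h3 h4]] := IH a b (step_decomp d) aD bD ab.
  by exists b'; rewrite inE h1 orbT.
have new a b : a \in s -> b \in s ++ verts r D -> e a b ->
    exists b', [/\ b' \in (p, s) :: D, a \in block_verts b',
      b \in block_verts b' & cadj (block_verts b') a b].
  move=> as_ bV; case: (d) => _ [_ _ _ _ h]; rewrite h // => /andP[/= bp ab].
  by exists (p, s); split; rewrite // /block_verts /= inE ?as_ ?orbT // eqxx.
have := xV; rewrite mem_cat => /orP[xs|xD]; first exact: new.
have := yV; rewrite mem_cat => /orP[ys|yD]; last exact: old.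
rewrite adj_sym in xy; have [b [h1 h2 h3 h4]] := new _ _ ys xV xy.
by exists b; rewrite cadj_sym.
Qed.
End Cycles.

(** * Growing a block decomposition of a cactus *)

Section Growth.
Variable G : sgraph.
Local Notation e := (@adj G).
Implicit Types (c t w : seq G) (x y u v r : G) (D : seq (G * seq G)).

Hypothesis conn : forall x y, connect e x y.
Hypothesis cact : forall c c' x y, is_cycle_seq c -> is_cycle_seq c' ->
  x \in c -> cadj c x y -> x \in c' -> cadj c' x y -> cycle_sub c = cycle_sub c'.

(** A block is made a bridge only if its edge lies on no cycle of the whole
    graph; this is what excludes ears between different vertices later on. *)
Definition bridges_ok D := forall b x y, b \in D -> ~~ is_cycle_block b ->
  x \in block_verts b -> cadj (block_verts b) x y ->
  forall c, is_cycle_seq c -> x \in c -> ~~ cadj c x y.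

(** An ear from [x] to [z] and a path from [z] back to [x] inside [verts r D] form
    a cycle with an edge inside [verts r D]. That edge belongs to a block: a
    bridge lies on no cycle, and a cycle block would be a second cycle through
    the edge. *)
Lemma no_ear r D x z t : decomp r D -> bridges_ok D -> x \in verts r D -> z \in verts r D ->
  x != z ->
  0 < size t -> uniq t -> ~~ has (mem (verts r D)) t -> path e x (rcons t z) -> False.
Proof.
move=> d ok xV zV xz t0 Ut hV pt.
have [q /and4P[pq /eqP lq Uq aq]] := decomp_connect d zV xV.
case: q pq lq Uq aq => [|w q] pq lq Uq aq; first by rewrite -lq eqxx in xz.
pose c := z :: (w :: q) ++ t.
have Cc : is_cycle_seq c.
  apply/and3P; split.
  - rewrite /c -cat_cons cat_uniq Uq Ut andbT /=; apply: contra hV => /hasP[y yt yq].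
    by apply/hasP; exists y => //; apply: (allP aq).
  - by rewrite /c /cycle rcons_cat cat_path pq lq.
  - by move: t0; rewrite /c /= size_cat; lia.
have [wV zw] : w \in verts r D /\ e z w.
  by split; [apply: (allP aq); rewrite !inE eqxx orbT | case/andP: pq].
have [b [bD zb wb zwb]] := edge_block d zV wV zw.
have zwc : cadj c z w by rewrite /cadj /= eqxx eqxx.
have [bc|nbc] := boolP (is_cycle_block b); last first.
  by have := ok b z w bD nbc zb zwb c Cc (mem_head _ _); rewrite zwc.
have E := cact Cc (block_cyc_seq d bD bc) (mem_head _ _) zwc zb zwb.
have [_ _ sub _] := block_facts d bD.
case: t t0 hV {Ut pt} @c Cc zwc E => [|y t] //= _ /norP[yV _] _ _ [/setP/(_ y) E _].
move/negP: yV; apply; apply: sub.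
by move: E; rewrite !inE mem_cat inE eqxx !orbT => /esym.
Qed.

(** A chord splits a cycle into two cycles, one of which shares an edge with the
    original without having all of its vertices. *)
Lemma chordless c a b : is_cycle_seq c -> a \in c -> b \in c -> e a b -> cadj c a b.
Proof.
move=> Cc ac bc ab; have /and3P[Uc _ _] := Cc.
have [i w def] := rot_to ac.
have Cw : is_cycle_seq (a :: w) by rewrite -def cyc_seq_rot.
rewrite -(cadj_rot i Uc) def.
have nab : b != a by apply: contraTneq ab => ->; rewrite adj_irr.
have bw : b \in w by move: bc; rewrite -(mem_rot i) def inE (negPf nab).
clear def ac bc Cc Uc c i; case/splitPr: bw Cw => u1 u2 Cw.
have /and3P[Uw Pw _] := Cw.
have nx : next (a :: u1 ++ b :: u2) a = head b u1 by rewrite /= ; case: (u1) => [|? ?] /=;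
  rewrite eqxx.
case: u1 Uw Pw Cw nx => [|x u1] Uw Pw Cw nx; first by rewrite /cadj nx eqxx.
case: u2 Uw Pw Cw nx => [|y u2] Uw Pw Cw nx.
  have pv := @prev_cat _ [::] a _ Uw; rewrite /= last_cat /= in pv.
  by have := next_prev Uw a; rewrite [prev _ _]pv /cadj => ->; rewrite eqxx orbT.
exfalso; pose c := a :: (x :: u1) ++ [:: b].
have Cc : is_cycle_seq c.
  apply/and3P; split; last by rewrite /c /= size_cat /=; lia.
    by move: Uw; rewrite -(cat1s b) catA -cat_cons cat_uniq => /andP[].
  have pc : path e a ((x :: u1) ++ [:: b]).
    by move: Pw; rewrite /cycle -(cat1s b) catA rcons_cat cat_path => /andP[].
  by rewrite /c /cycle rcons_path pc last_cat /= adj_sym.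
have E := cact Cw Cc (mem_head _ _) _ (mem_head _ _).
have {}E := E x; rewrite /cadj nx /= !eqxx in E.
have [/setP/(_ y)] := E isT isT; rewrite !inE !mem_cat !inE eqxx !orbT.
have : y \notin c.
  move: Uw; rewrite -(cat1s b) catA -cat_cons cat_uniq => /and3P[_ /norP[h _] _].
  by rewrite /= in h; rewrite /c.
by rewrite /c !inE !mem_cat !inE => /negPf->.
Qed.

(** Following the cycle from [x] through [y] outside the present vertices, the
    first return must be to [x] because there are no ears; so the cycle is a new
    block, and chords and further edges to old vertices are impossible. *)
Lemma grow_cycle r D x y c : decomp r D -> bridges_ok D -> x \in verts r D -> y \notin verts r D ->
  is_cycle_seq c -> x \in c -> cadj c x y ->
  exists s, [/\ decomp r ((x, s) :: D), bridges_ok ((x, s) :: D) & 1 < size s].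
Proof.
move=> d ok xV yV Cc xc xy.
have [w [Cw _ _]] := cyc_seq_edge Cc xc xy; clear Cc xc xy c.
have /and3P[Uw Pw Sw] := Cw.
have out : ~~ has (mem (verts r D)) (y :: w).
  apply/negP => h; have [t1 [z [t2 [E zV nt1]]]] : exists t1 z t2,
      [/\ y :: w = rcons t1 z ++ t2, z \in verts r D & ~~ has (mem (verts r D)) t1].
    by case/split_find: h => z t1 t2 zV nt1; exists t1, z, t2.
  have t1n : 0 < size t1 by case: t1 E {nt1} => [|//] [yz _]; rewrite yz zV in yV.
  rewrite E in Pw Uw; apply: (@no_ear r D x z t1 d ok xV zV) => //.
  - by apply: contraTneq Uw => ->; rewrite /= mem_cat mem_rcons mem_head.
  - by move: Uw; rewrite /= cat_uniq rcons_uniq => /andP[_ /andP[/andP[_ ->]]].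
  - by move: Pw; rewrite /= rcons_cat cat_path => /andP[].
exists (y :: w); split=> //; last first.
  move=> b u v; rewrite inE => /orP[/eqP->|bD]; last exact: ok.
  by rewrite /is_cycle_block /= => h; move: Sw h => /=; lia.
split=> //; split=> //; first by case/andP: Uw.
move=> a b as_ bV; rewrite -[(x, y :: w).1 :: _]/([:: x, y & w]).
have ac : a \in [:: x, y & w] by rewrite inE [a \in _]as_ orbT.
apply/idP/andP => [ab|[bc]]; last exact: cyc_seq_adj.
have [bc|nbc] := boolP (b \in [:: x, y & w]); first by split=> //; apply: chordless.
exfalso; have bD : b \in verts r D.
  by move: bV nbc; rewrite mem_cat inE negb_or => /orP[->|//] /andP[].
have xb : x != b by apply: contraNneq nbc => <-; rewrite mem_head.
rewrite /= in as_; case/splitPr: as_ Uw Pw out => t1 t2 Uw Pw out.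
apply: (@no_ear r D x b (rcons t1 a) d ok xV bD xb); first by rewrite size_rcons.
- by move: Uw; rewrite /= -cat_rcons cat_uniq => /and3P[_].
- by move: out; rewrite -cat_rcons has_cat negb_or => /andP[].
- by move: Pw; rewrite /= -cat_rcons rcons_cat cat_path !rcons_path last_rcons ab => /andP[->].
Qed.

Lemma grow_edge r D x y : decomp r D -> bridges_ok D -> x \in verts r D ->
  y \notin verts r D -> e x y ->
  (forall c, is_cycle_seq c -> x \in c -> ~~ cadj c x y) ->
  decomp r ((x, [:: y]) :: D) /\ bridges_ok ((x, [:: y]) :: D).
Proof.
move=> d ok xV yV xy nc.
have nxy : x != y by apply: contraTneq xy => ->; rewrite adj_irr.
have cad : cadj [:: x; y] y x by rewrite /cadj /= [y == x]eq_sym (negPf nxy) !eqxx.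
split; last first.
  move=> b u v; rewrite inE => /orP[/eqP->|bD]; last exact: ok.
  move=> _ /= ub uv c Cc uc; apply/negP => uvc.
  have uv' : u != v by apply: contraTneq uv => <-; rewrite cadj_irr //= ?inE ?nxy.
  have /andP[_ vb] := cadj_mem uv uv'.
  have : (u == x) && (v == y) || (u == y) && (v == x).
    by move: ub vb uv'; rewrite !inE => /orP[]/eqP-> /orP[]/eqP->; rewrite ?eqxx ?orbT.
  case/orP => /andP[/eqP eu /eqP ev]; subst u v; first by have := nc c Cc uc; rewrite uvc.
  have /and3P[U _ _] := Cc.
  have xc : x \in c by have := cadj_mem uvc; rewrite eq_sym nxy => /(_ isT) /andP[].
  by have := nc c Cc xc; rewrite cadj_sym uvc.
split=> //; split=> //; first by rewrite /= orbF.
move=> a b; rewrite inE => /eqP-> {a}; rewrite /= inE => /orP[/eqP->|bD].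
  by rewrite adj_irr cadj_irr ?andbF //= ?inE ?nxy ?eqxx ?orbT.
rewrite !inE; case: (eqVneq b x) => [->|bx] /=; first by rewrite adj_sym xy cad.
case: (eqVneq b y) => [eb|_] /=; first by rewrite -eb bD in yV.
apply/negP => yb; apply: (@no_ear r D x b [:: y] d ok xV bD) => //=; rewrite ?xy ?yb ?orbF //.
by rewrite eq_sym.
Qed.

Lemma exit_edge r D z : z \notin verts r D -> exists x y, [/\ x \in verts r D,
  y \notin verts r D & e x y].
Proof.
move=> zV; have /connectP[q pq lq] := conn r z; rewrite lq in zV.
have gen x : path e x q -> last x q \notin verts r D -> x \in verts r D ->
    exists x y, [/\ x \in verts r D, y \notin verts r D & e x y].
  elim: q x {pq lq zV} => [|w q IH] x /=; first by move=> _ /negP.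
  move=> /andP[xw pq] lq xV; have [wV|wV] := boolP (w \in verts r D); first exact: IH pq lq wV.
  by exists x, w.
exact: gen pq zV (root_mem r D).
Qed.

Lemma grow_full r D : decomp r D -> bridges_ok D ->
  exists E, [/\ decomp r (E ++ D), bridges_ok (E ++ D) & forall x, x \in verts r (E ++ D)].
Proof.
have [n] := ubnP (#|G| - size (verts r D)).
elim: n D => // n IH D le d ok.
have [/forallP full|/forallPn[z zV]] := boolP [forall x, x \in verts r D]; first by exists [::].
have [x [y [xV yV xy]]] := exit_edge zV.
have step s : 0 < size s -> decomp r ((x, s) :: D) -> bridges_ok ((x, s) :: D) ->
  exists E, [/\ decomp r (E ++ D), bridges_ok (E ++ D) & forall x, x \in verts r (E ++ D)].
  move=> s0 d' ok'; have [|E [h1 h2 h3]] := IH _ _ d' ok'; last first.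
    by exists (rcons E (x, s)); rewrite cat_rcons.
  have : size (verts r D) < #|G|.
    have U := verts_uniq d; rewrite -(card_uniqP U); apply/proper_card/properP.
    by split; [apply/subsetP | exists z].
  by move: le; rewrite /= size_cat; lia.
have [/existsP[H /andP[HC xyH]]|nH] := boolP [exists H, (H \in cycles G) && ([set x; y] \in H.2)].
  have [c Cc E] := mem_cycles _ HC; rewrite E /= mem_cycle_edges in xyH; last by case/and3P: Cc.
  case/andP: xyH => xc xyc.
  have [s [d' ok' s1]] := grow_cycle d ok xV yV Cc xc xyc.
  by apply: step d' ok'; lia.
have [|d' ok'] := grow_edge d ok xV yV xy; last exact: step d' ok'.
move=> c Cc xc; apply: contra nH => xyc; apply/existsP; exists (cycle_sub c).
apply/andP; split; first by apply/mem_cycles; exists c.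
by rewrite /= mem_cycle_edges ?xc //; case/and3P: Cc.
Qed.

(** The root is chosen on a cycle so that the first block is a cycle: every later
    bridge then has a cycle to be charged to. *)
Lemma grow_from r : (exists2 c, is_cycle_seq c & r \in c) ->
  exists E s, [/\ decomp r (rcons E (r, s)), bridges_ok (rcons E (r, s)),
    forall x, x \in verts r (rcons E (r, s)) & 1 < size s].
Proof.
move=> [c Cc rc]; have /and3P[Uc _ Sc] := Cc.
have rn : cadj c r (next c r) by rewrite /cadj eqxx.
have nr : next c r \notin verts r [::].
  rewrite /= inE; apply: contraTneq rn => ->; rewrite cadj_irr //; exact: ltnW.
have [|s [d ok s1]] := grow_cycle (D := [::]) I _ (mem_head _ _) nr Cc rc rn; first by [].
have [E [h1 h2 h3]] := grow_full d ok.
by exists E, s; rewrite -cats1.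
Qed.
End Growth.

Lemma cactus_connect (G : sgraph) : cactus G -> forall x y : G, connect (@adj G) x y.
Proof.
move=> /andP[/eqP c1 _] x y.
have sym : connect_sym (@adj G) by apply/sym_connect_sym/adj_sym.
have /card_le1_eqP h : n_comp (@adj G) G <= 1 by rewrite c1.
have : root (@adj G) x = root (@adj G) y by apply: h; rewrite inE /= roots_root.
by move=> E; rewrite -(root_connect sym) E.
Qed.

Lemma cactus_uniq (G : sgraph) : cactus G -> forall c c' (x y : G), is_cycle_seq c ->
  is_cycle_seq c' ->
  x \in c -> cadj c x y -> x \in c' -> cadj c' x y -> cycle_sub c = cycle_sub c'.
Proof.
move=> /andP[_ /forallP h] c c' x y Cc Cc' xc xyc xc' xyc'.
have xy := cyc_seq_adj Cc xc xyc.
have exy : [set x; y] \in edges G by apply/imsetP; exists (x, y); rewrite ?inE.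
have /implyP/(_ exy) := h [set x; y].
move/card_le1_eqP; apply; rewrite inE /= mem_cycle_edges ?xc ?xc' ?xyc ?xyc' ?andbT;
  try by case/and3P: Cc; case/and3P: Cc'.
- by apply/mem_cycles; exists c'.
- by apply/mem_cycles; exists c.
Qed.

(** * A quadratic form in the extra vertices *)

Section Arith.
Implicit Types (k : nat) (f g : nat -> nat) (kap : nat -> nat -> nat).

Definition tsum k f := \sum_(i < k) f i.
Definition lin k f g := \sum_(i < k) f i * g i.
Definition quad k kap f := \sum_(i < k) \sum_(j < k) kap i j * (f i * f j).

Lemma floor_quarter x y e c : 1 <= c ->
  c * ((x + y + e) ^ 2) <= 4 * c * ((x + y + e) ^ 2 %/ 4) + c * odd (x + y + e).
Proof.
move=> c1; set F := x + y + e.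
suff : F ^ 2 <= 4 * (F ^ 2 %/ 4) + odd F by nia.
have h := odd_double_half F; rewrite -mul2n in h.
set a := F./2 in h; case: (odd F) h => /= h.
  have -> : F ^ 2 = a * (a + 1) * 4 + 1 by rewrite -h; nia.
  by rewrite divnDl ?dvdn_mull // mulnK //; lia.
have -> : F ^ 2 = a * a * 4 by rewrite -h; nia.
by rewrite mulnK //; lia.
Qed.

(** With [F = x + y + e], the difference of the two sides is at least
    [(c - 1) * ((x - y) ^ 2 - 1) + e ^ 2 + (c - 2) * e + 2 * e * (x + y)] for odd
    [F], and the same without the [- 1] for even [F]. *)
Lemma quad_arith c x y e T : 2 <= c ->
  T + (c - 2) * (x ^ 2 + y ^ 2 + e) <= c * (x + y + e) ^ 2 + 2 * c * (x * y) ->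
  T <= 2 * (x + y + e) ^ 2 + 4 * (c - 1) * ((x + y + e) ^ 2 %/ 4).
Proof.
move=> c2 hT; have [d ec] : exists d, c = d + 2 by exists (c - 2); lia.
subst c.
have h := @floor_quarter x y e (d + 1) (leq_addl _ _).
have -> : d + 2 - 1 = d + 1 by lia.
have d2 : d + 2 - 2 = d by lia.
rewrite d2 in hT.
suff key : 2 * (d + 2) * (x * y) + (d + 1) * odd (x + y + e) <=
   (x + y + e) ^ 2 + d * (x ^ 2 + y ^ 2 + e) by nia.
(* [t + t + z] has the parity of the imbalance [z] *)
have o t z : odd (t + t + z + e) <= z * z + e * e /\ odd (t + t + z + e) <= z * z + e.
  rewrite addnn -addnA oddD odd_double /=; case: (posnP z) => [->|z0].
    rewrite add0n; case: (posnP e) => [->|e0] //.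
    have h1 := leq_b1 (odd e); have h2 : 0 < e * e by rewrite muln_gt0 e0.
    by split; lia.
  have h2 : 0 < z * z by rewrite muln_gt0 z0.
  by have h1 := leq_b1 (odd (z + e)); split; lia.
have fin t z o' : o' <= z * z + e * e -> o' <= z * z + e ->
    2 * (d + 2) * (t * (t + z)) + (d + 1) * o' <=
      (t + t + z + e) * (t + t + z + e) + d * (t * t + (t + z) * (t + z) + e).
  move=> h1 h2; have h3 : d * o' <= d * (z * z + e) by rewrite leq_mul2l h2 orbT.
  by lia.
rewrite -!mulnn; case: (leqP x y) => [/subnKC <- | /ltnW/subnKC <- ]; set z := _ - _.
  have [o1 o2] := o x z; rewrite [x + _ + e](_ : _ = x + x + z + e); [exact: fin|lia].
have [o1 o2] := o y z; rewrite [y + _ + _ + e](_ : _ = y + y + z + e); last lia.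
by rewrite [(y + z) * y]mulnC [_ * (y + z) + y * y]addnC; apply: fin.
Qed.

Lemma sum_delta k h (g : nat -> nat) : h < k -> \sum_(i < k) (i == h :> nat) * g i = g h.
Proof.
move=> hk; rewrite (bigD1 (Ordinal hk)) //= eqxx mul1n big1 ?addn0 // => i ih.
by case: eqP => // e; case/eqP: ih; apply: val_inj.
Qed.

Lemma sq_ge_two k f a b : a < k -> b < k -> a != b ->
  f a ^ 2 + f b ^ 2 + tsum k f <= \sum_(i < k) f i ^ 2 + f a + f b.
Proof.
move=> ak bk ab; have ha := sum_delta (fun i => f i ^ 2) ak;
  have hb := sum_delta (fun i => f i ^ 2) bk.
have ha' := sum_delta f ak; have hb' := sum_delta f bk.
rewrite -{1}ha -{1}hb -ha' -hb' /tsum -!big_split /=; apply: leq_sum => i _.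
by case: (eqVneq (i : nat) a) => [->|_]; [rewrite (negPf ab)|case: (_ == b)] => /=; nia.
Qed.

(** Only the pair [a], [b] has the full weight [2 * c], all other pairs at most
    half of it. So the form is largest when all of [f] is split evenly between
    [a] and [b]: moving weight elsewhere costs more than an imbalance can save. *)
Lemma quad_bound k kap f a b c : 2 <= c -> a < k -> b < k -> a != b ->
  (forall i, i < k -> kap i i = 2) ->
  (forall i j, i < k -> j < k -> i != j -> kap i j <= 2 * c) ->
  (forall i j, i < k -> j < k -> i != j -> ~~ ((i == a) && (j == b) || (i == b) && (j ==
    a)) -> kap i j <= c) ->
  quad k kap f <= 2 * tsum k f ^ 2 + 4 * (c - 1) * (tsum k f ^ 2 %/ 4).
Proof.
move=> c2 ak bk ab kii k2 k1.
have sq := sq_ge_two f ak bk ab.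
have tot : exists e, tsum k f = f a + f b + e.
  exists (tsum k f - (f a + f b)); suff : f a + f b <= tsum k f by lia.
  rewrite -(sum_delta f ak) -(sum_delta f bk) /tsum -big_split; apply: leq_sum => i _ /=.
  by case: (eqVneq (i : nat) a) => [->|_]; [rewrite (negPf ab)|case: (_ == b)] => /=; lia.
case: tot => e tot; rewrite tot in sq *; apply: quad_arith => //; rewrite -tot.
apply: (@leq_trans (quad k kap f + (c - 2) * \sum_(i < k) f i ^ 2)).
  by rewrite leq_add2l leq_mul2l; apply/orP; right; lia.
have -> : c * tsum k f ^ 2 = \sum_(i < k) \sum_(j < k) c * (f i * f j).
  rewrite expnSr expn1 big_distrlr /= big_distrr /=; apply: eq_bigr => i _; by rewrite big_distrr.
have -> : (c - 2) * (\sum_(i < k) f i ^ 2) = \sum_(i < k) \sum_(j < k) (j ==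
  i :> nat) * ((c - 2) * (f i * f j)).
  rewrite big_distrr; apply: eq_bigr => i _ /=.
  by rewrite (sum_delta (fun j => (c - 2) * (f i * f j))) // expnSr expn1.
have -> : 2 * c * (f a * f b) = \sum_(i < k) \sum_(j < k)
    ((i == a :> nat) * ((j == b :> nat) * (c * (f i * f j))) + (i == b :> nat) * ((j ==
      a :> nat) * (c * (f i * f j)))).
  under eq_bigr => i _ do rewrite big_split /= -!big_distrr /=.
  rewrite big_split /= (sum_delta (fun i => \sum_(j < k) (j == b :> nat) * (c * (f i * f j)))) //.
  rewrite (sum_delta (fun i => \sum_(j < k) (j == a :> nat) * (c * (f i * f j)))) //.
  rewrite (sum_delta (fun j => c * (f a * f j))) // (sum_delta (fun j => c * (f b * f j))) //.
  nia.
rewrite /quad -!big_split /=; apply: leq_sum => i _; rewrite -!big_split /=; apply: leq_sum => j _.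
case: (eqVneq (j : nat) i) => [->|ji].
  rewrite kii //; move: (f i * f i) => z; nia.
have ij : (i : nat) != j by rewrite eq_sym.
have := k2 i j (ltn_ord i) (ltn_ord j) ij; have := k1 i j (ltn_ord i) (ltn_ord j) ij.
move: (f i * f j) (kap i j) => z w h1 h2; rewrite mul0n addn0.
set A := ((i : nat) == a) && ((j : nat) == b) in h1;
  set B := ((i : nat) == b) && ((j : nat) == a) in h1.
have -> : (i == a :> nat) * ((j == b :> nat) * (c * z)) + (i == b :> nat) * ((j ==
  a :> nat) * (c * z)) = (A + B) * c * z.
  by rewrite !mulnA !mulnb -!mulnDl.
rewrite -mulnDl leq_mul2r; apply/orP; right.
case: A B h1 h2 => [] [] /= h1 h2; try (have := h1 isT); lia.
Qed.

End Arith.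

(** * The upper bound *)

Section Bound.
Variable G : sgraph.
Local Notation e := (@adj G).
Implicit Types (D : seq (G * seq G)) (r p u v x y : G) (s : seq G).

(** Path numbers are powers of two, so a value below the maximum is at most half
    of it. *)
Definition half_or_full m z := (z == m) || (2 * z <= m).

Lemma half_or_full_le m z : half_or_full m z -> z <= m.
Proof. by case/orP; lia. Qed.

Lemma half_or_full_double m z : half_or_full m z -> half_or_full (2 * m) (2 * z).
Proof. by rewrite /half_or_full; lia. Qed.

Lemma half_or_full_old m z : half_or_full m z -> half_or_full (2 * m) z.
Proof. by rewrite /half_or_full; lia. Qed.

Lemma half_or_full1 m z : 0 < m -> z <= 1 -> half_or_full m z.
Proof. by rewrite /half_or_full; lia. Qed.

Lemma ncycles_cons p s D : ncycles ((p, s) :: D) = (1 < size s) + ncycles D.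
Proof. by []. Qed.

Lemma bmul_cyc s : 1 < size s -> block_npaths s = 2.
Proof. by rewrite /block_npaths => ->. Qed.

Lemma npaths_half_or_full r D u v : decomp r D -> u \in verts r D -> v \in verts r D ->
  half_or_full (2 ^ ncycles D) (npaths (verts r D) u v).
Proof.
elim: D u v => [|[p s] D IH] u v.
  by move=> _; rewrite !inE => /eqP-> /eqP->; rewrite npaths_self ?inE.
move=> d; have dD := step_decomp d; have pV := step_p d.
have e0 : 0 < 2 ^ ncycles D by rewrite expn_gt0.
have N1 a b : a \in verts r D -> b \in s ->
    half_or_full (2 ^ ncycles ((p, s) :: D)) (npaths (verts r ((p, s) :: D)) a b).
  move=> aV bs; rewrite (npaths_new d) // ncycles_cons mulnC /block_npaths expnD.
  by case: ifP => _; rewrite ?mul1n; [apply: half_or_full_double|]; apply: IH.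
have e1 : 0 < 2 ^ ncycles ((p, s) :: D) by rewrite expn_gt0.
rewrite [verts r _]/= !mem_cat => /orP[us|uV] /orP[vs|vV].
- rewrite (npaths_new2 d) //; case: eqP => uv; first exact: half_or_full1.
  rewrite ncycles_cons /block_npaths; case: ifP => h; last exact: half_or_full1.
  by rewrite -[X in half_or_full _ X]muln1 expnD; apply: half_or_full_double; apply: half_or_full1.
- by rewrite npaths_sym; apply: N1.
- exact: N1.
rewrite (npaths_old d) // ncycles_cons expnD; have := IH u v dD uV vV.
by case: (1 < size s); rewrite ?mul1n //; apply: half_or_full_old.
Qed.

(** The invariant of the growth, for [k = ncycles D]. Here [K u j] stands for the
    number of simple paths from [u] to a generic new vertex of the cycle block
    number [j], and [kap i j] for that between generic new vertices of the blocks
    [i] and [j]. The function [f] distributes the extra vertices: those of a cycle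
    block beyond its first two new ones, and the ends of bridges, which
    [inv_home] charges to a cycle block [h] that is as far as the attachment
    vertex from everything else, or farther. The number [wo u] bounds what
    [npaths_from] would be without extra vertices. In [inv_Q] the left constants
    are those of chains of triangles, where equality holds with [f] zero; the last
    field makes the bound strict unless there are no bridges and some simple path
    crosses all cycles. *)
Record growth_bound r D (K : G -> nat -> nat) (kap : nat -> nat -> nat) (f : nat ->
  nat) (wo : G -> nat) : Prop := GrowthBound {
  inv_size : size (verts r D) = 2 * ncycles D + 1 + tsum (ncycles D) f;
  inv_K : forall u j, u \in verts r D -> j < ncycles D -> half_or_full (2 ^ ncycles D) (K u j);
  inv_Kuniq : forall u i j, u \in verts r D -> i < ncycles D -> j < ncycles D ->
    K u i = 2 ^ ncycles D -> K u j = 2 ^ ncycles D -> i = j;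
  inv_home : forall v, v \in verts r D -> 0 < ncycles D -> exists2 h, h < ncycles D &
    (forall u, u \in verts r D -> npaths (verts r D) u v <= K u h) /\
    (forall j, j < ncycles D -> K v j <= kap j h);
  inv_sym : forall i j, kap i j = kap j i;
  inv_diag : forall i, i < ncycles D -> kap i i = 2;
  inv_kap : forall i j, i < j < ncycles D -> half_or_full (2 ^ ncycles D) (kap i j);
  inv_kuniq : forall i j i' j', i < j < ncycles D -> i' < j' < ncycles D ->
    kap i j = 2 ^ ncycles D -> kap i' j' = 2 ^ ncycles D -> i = i' /\ j = j';
  inv_W : forall u, u \in verts r D -> npaths_from r D u <= wo u + lin (ncycles D) f (K u);
  inv_wo : forall u, u \in verts r D -> wo u + 3 <= 4 * 2 ^ ncycles D;
  inv_full : forall u, u \in verts r D -> wo u + 3 = 4 * 2 ^ ncycles D ->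
    exists2 v, v \in verts r D & npaths (verts r D) u v = 2 ^ ncycles D;
  inv_Q : npaths_total r D + size (verts r D) + 30 + 16 * ncycles D + 4 * tsum (ncycles D) f
      <= 32 * 2 ^ ncycles D + 8 * 2 ^ ncycles D * tsum (ncycles D) f + quad (ncycles D) kap f;
  inv_strict : (all (@is_cycle_block _) D /\ exists u v, [/\ u \in verts r D, v \in verts r D &
      npaths (verts r D) u v = 2 ^ ncycles D]) \/
    npaths_total r D + size (verts r D) + 30 + 16 * ncycles D + 4 * tsum (ncycles D) f
      < 32 * 2 ^ ncycles D + 8 * 2 ^ ncycles D * tsum (ncycles D) f + quad (ncycles D) kap f
}.

Lemma inv_nil r : exists K kap f wo, growth_bound r [::] K kap f wo.
Proof.
exists (fun _ _ => 0), (fun _ _ => 0), (fun _ => 0), (fun _ => 1).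
have W1 : npaths_from r [::] r = 1 by rewrite /npaths_from /= big_seq1 npaths_self ?inE.
have Q1 : npaths_total r [::] = 1 by rewrite /npaths_total /= big_seq1.
have rV : r \in verts r [::] by rewrite /= inE.
split=> //=; rewrite /tsum /lin /quad ?big_ord0 //; rewrite ?Q1 //.
- by move=> u; rewrite inE => /eqP->; rewrite W1.
- by move=> u; rewrite inE => /eqP-> _; exists r; rewrite ?inE ?npaths_self ?inE.
- by left; split=> //; exists r, r; rewrite ?inE ?npaths_self ?inE.
Qed.

(** Extensions by the data of one more cycle block, which gets number [k]. *)
Definition extend k (g : nat -> nat) z j := if j == k then z else g j.
Definition extend2 k (kap : nat -> nat -> nat) (g : nat -> nat) z i j :=
  if i == k then extend k g z j else if j == k then g i else kap i j.

Lemma tsum_ext k f z : tsum k.+1 (extend k f z) = tsum k f + z.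
Proof.
rewrite /tsum big_ord_recr /= /extend eqxx; congr (_ + _); apply: eq_bigr => i _.
by rewrite ltn_eqF.
Qed.

Lemma lin_ext k f z g w : lin k.+1 (extend k f z) (extend k g w) = lin k f g + z * w.
Proof.
rewrite /lin big_ord_recr /= /extend eqxx; congr (_ + _); apply: eq_bigr => i _.
by rewrite ltn_eqF.
Qed.

Lemma quad_ext k kap g z f w :
  quad k.+1 (extend2 k kap g z) (extend k f w) = quad k kap f + 2 * w * lin k f g + z * w * w.
Proof.
have E (F : nat -> nat -> nat) : \sum_(i < k.+1) \sum_(j < k.+1) F i j =
    \sum_(i < k) \sum_(j < k) F i j + \sum_(i < k) F i k + (\sum_(j < k) F k j + F k k).
  rewrite big_ord_recr /= big_ord_recr /=; congr (_ + _).
  by rewrite -big_split; apply: eq_bigr => i _; rewrite big_ord_recr.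
rewrite /quad (E (fun i j => extend2 k kap g z i j * (extend k f w i * extend k f w j))).
have -> : \sum_(i < k) \sum_(j < k) extend2 k kap g z i j * (extend k f w i * extend k f w j) =
  quad k kap f.
  by apply: eq_bigr => i _; apply: eq_bigr => j _; rewrite /extend2 /extend !ltn_eqF.
have -> : \sum_(i < k) extend2 k kap g z i k * (extend k f w i * extend k f w k) = w * lin k f g.
  rewrite /lin big_distrr /=; apply: eq_bigr => i _; rewrite /extend2 /extend eqxx ltn_eqF //; lia.
have -> : \sum_(i < k) extend2 k kap g z k i * (extend k f w k * extend k f w i) = w * lin k f g.
  rewrite /lin big_distrr /=; apply: eq_bigr => i _; rewrite /extend2 /extend eqxx ltn_eqF //; lia.
by rewrite /extend2 /extend eqxx /quad; lia.
Qed.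

Lemma lin_le k f g b : (forall j, j < k -> g j <= b) -> lin k f g <= b * tsum k f.
Proof.
by move=> h; rewrite /lin /tsum big_distrr /=; apply: leq_sum => i _;
  rewrite mulnC leq_mul2r h ?orbT.
Qed.

Lemma lin_double k f g : lin k f (fun j => 2 * g j) = 2 * lin k f g.
Proof. by rewrite /lin big_distrr /=; apply: eq_bigr => i _; lia. Qed.

(** A cycle block with [2 + m] new vertices at [p] contributes to the quadratic
    form the row [2 * K p j] with weight [m]. The remaining contributions are
    linear in the extra vertices and are largest when [K p j = 2 ^ k] and when
    [wo p] attains its bound; the latter forces a vertex joined to [p] by
    [2 ^ k] paths, hence a new path that crosses all cycles. *)
Lemma inv_cycle r p s D K kap f wo : decomp r ((p, s) :: D) -> 1 < size s ->
  (ncycles D = 0 -> D = [::]) -> growth_bound r D K kap f wo ->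
  exists K' kap' f' wo', growth_bound r ((p, s) :: D) K' kap' f' wo'.
Proof.
move=> d s1 D0 I; set k := ncycles D.
have dD := step_decomp d; have pV := step_p d; have b2 := bmul_cyc s1.
have nc : ncycles ((p, s) :: D) = k.+1 by rewrite ncycles_cons s1.
pose V := verts r D; pose V' := verts r ((p, s) :: D).
pose m := size s - 2; have ms : size s = m + 2 by rewrite /m; lia.
pose K' u := if u \in s then extend k (fun j => 2 * K p j) 2 else extend k (K u) (2 * npaths V u p).
pose kap' := extend2 k kap (fun j => 2 * K p j) 2.
pose wo' u := if u \in s then 2 * wo p + 3 else wo u + 4 * npaths V u p.
have snew u : u \in V -> (u \in s) = false by move=> uV; apply: contraTF uV => /(step_new d).
have V'E u : (u \in V') = (u \in s) || (u \in V) by rewrite /V' /= mem_cat.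
have npx := npaths_half_or_full dD.
have x0 : 0 < 2 ^ k by rewrite expn_gt0.
have e2 : 2 ^ k.+1 = 2 * 2 ^ k by rewrite expnS.
have full2 z : half_or_full (2 ^ k) z -> z <> 2 * 2 ^ k by case/orP; lia.
have Wold u : u \in V -> npaths_from r ((p, s) :: D) u =
  npaths_from r D u + 2 * (m + 2) * npaths V u p.
  by move=> uV; rewrite npaths_from_old // b2 ms.
have Wnew u : u \in s -> npaths_from r ((p, s) :: D) u = 2 * npaths_from r D p + 2 * (m + 1) + 1.
  by move=> us; rewrite npaths_from_new // b2 ms; congr (_ + _ * _ + _); lia.
have Wp := inv_W I pV; have wop := inv_wo I pV.
have linp : lin k f (K p) <= 2 ^ k * tsum k f.
  by apply: lin_le => j jk; apply: half_or_full_le; apply: (inv_K I).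
have Q' : npaths_total r ((p, s) :: D) = npaths_total r D + 4 * (m + 2) * npaths_from r D p + (m
  + 2) * (2 * (m + 1) + 1).
  by rewrite npaths_total_step // b2 ms; congr (_ + _ * _ + _ * (_ * _ + _)); lia.
have sz' : size V' = size V + (m + 2) by rewrite /V' /= size_cat ms addnC.
(* the new bound, with the slack of [wo p] kept for the strict case *)
have fin : npaths_total r ((p, s) :: D) + size V' + 30 + 16 * k.+1 + 4 * (tsum k f + m)
      + (32 * 2 ^ k + 8 * 2 ^ k * tsum k f + quad k kap f) + 8 * (4 * 2 ^ k - (wo p + 3))
   <= 32 * (2 * 2 ^ k) + 8 * (2 * 2 ^ k) * (tsum k f + m) + (quad k kap f + 2 * m * (2 * lin k f
     (K p)) + 2 * m * m)
      + (npaths_total r D + size V + 30 + 16 * k + 4 * tsum k f).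
  rewrite Q' sz'; move: Wp wop linp; rewrite -/k.
  move: (npaths_total r D) (npaths_from r D p) (wo p) (lin k f (K p)) (2 ^ k) (tsum k f) (quad k
    kap f) (size V) => Q W w l x F T S Wp wop linp.
  have : m * (w + 3) <= m * (4 * x) by rewrite leq_mul2l wop orbT.
  have : (m + 2) * W <= (m + 2) * (w + l) by rewrite leq_mul2l Wp orbT.
  lia.
exists K', kap', (extend k f m), wo'; split; rewrite ?nc -/V -/V' ?e2.
- rewrite tsum_ext sz' (inv_size I) -/k; lia.
- move=> u j; rewrite V'E ltnS leq_eqVlt => /orP[us|uV] jk; rewrite /K' /extend ?us ?snew //.
    case: eqP jk => [_ _|_ /= jk]; last by apply: half_or_full_double; apply: (inv_K I).
    by rewrite -[X in half_or_full _ X]muln1; apply: half_or_full_double; apply: half_or_full1.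
  case: eqP jk => [_ _|_ /= jk]; first by apply: half_or_full_double; apply: npx.
  by apply: half_or_full_old; apply: (inv_K I).
- move=> u i j; rewrite V'E !ltnS (leq_eqVlt i) (leq_eqVlt j) => /orP[us|uV] ik jk;
  rewrite /K' /extend ?us ?snew //; last first.
    case: eqP ik => [->|_] /= ik; case: eqP jk => [->|_] //= jk.
    + by move=> _ h; have := full2 _ (inv_K I uV jk).
    + by move=> h; have := full2 _ (inv_K I uV ik).
    + by move=> h; have := full2 _ (inv_K I uV ik).
  have aux i' : i' < k -> 2 * K p i' = 2 * 2 ^ k -> 2 <> 2 * 2 ^ k.
    by move=> h _; have : 1 < 2 ^ k; [rewrite -{1}[1](expn0 2) ltn_exp2l //; lia | lia].
  case: eqP ik => [->|_] /= ik; case: eqP jk => [->|_] //= jk.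
  + by move=> h1 h2; case: (aux _ jk h2).
  + by move=> h1 h2; case: (aux _ ik h1).
  by move=> h1 h2; apply: (inv_Kuniq I pV ik jk); rewrite -/k; lia.
- move=> v; rewrite V'E => /orP[vs|vV] _.
    exists k => //; split=> [u|j].
      rewrite V'E => /orP[us|uV].
        by rewrite (npaths_new2 d) // b2 /K' us /extend eqxx; case: ifP.
      by rewrite (npaths_new d) // b2 /K' snew // /extend eqxx mulnC.
    by rewrite ltnS leq_eqVlt /K' vs /kap' /extend2 /extend eqxx => /orP[/eqP->|jk];
      rewrite ?eqxx ?ltn_eqF.
  case: (posnP k) => k0.
    have D1 := D0 k0; have vr : v = r by apply/eqP; move: vV; rewrite /V D1 /= inE.
    have pr : p = r by apply/eqP; move: pV; rewrite D1 /= inE.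
    have np1 : npaths V r r = 1 by apply: npaths_self; rewrite -vr.
    exists 0; first by [].
    split=> [u|j].
      rewrite V'E => /orP[us|uV].
        by rewrite npaths_sym (npaths_new d) // b2 vr pr -/V np1 /K' us /extend k0.
      have ur : u = r by apply/eqP; move: uV; rewrite /V D1 /= inE.
      by rewrite (npaths_old d) // /K' snew // /extend k0 ur vr pr -/V np1.
    rewrite k0 ltnS leqn0 => /eqP->; rewrite /K' snew // /extend k0 vr pr np1.
    by rewrite /kap' /extend2 k0 /extend.
  have [h hk [h1 h2]] := inv_home I vV k0.
  exists h; first exact: ltnW.
  split=> [u|j].
    rewrite V'E => /orP[us|uV].
      rewrite npaths_sym (npaths_new d) // b2 /K' us /extend (ltn_eqF hk) npaths_sym mulnC
        leq_mul2l.
      exact: h1.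
    by rewrite (npaths_old d) // /K' snew // /extend (ltn_eqF hk) h1.
  rewrite ltnS leq_eqVlt /K' snew // /kap' /extend2 /extend (ltn_eqF hk) => /orP[/eqP->|jk];
    rewrite ?eqxx ?(ltn_eqF jk).
    by rewrite leq_mul2l npaths_sym h1.
  exact: h2.
- move=> i j; rewrite /kap' /extend2 /extend (inv_sym I).
  by case: (eqVneq i k); case: (eqVneq j k).
- move=> i; rewrite ltnS leq_eqVlt /kap' /extend2 /extend => /orP[/eqP->|ik]; first by rewrite eqxx.
  by rewrite ltn_eqF // (inv_diag I).
- move=> i j /andP[ij]; rewrite ltnS leq_eqVlt /kap' /extend2 /extend => /orP[/eqP ej|jk].
    by rewrite ej eqxx in ij *; rewrite ltn_eqF //; apply: half_or_full_double; apply: (inv_K I).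
  by rewrite !ltn_eqF //; [apply: half_or_full_old; apply: (inv_kap I);
    rewrite ij | apply: ltn_trans jk].
- have aux i j : i < j < k.+1 -> kap' i j = 2 * 2 ^ k -> [/\ j = k, i < k & K p i = 2 ^ k].
    move=> /andP[ij]; rewrite ltnS leq_eqVlt /kap' /extend2 /extend => /orP[/eqP ej|jk].
      by rewrite ej eqxx in ij *; rewrite ltn_eqF // => h; split=> //; lia.
    have ik : i < k by apply: ltn_trans jk.
    by rewrite !ltn_eqF // => h; have := full2 _ (inv_kap I (i := i) (j := j) _);
      rewrite ij jk h => /(_ isT).
  move=> i j i' j' ij ij' h h'; have [-> ik hi] := aux _ _ ij h; have [->
    ik' hi'] := aux _ _ ij' h'.
  by split=> //; apply: (inv_Kuniq I pV).
- move=> u; rewrite V'E => /orP[us|uV]; rewrite /K' /wo' ?us ?snew //.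
    rewrite Wnew // lin_ext lin_double; move: Wp; rewrite -/k; lia.
  rewrite Wold // lin_ext; have := inv_W I uV; rewrite -/k; lia.
- move=> u; rewrite V'E => /orP[us|uV]; rewrite /wo' ?us ?snew //; first by move: wop;
  rewrite -/k; lia.
  by have := half_or_full_le (npx u p uV pV); have := inv_wo I uV; rewrite -/k -/V; lia.
- move=> u; rewrite V'E => /orP[us|uV]; rewrite /wo' ?us ?snew // => E.
    have [|v vV hv] := inv_full I pV; first by rewrite -/k; lia.
    exists v; first by rewrite V'E vV orbT.
    by rewrite npaths_sym (npaths_new d) // b2 npaths_sym hv mulnC.
  have [w ws] : exists w, w \in s by case: (s) s1 => [|w ?] // _; exists w; rewrite mem_head.
  exists w; first by rewrite V'E ws.
  rewrite (npaths_new d) // b2 mulnC; congr (_ * _).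
  by have := half_or_full_le (npx u p uV pV); have := inv_wo I uV; rewrite -/k -/V; lia.
- rewrite tsum_ext quad_ext lin_double; have := inv_Q I; rewrite -/k -/V; move: fin wop; lia.
rewrite tsum_ext quad_ext lin_double.
case: (inv_strict I) => [[ac _]|h]; last by right; move: h fin; rewrite -/k -/V; lia.
have [E|E] := eqVneq (wo p + 3) (4 * 2 ^ k); last first.
  by right; have := inv_Q I; rewrite -/k -/V; move: fin wop E; rewrite -/k; lia.
left; split; first by rewrite /= ac andbT.
have [v vV hv] := inv_full I pV E.
have [w ws] : exists w, w \in s by case: (s) s1 => [|w ?] // _; exists w; rewrite mem_head.
exists v, w; split; rewrite ?V'E ?vV ?ws ?orbT //.
by rewrite (npaths_new d) // b2 npaths_sym hv mulnC.
Qed.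

Definition bump1 h (f : nat -> nat) j := f j + (j == h).

Lemma tsum_bump k h f : h < k -> tsum k (bump1 h f) = tsum k f + 1.
Proof.
move=> hk; rewrite /tsum /bump1 big_split /=; congr (_ + _).
by rewrite -(sum_delta (fun _ => 1) hk); apply: eq_bigr => i _; rewrite muln1.
Qed.

Lemma lin_bump k h f g : h < k -> lin k (bump1 h f) g = lin k f g + g h.
Proof.
move=> hk; rewrite /lin /bump1 -(sum_delta g hk) -big_split; apply: eq_bigr => i _ /=.
by rewrite mulnDl.
Qed.

Lemma quad_bump k kap h f : h < k -> (forall i j, kap i j = kap j i) ->
  quad k kap (bump1 h f) = quad k kap f + 2 * lin k f (kap^~ h) + kap h h.
Proof.
move=> hk sym; pose row i := \sum_(j < k) kap i j * f j.
have rowE i g : \sum_(j < k) kap i j * (g * f j) = g * row i.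
  by rewrite /row big_distrr /=; apply: eq_bigr => j _; lia.
have E i : \sum_(j < k) kap i j * (bump1 h f i * bump1 h f j) = bump1 h f i * (row i + kap i h).
  rewrite mulnDr -rowE -(sum_delta (fun j => bump1 h f i * kap i j) hk) -big_split.
  by apply: eq_bigr => j _; rewrite /bump1 /=; case: (_ == h); case: (_ == h) => /=; lia.
have rowh : row h = lin k f (kap^~ h).
  by apply: eq_bigr => i _; rewrite sym mulnC.
rewrite /quad (eq_bigr (fun i : 'I_k => bump1 h f i * (row i + kap i h))) => [|i _]; last exact: E.
rewrite [LHS](lin_bump f (fun i => row i + kap i h) hk) rowh.
have -> : lin k f (fun i => row i + kap i h) =
  \sum_(i < k) \sum_(j < k) kap i j * (f i * f j) + lin k f (kap^~ h).
  rewrite /lin -big_split /=; apply: eq_bigr => i _; rewrite rowE; lia.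
lia.
Qed.

(** The end of a bridge at [p] sees every other vertex through [p], hence by no
    more paths than an additional vertex of the home cycle of [p] would; its
    distance to [p] itself is smaller, which makes the bound strict. *)
Lemma inv_bridge r p s D K kap f wo : decomp r ((p, s) :: D) -> ~~ (1 < size s) -> 0 < ncycles D ->
  growth_bound r D K kap f wo -> exists K' kap' f' wo', growth_bound r ((p, s) :: D) K' kap' f' wo'.
Proof.
move=> d s1 k0 I; set k := ncycles D.
have dD := step_decomp d; have pV := step_p d.
have sz1 : size s = 1 by have := step_size d; lia.
have b1 : block_npaths s = 1 by rewrite /block_npaths (negPf s1).
have nc : ncycles ((p, s) :: D) = k by rewrite ncycles_cons (negPf s1).
pose V := verts r D; pose V' := verts r ((p, s) :: D).
have snew u : u \in V -> (u \in s) = false by move=> uV; apply: contraTF uV => /(step_new d).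
have V'E u : (u \in V') = (u \in s) || (u \in V) by rewrite /V' /= mem_cat.
have [h hk [h1 h2]] := inv_home I pV k0; rewrite -/k in hk h2.
pose K' u := if u \in s then K p else K u.
pose wo' u := if u \in s then wo p else wo u.
have npold u v : u \in V -> v \in V -> npaths V' u v = npaths V u v by move=> uV vV;
  rewrite (npaths_old d).
have npnew u v : u \in V -> v \in s -> npaths V' u v = npaths V u p by move=> uV vs;
  rewrite (npaths_new d) // b1 muln1.
have npss u v : u \in s -> v \in s -> npaths V' u v = 1 by move=> us vs;
  rewrite (npaths_new2 d) // b1; case: eqP.
have nppp : npaths V p p = 1 by apply: npaths_self.
have Kph : 1 <= K p h by rewrite -nppp; apply: h1.
have Wold u : u \in V -> npaths_from r ((p, s) :: D) u = npaths_from r D u + npaths V u p.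
  by move=> uV; rewrite npaths_from_old // b1 sz1 !mul1n.
have Wnew u : u \in s -> npaths_from r ((p, s) :: D) u = npaths_from r D p + 1.
  by move=> us; rewrite npaths_from_new // b1 sz1; lia.
have Q' : npaths_total r ((p, s) :: D) = npaths_total r D + 2 * npaths_from r D p + 1 by rewrite
  npaths_total_step // b1 sz1; lia.
have sz' : size V' = size V + 1 by rewrite /V' /= size_cat sz1 addnC.
have fin : npaths_total r ((p, s) :: D) + size V' + 30 + 16 * k + 4 * (tsum k f + 1)
      < 32 * 2 ^ k + 8 * 2 ^ k * (tsum k f + 1) + (quad k kap f + 2 * lin k f (kap^~ h) + kap h h).
  have linp : lin k f (K p) <= lin k f (kap^~ h).
    by apply: leq_sum => j _; rewrite leq_mul2l h2 ?orbT.
  have := inv_Q I; have := inv_W I pV; have := inv_wo I pV;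
    rewrite (inv_diag I hk) Q' sz' -/k -/V; lia.
exists K', kap, (bump1 h f), wo'; split; rewrite ?nc -/V -/V' ?tsum_bump ?quad_bump //;
  try exact: (inv_sym I).
- rewrite sz' (inv_size I) -/k; lia.
- by move=> u j; rewrite V'E => /orP[us|uV] jk; rewrite /K' ?us ?snew //; apply: (inv_K I).
- move=> u i j; rewrite V'E => /orP[us|uV] ik jk; rewrite /K' ?us ?snew //; exact: (inv_Kuniq I).
- move=> v; rewrite V'E => /orP[vs|vV] _.
    exists h => //; split=> [u|j jk]; last by rewrite /K' vs h2.
    rewrite V'E => /orP[us|uV]; first by rewrite npss // /K' us.
    by rewrite npnew // /K' snew // h1.
  have [h' hk' [h1' h2']] := inv_home I vV k0; exists h' => //.
  split=> [u|j jk]; last by rewrite /K' snew // h2'.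
  rewrite V'E => /orP[us|uV]; last by rewrite npold // /K' snew // h1'.
  by rewrite npaths_sym npnew // npaths_sym /K' us h1'.
- exact: (inv_diag I).
- exact: (inv_kap I).
- exact: (inv_kuniq I).
- move=> u; rewrite V'E => /orP[us|uV]; rewrite /K' /wo' ?us ?snew // lin_bump //.
    by rewrite Wnew //; have := inv_W I pV; rewrite -/k; lia.
  by rewrite Wold //; have := inv_W I uV; have := h1 u uV; rewrite -/k -/V; lia.
- by move=> u; rewrite V'E => /orP[us|uV]; rewrite /wo' ?us ?snew //; apply: (inv_wo I).
- move=> u; rewrite V'E => /orP[us|uV]; rewrite /wo' ?us ?snew // => E.
    have [v vV hv] := inv_full I pV E; exists v; first by rewrite V'E vV orbT.
    by rewrite npaths_sym npnew // npaths_sym.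
  have [v vV hv] := inv_full I uV E; exists v; first by rewrite V'E vV orbT.
  by rewrite npold.
- exact: ltnW.
by right.
Qed.

Lemma inv_exists r p s E : 1 < size s -> decomp r (rcons E (p, s)) ->
  exists K kap f wo, growth_bound r (rcons E (p, s)) K kap f wo.
Proof.
move=> s1; elim: E => [|[q t] E IH] d.
  by have [K [kap [f [wo I]]]] := inv_nil r; apply: inv_cycle d s1 _ I.
have [K [kap [f [wo I]]]] := IH (step_decomp d).
have k0 : 0 < ncycles (rcons E (p, s)) by rewrite /ncycles -cats1 count_cat /=
  /is_cycle_block s1; lia.
rewrite rcons_cons in d *; have [t1|t1] := boolP (1 < size t); last exact: inv_bridge I.
by apply: inv_cycle d t1 _ I; lia.
Qed.

(** The maximum of [2 * pn G + 30 + 16 * k + 4 * F] over cacti with [2 <= k] cycles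
    and [2 * k + 1 + F] vertices; doubling and the added terms avoid
    subtraction. *)
Definition double_top F k := 32 * 2 ^ k + 8 * 2 ^ k * F + 2 * F ^ 2 + 4 * (2 ^ k.-1 - 1) * (F ^ 2
  %/ 4).

(** A path crossing all cycles has its two end cycles determined, so at most one
    pair of blocks has the full weight. *)
Lemma quad_top r D K kap f wo : 2 <= ncycles D -> growth_bound r D K kap f wo ->
  quad (ncycles D) kap f <= 2 * tsum (ncycles D) f ^ 2 + 4 * (2 ^ (ncycles D).-1 - 1) * (tsum
    (ncycles D) f ^ 2 %/ 4).
Proof.
move=> k2 I; set k := ncycles D; set c := 2 ^ k.-1.
have ec : 2 ^ k = 2 * c by rewrite /c -expnS prednK // /k; lia.
have c2 : 2 <= c by rewrite -[X in X <= _](expn1 2) leq_exp2l // /k; lia.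
have [a [b [ak bk ab ful]]] : exists a b, [/\ a < k, b < k, a != b &
   forall i j, i < j < k -> kap i j = 2 * c -> (i == a) && (j == b)].
  have [/existsP[a /existsP[b /andP[ab /eqP hab]]]|nf] :=
      boolP [exists a : 'I_k, exists b : 'I_k, (a < b) && (kap a b == 2 * c)].
    exists a, b; split=> // [|i j ij hij]; first by rewrite ltn_eqF.
    have abk : (a : nat) < (b : nat) < k by rewrite ab ltn_ord.
    by have [||-> ->] := inv_kuniq I (i := i) (j := j) (i' := a) (j' := b) ij abk;
      rewrite -/k ?ec ?eqxx.
  exists 0, 1; split=> //; [by rewrite /k; lia|] => i j /andP[ij jk] hij.
  case/existsP: nf; have ik := ltn_trans ij jk; exists (Ordinal ik); apply/existsP;
    exists (Ordinal jk).
  by rewrite /= ij hij eqxx.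
have lt2 i j : i < j -> j < k -> kap i j <= 2 * c /\ (~~ ((i == a) && (j == b)) -> kap i j <= c).
  move=> ij jk; have ijk : i < j < k by rewrite ij jk.
  have := inv_kap I ijk; rewrite -/k ec => /orP[/eqP E|E]; last by split; lia.
  by rewrite (ful _ _ ijk E) E.
apply: (@quad_bound k kap f a b c) => // [i ik|i j ik jk ij|i j ik jk ij].
- exact: (inv_diag I).
- case: (ltngtP i j) ij => // [ij|ji] _; first by have [] := lt2 _ _ ij jk.
  by rewrite (inv_sym I); have [] := lt2 _ _ ji ik.
rewrite negb_or => /andP[h1 h2].
case: (ltngtP i j) ij => // [ij|ji] _; first by have [_ ->] := lt2 _ _ ij jk.
by rewrite (inv_sym I); have [_ ->] := lt2 _ _ ji ik; rewrite // andbC.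
Qed.

Lemma pn_top r p s E : let D := rcons E (p, s) in 1 < size s -> decomp r D ->
  (forall x, x \in verts r D) ->
  2 <= ncycles D ->
  let F := #|G| - (2 * ncycles D + 1) in
  2 * ncycles D + 1 <= #|G| /\
  2 * pn G + 30 + 16 * ncycles D + 4 * F <= double_top F (ncycles D) /\
  (2 * pn G + 30 + 16 * ncycles D + 4 * F = double_top F (ncycles D) ->
   all (@is_cycle_block _) D /\ exists u v, npaths (verts r D) u v = 2 ^ ncycles D).
Proof.
move=> D s1 d full k2 F.
have [K [kap [f [wo I]]]] := inv_exists s1 d; rewrite -/D in I.
have U := verts_uniq d.
have sz : size (verts r D) = #|G| by rewrite -(card_uniqP U); apply: eq_card => x; rewrite full.
have pnE : 2 * pn G = npaths_total r D + size (verts r D) by rewrite sz (pn_double U) // => x;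
  rewrite full.
have FE : F = tsum (ncycles D) f by rewrite /F -sz (inv_size I); lia.
have q := quad_top k2 I; have Q := inv_Q I.
split; first by rewrite -sz (inv_size I); lia.
rewrite pnE FE /double_top; split; first lia.
move=> E0; case: (inv_strict I) => [[ac [u [v [_ _ h]]]]|]; last by lia.
by split=> //; exists u, v.
Qed.
End Bound.

(** * Arithmetic of chains of cycles *)

Section ChainArith.
Implicit Types (l : seq nat).

(** Along a chain of cycle blocks with [2 + f] new vertices each, [f] running
    through [l] with the latest block first, [chU l] and [chV l] are the parts that
    depend on [l] of the numbers of simple paths from a latest vertex and from the
    root; [chL l] and [chS l] are the linear and the quadratic part of the doubled
    number of paths. *)
Fixpoint chU l := if l is f :: l' then 2 * (chU l' + f) else 0.
Fixpoint chL l := if l is f :: l' then chL l' + 8 * chU l' + 16 * 2 ^ size l' * f else 0.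
Fixpoint chS l := if l is f :: l' then chS l' + 4 * f * chU l' + 2 * f ^ 2 else 0.
Fixpoint chV l := if l is f :: l' then chV l' + 2 * 2 ^ size l' * f else 0.

Lemma chU_le l : chU l <= 2 ^ size l * sumn l.
Proof.
elim: l => //= f l IH; rewrite expnS -mulnA leq_mul2l mulnDr [2 ^ _ * f + _]addnC /=.
by apply: leq_add => //; rewrite leq_pmull // expn_gt0.
Qed.

Lemma chL_le l : chL l <= 8 * 2 ^ size l * sumn l.
Proof.
elim: l => //= f l IH; have := chU_le l; rewrite expnS.
move: (2 ^ size l) (sumn l) (chL l) (chU l) IH => x F L U IH hU.
have : 8 * U <= 8 * (x * F) by rewrite leq_mul2l.
lia.
Qed.

(** Extra vertices outside the oldest block count at most half as much as those
    in it. *)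
Lemma chU_tail mid x : 2 * chU (rcons mid x) <= 2 ^ size (rcons mid x) * (2 * x + sumn mid).
Proof.
elim: mid => [|f mid IH]; first by rewrite /= expn1; lia.
rewrite rcons_cons [chU _]/= [size _]/= expnS [sumn _]/=.
have : 2 * f <= 2 ^ size (rcons mid x) * f by rewrite leq_mul2r size_rcons expnS leq_pmulr ?orbT
  // expn_gt0.
move: (2 ^ _) (chU _) (sumn mid) IH => z U S; lia.
Qed.

Lemma chS_le c l : 2 <= c -> 2 ^ size l <= c ->
  chS l + (c - 2) * sumn [seq f ^ 2 | f <- l] <= c * sumn l ^ 2.
Proof.
move=> c2; elim: l => [|f l IH] /=; first by rewrite muln0.
rewrite expnS => h; have h' : 2 ^ size l <= c by lia.
have := IH h'; have := chU_le l; move: (sumn [seq g ^ 2 | g <- l]) (2 ^ size l) (sumn l) (chS l)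
  (chU l) h => Q z F S U h hU hS.
have h1 : f * U <= f * (z * F) by rewrite leq_mul2l hU orbT.
have h2 : (f * F) * (2 * z) <= (f * F) * c by rewrite leq_mul2l h orbT.
have [d ec] : exists d, c = d + 2 by exists (c - 2); lia.
have d2 : d + 2 - 2 = d by lia.
subst c; rewrite d2 in hS *; rewrite -!mulnn in hS *; lia.
Qed.

Lemma sumn_sq_ge l : sumn l <= sumn [seq f ^ 2 | f <- l].
Proof. by elim: l => //= f l IH; apply: leq_add => //; case: f => // f;
  rewrite -mulnn leq_pmulr. Qed.

Definition chain_top k F := 8 * 2 ^ k * F + 2 * F ^ 2 + 4 * (2 ^ k.-1 - 1) * (F ^ 2 %/ 4).

(** Wherever the extra vertices are, the quadratic part obeys [quad_arith], while
    by [chU_tail] the linear part loses at least [2 * 2 ^ size l] for each extra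
    vertex of a middle block. *)
Lemma chain_top_eq mid x y : let l := y :: rcons mid x in
  chL l + chS l = chain_top (size l) (sumn l) -> sumn mid = 0.
Proof.
move=> l; set e := sumn mid.
have sl : sumn l = x + y + e by rewrite /l /= sumn_rcons -/e; lia.
set n := size (rcons mid x); set c := 2 ^ n.
have n1 : 0 < n by rewrite /n size_rcons.
have c2 : 2 <= c by rewrite -[X in X <= _](expn1 2) leq_exp2l.
have ec : 2 ^ size l = 2 * c by rewrite /l /= expnS.
have tl := chU_tail mid x; rewrite -/n -/c -/e in tl.
have L0 : chL l + 4 * c * e <= 8 * 2 ^ size l * sumn l.
  have := chL_le (rcons mid x); rewrite ec sl [chL l]/= -/n -/c sumn_rcons -/e.
  move: (chL _) (chU _) tl => L U tl; lia.
have S0 : chS l <= 2 * (x + y + e) ^ 2 + 4 * (c - 1) * ((x + y + e) ^ 2 %/ 4).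
  apply: quad_arith => //.
  have := @chS_le c (rcons mid x) c2 (leqnn _).
  rewrite [chS l]/= map_rcons !sumn_rcons -/e.
  have := sumn_sq_ge mid; rewrite -/e.
  move: (sumn [seq g ^ 2 | g <- mid]) (chS _) (chU _) tl => Q S U tl hQ hS.
  have h1 : y * (2 * U) <= y * (c * (2 * x + e)) by rewrite leq_mul2l tl orbT.
  have [d ed] : exists d, c = d + 2 by exists (c - 2); lia.
  have d2 : d + 2 - 2 = d by lia.
  rewrite ed d2 in hS h1 *.
  have h2 : d * e <= d * Q by rewrite leq_mul2l hQ orbT.
  by rewrite -!mulnn in hS *; lia.
move=> E; have : 4 * c * e <= 0.
  have sl1 : (size l).-1 = n by [].
  by rewrite /chain_top sl1 -/c sl in E; rewrite sl in L0; lia.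
by rewrite leqn0 !muln_eq0 /= => /orP[/eqP c0|/eqP]; [move: c2; rewrite c0|].
Qed.

Lemma chU_zero j x : chU (rcons (nseq j 0) x) = 2 ^ j.+1 * x.
Proof. by elim: j => [|j IH] /=; rewrite ?expn1 ?add0n // IH addn0 mulnA -expnS. Qed.

Lemma chV_zero j x : chV (rcons (nseq j 0) x) = 2 * x.
Proof. by elim: j => [|j IH] /=; rewrite ?muln0 ?addn0. Qed.

Lemma chS_zero j x : chS (rcons (nseq j 0) x) = 2 * x ^ 2.
Proof. by elim: j => [|j IH] /=; rewrite ?muln0 ?mul0n ?addn0. Qed.

Lemma chL_zero j x : chL (rcons (nseq j 0) x) = 8 * 2 ^ j.+1 * x.
Proof.
elim: j => [|j IH] /=; first by rewrite expn0; lia.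
by rewrite IH chU_zero muln0 addn0 [in RHS]expnS; lia.
Qed.

Lemma floor_quarter_prod x y : x <= y.+1 -> y <= x.+1 -> (x + y) ^ 2 %/ 4 = x * y.
Proof.
move=> h1 h2; have : x = y \/ x = y.+1 \/ y = x.+1 by lia.
case=> [->|[->|->]].
- by rewrite (_ : (y + y) ^ 2 = y * y * 4) ?mulnK // -mulnn; lia.
- by rewrite (_ : (y.+1 + y) ^ 2 = y.+1 * y * 4 + 1); [rewrite divnMDl // addn0|rewrite -mulnn;
  lia].
by rewrite (_ : (x + x.+1) ^ 2 = x * x.+1 * 4 + 1); [rewrite divnMDl // addn0|rewrite -mulnn; lia].
Qed.

Lemma floor_quarter_prod_lt x y : ~~ ((x <= y.+1) && (y <= x.+1)) -> x * y < (x + y) ^ 2 %/ 4.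
Proof.
wlog xy : x y / x <= y.
  by move=> H; case: (leqP x y) => [/H//|/ltnW /H h]; rewrite andbC mulnC addnC.
move=> h; have [z ->] : exists z, y = x + z + 2 by exists (y - x - 2); lia.
have : (x * (x + z + 2) + 1) * 4 <= (x + (x + z + 2)) ^ 2 by rewrite -mulnn; lia.
move/(leq_div2r 4); rewrite mulnK //; lia.
Qed.

Lemma chain_top_zero j x y : let l := y :: rcons (nseq j 0) x in
  chL l + chS l = chain_top (size l) (sumn l) <-> (x <= y.+1) && (y <= x.+1).
Proof.
move=> l.
have sl : sumn l = x + y by rewrite /l /= sumn_rcons sumn_nseq mul0n; lia.
have szl : size (rcons (nseq j 0) x) = j.+1 by rewrite size_rcons size_nseq.
rewrite /chain_top sl /l /= chL_zero chS_zero chU_zero szl (expnS 2 j.+1).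
set c := 2 ^ j.+1; have c2 : 2 <= c by rewrite -[X in X <= _](expn1 2) leq_exp2l.
have [d ed] : exists d, c = d + 2 by exists (c - 2); lia.
rewrite ed (_ : d + 2 - 1 = d + 1); last lia.
split=> [E|/andP[h1 h2]]; last by rewrite floor_quarter_prod // -!mulnn; lia.
apply: contraT => /floor_quarter_prod_lt h; move: E.
set q := _ %/ 4 in h *; rewrite -!mulnn => E.
have : (d + 1) * (x * y) = (d + 1) * q by lia.
by move/eqP; rewrite eqn_mul2l addn1 /= => /eqP; lia.
Qed.
End ChainArith.

(** * Equality forces a balanced chain *)

Section Chain.
Variable G : sgraph.
Local Notation e := (@adj G).
Implicit Types (D : seq (G * seq G)) (r p u v x y : G) (s : seq G).

Definition attach_ok r D p := if D is b :: _ then p \in b.2 else p == r.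
(** Blocks grow along a line: each is attached at a vertex introduced by the
    block just before it, and the first at the root. *)
Fixpoint chain r D := if D is b :: D' then attach_ok r D' b.1 && chain r D' else true.

Definition extras D := [seq size b.2 - 2 | b : G * seq G <- D].

(** The number of paths from the root to the farthest vertices at most doubles
    with a cycle block, and it does so only if the block is attached at one of the
    farthest vertices, which are those introduced last. *)
Lemma chain_of_full r D u : decomp r D -> all (@is_cycle_block _) D -> u \in verts r D ->
  npaths (verts r D) r u = 2 ^ ncycles D -> chain r D /\ attach_ok r D u.
Proof.
elim: D u => [|[p s] D IH] u; first by rewrite /= inE.
move=> d /andP[s1 cD] uV; rewrite ncycles_cons [1 < size s]s1 add1n expnS.
have dD := step_decomp d; have pV := step_p d; have rV := root_mem r D.
have [us|us] := boolP (u \in s).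
  rewrite (npaths_new d) // bmul_cyc // mulnC => /eqP; rewrite eqn_mul2l /= => /eqP h.
  by have [cD' ap] := IH p dD cD pV h; rewrite /= ap cD'.
have uD : u \in verts r D by move: uV; rewrite /= mem_cat (negPf us).
rewrite (npaths_old d) // => h; have := npaths_le dD rV uD; rewrite h.
have e0 : 0 < 2 ^ ncycles D by rewrite expn_gt0.
by lia.
Qed.

Lemma full_of_chain r D u : decomp r D -> all (@is_cycle_block _) D -> chain r D ->
  attach_ok r D u ->
  npaths (verts r D) r u = 2 ^ ncycles D.
Proof.
elim: D u => [|[p s] D IH] u; first by move=> _ _ _ /eqP->; rewrite npaths_self ?inE.
move=> d /andP[s1 cD] /andP[ap cD'] us; rewrite ncycles_cons [1 < size s]s1 add1n expnS.
by rewrite (npaths_new d) ?root_mem // bmul_cyc // mulnC (IH p (step_decomp d)).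
Qed.

Lemma ncycles_all D : all (@is_cycle_block _) D -> ncycles D = size D.
Proof. by rewrite all_count => /eqP. Qed.

Lemma size_extras D : size (extras D) = size D.
Proof. by rewrite size_map. Qed.

Lemma chain_npaths_from r D u : decomp r D -> all (@is_cycle_block _) D -> chain r D ->
  attach_ok r D u ->
  npaths_from r D u + 3 = 4 * 2 ^ size D + chU (extras D).
Proof.
elim: D u => [|[p s] D IH] u.
  by move=> _ _ _ /eqP->; rewrite /npaths_from /= big_seq1 npaths_self ?inE.
move=> d /andP[s1 cD] /andP[ap cD'] us; rewrite /= expnS npaths_from_new // bmul_cyc //.
have := IH p (step_decomp d) cD cD' ap; rewrite /is_cycle_block /= in s1.
move: (2 ^ size D) (npaths_from r D p) (chU _) => x W U; lia.
Qed.

Lemma chain_npaths_from_root r D : decomp r D -> all (@is_cycle_block _) D -> chain r D ->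
  npaths_from r D r + 3 = 4 * 2 ^ size D + chV (extras D).
Proof.
elim: D => [|[p s] D IH]; first by move=> _ _ _; rewrite /npaths_from /= big_seq1 npaths_self ?inE.
move=> d /andP[s1 cD] /andP[ap cD'].
rewrite /= expnS npaths_from_old ?root_mem // bmul_cyc // (full_of_chain (step_decomp d) cD cD' ap).
have := IH (step_decomp d) cD cD'; rewrite size_extras ncycles_all //;
  rewrite /is_cycle_block /= in s1.
have [m ms] : exists m, size s = m + 2 by exists (size s - 2); lia.
rewrite ms addnK; move: (2 ^ size D) (npaths_from r D r) (chV _) => x W U; lia.
Qed.

Lemma chain_npaths_total r D : decomp r D -> all (@is_cycle_block _) D -> chain r D ->
  npaths_total r D + size (verts r D) + 30 + 16 * size D + 4 * sumn (extras D) =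
  32 * 2 ^ size D + (chL (extras D) + chS (extras D)).
Proof.
elim: D => [|[p s] D IH].
  by move=> _ _ _; rewrite /npaths_total /npaths_from /= !big_seq1 npaths_self ?inE.
move=> d /andP[s1 cD] /andP[ap cD'].
have := IH (step_decomp d) cD cD'; have := chain_npaths_from (step_decomp d) cD cD' ap.
rewrite npaths_total_step // /= bmul_cyc // size_cat expnS size_extras;
  rewrite /is_cycle_block /= in s1.
have [m ms] : exists m, size s = m + 2 by exists (size s - 2); lia.
rewrite ms addnK (_ : m + 2 - 1 = m + 1); last lia.
move: (2 ^ size D) (npaths_from r D p) (npaths_total r D) (chU _) (chL _) (chS _) (sumn _) (size
  (verts r D)) => x W Q U L S T V hW hQ.
have h : (m + 2) * (W + 3) = (m + 2) * (4 * x + U) by rewrite hW.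
rewrite -!mulnn; lia.
Qed.

Lemma size_verts r D : size (verts r D) = (sumn [seq size b.2 | b <- D]).+1.
Proof. by elim: D => //= b D IH; rewrite size_cat IH addnS. Qed.

Lemma size_verts_extras r D : all (@is_cycle_block _) D ->
  size (verts r D) = 2 * size D + 1 + sumn (extras D).
Proof.
rewrite size_verts; elim: D => //= b D IH /andP[b1 /IH]; rewrite /is_cycle_block in b1; lia.
Qed.

Lemma verts_card r D : decomp r D -> (forall x, x \in verts r D) -> size (verts r D) = #|G|.
Proof.
move=> d full; have U := verts_uniq d.
by rewrite -(card_uniqP U); apply: eq_card => x; rewrite full.
Qed.

Lemma chain_pn r D : decomp r D -> (forall x, x \in verts r D) -> all (@is_cycle_block _) D ->
  chain r D ->
  2 * pn G + 30 + 16 * size D + 4 * sumn (extras D) =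
  32 * 2 ^ size D + (chL (extras D) + chS (extras D)).
Proof.
move=> d full c ch; rewrite -(chain_npaths_total d c ch) (verts_card d full) (pn_double
  (verts_uniq d)) //; exact: full.
Qed.

Lemma top2E F k : double_top F k = 32 * 2 ^ k + chain_top k F.
Proof. by rewrite /double_top /chain_top; lia. Qed.

Lemma npaths_from_full r D r' D' u : decomp r D -> (forall x, x \in verts r D) -> decomp r' D' ->
  (forall x, x \in verts r' D') -> npaths_from r D u = npaths_from r' D' u.
Proof.
move=> d f d' f'; have pe : perm_eq (verts r D) (verts r' D').
  by apply: uniq_perm; rewrite ?verts_uniq // => x; rewrite f f'.
rewrite /npaths_from (perm_big _ pe) /=; apply: eq_bigr => v _; apply: npaths_eq_mem => x;
  by rewrite f f'.
Qed.

Hypothesis conn : forall x y, connect e x y.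
Hypothesis cact : forall c c' x y, is_cycle_seq c -> is_cycle_seq c' ->
  x \in c -> cadj c x y -> x \in c' -> cadj c' x y -> cycle_sub c = cycle_sub c'.

(** Having no bridge blocks is a property of the graph: every edge lies on a
    cycle. *)
Lemma all_cyc_transfer r D r' D' : decomp r D -> (forall x, x \in verts r D) ->
  all (@is_cycle_block _) D ->
  decomp r' D' -> bridges_ok D' -> all (@is_cycle_block _) D'.
Proof.
move=> d full c d' ok; apply/allP => b bD'; apply: contraT => nb.
have [U A sub s0] := block_facts d' bD'.
have [x xs] : exists x, x \in b.2 by case: (b.2) s0 => [|w ?] // _; exists w; rewrite mem_head.
have pb : b.1 \in block_verts b by rewrite mem_head.
have px : cadj (block_verts b) b.1 (next (block_verts b) b.1) by rewrite /cadj eqxx.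
have adjpx : e b.1 (next (block_verts b) b.1) by rewrite A // mem_next.
have [b' [b'D h1 h2 h3]] := edge_block d (full _) (full _) adjpx.
have Cc := block_cyc_seq d b'D (allP c _ b'D).
by have := ok b _ _ bD' nb pb px _ Cc h1; rewrite h3.
Qed.

Lemma root_on_cycle r D : decomp r D -> (forall x, x \in verts r D) ->
  all (@is_cycle_block _) D -> 0 < size D ->
  forall x, exists2 c, is_cycle_seq c & x \in c.
Proof.
move=> d full c D0 x.
have [y xy] : exists y, e x y.
  have [y xy] : exists y : G, y != x.
    have := verts_card d full; rewrite size_verts_extras // => h.
    have : 1 < #|G| by rewrite -h; lia.
    by case/card_gt1P => a [b [_ _ ab]]; case: (eqVneq a x) => [ax|]; [exists b;
      rewrite -ax eq_sym|exists a].
  have /connectP[[|z q] /= pq lq] := conn x y; first by rewrite lq eqxx in xy.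
  by exists z; case/andP: pq.
have [b [bD h1 _ _]] := edge_block d (full _) (full _) xy.
by exists (block_verts b) => //; apply: block_cyc_seq d bD (allP c _ bD).
Qed.

(** Grown from an end of a path that crosses all cycles, a bridgeless cactus
    becomes a chain. *)
Lemma regrow r D x y : decomp r D -> (forall x, x \in verts r D) ->
  all (@is_cycle_block _) D -> 0 < size D ->
  npaths (verts r D) x y = 2 ^ size D ->
  exists D', [/\ decomp x D', forall x', x' \in verts x D', all (@is_cycle_block _) D', chain x D' &
     attach_ok x D' y /\ size D' = size D].
Proof.
move=> d full c D0 h; have [E [s [d' ok full' s1]]] :=
  grow_from conn cact (root_on_cycle d full c D0 x).
set D' := rcons E (x, s) in d' ok full'.
have c' := all_cyc_transfer d full c d' ok.
have sz : size D' = size D by rewrite -!ncycles_all // -(ncycles_card d' full') (ncycles_card d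
  full).
have h' : npaths (verts x D') x y = 2 ^ ncycles D'.
  by rewrite ncycles_all // sz -h; apply: npaths_eq_mem => z; rewrite full full'.
by have [ch ay] := chain_of_full d' c' (full' _) h'; exists D'.
Qed.

Definition canon_extras F k := (F./2) :: rcons (nseq (k - 2) 0) (uphalf F).

Lemma seq_ends (T : Type) (l : seq T) : 2 <= size l -> exists b m a, l = b :: rcons m a.
Proof. by case: l => [|y l] //; case/lastP: l => [|m x] // _; exists y, m, x. Qed.

Lemma sumn0_nseq l : sumn l = 0 -> l = nseq (size l) 0.
Proof. by elim: l => //= f l IH /eqP; rewrite addn_eq0 => /andP[/eqP-> /eqP/IH <-]. Qed.

Lemma eq_extras r D : decomp r D -> (forall x, x \in verts r D) ->
  all (@is_cycle_block _) D -> chain r D ->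
  2 <= size D -> 2 * pn G + 30 + 16 * size D + 4 * sumn (extras D) =
    double_top (sumn (extras D)) (size D) ->
  exists a b, [/\ extras D = b :: rcons (nseq (size D - 2) 0) a, a <= b.+1 & b <= a.+1].
Proof.
move=> d full c ch k2; rewrite (chain_pn d full c ch) top2E => /addnI.
have [|y [mid [x El]]] := @seq_ends _ (extras D); first by rewrite size_extras.
have sm : size mid = size D - 2 by rewrite -size_extras El /= size_rcons; lia.
rewrite -{1}(size_extras D) El => E; have m0 := chain_top_eq E.
have Em : mid = nseq (size D - 2) 0 by rewrite -sm; apply: sumn0_nseq.
by rewrite Em in E *; have /andP[h1 h2] := (chain_top_zero _ _ _).1 E; exists x, y.
Qed.

(** The chain can be grown from either end of the full path. If the end cycles
    differ in size, the number of paths from its root tells which of them comes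
    first, so one of the two ends gives the sizes in the prescribed order. *)
Lemma eq_chain r D : decomp r D -> (forall x, x \in verts r D) -> all (@is_cycle_block _) D ->
  2 <= size D -> (exists u v, npaths (verts r D) u v = 2 ^ size D) ->
  let F := sumn (extras D) in
  2 * pn G + 30 + 16 * size D + 4 * F = double_top F (size D) ->
  exists x D', [/\ decomp x D', forall x', x' \in verts x D', all (@is_cycle_block _) D',
    chain x D' &
    extras D' = canon_extras F (size D)].
Proof.
move=> d full c k2 [u [v h]] F E; set k := size D in k2 E h *.
have sumF x D' : decomp x D' -> (forall x', x' \in verts x D') ->
  all (@is_cycle_block _) D' -> size D' = k -> sumn (extras D') = F.
  move=> d' f' c' s'; have := verts_card d' f'; rewrite -(verts_card d full) !size_verts_extras //.
  by rewrite s' -/k; move/addnI.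
have one x y : npaths (verts r D) x y = 2 ^ k ->
  exists D' a b, [/\ decomp x D', forall x', x' \in verts x D', all (@is_cycle_block _) D',
    chain x D' &
  [/\ attach_ok x D' y, size D' = k, extras D' = b :: rcons (nseq (k - 2) 0) a,
    a <= b.+1 & b <= a.+1]].
  move=> hxy; have [|D' [d' f' c' ch' [ay s']]] := regrow d full c _ hxy; first by rewrite -/k; lia.
  have := eq_extras d' f' c' ch'; rewrite (sumF _ _ d' f' c' s') s' => /(_ k2 E)[a [b [h1 h2 h3]]].
  by exists D', a, b.
have [D1 [a [b [d1 f1 c1 ch1 [av s1 E1 h1 h2]]]]] := one u v h.
have sab : a + b = F.
  by have := sumF _ _ d1 f1 c1 s1; rewrite E1 /= sumn_rcons sumn_nseq mul0n add0n addnC.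
have can a' b' : a' + b' = F -> b' <= a' -> a' <= b'.+1 ->
  b' :: rcons (nseq (k - 2) 0) a' = canon_extras F k.
  by move=> s2 l1 l2; rewrite /canon_extras; congr (_ :: rcons _ _); lia.
have [ba|ab] := leqP b a; first by exists u, D1; split=> //; rewrite E1 can.
have h' : npaths (verts r D) v u = 2 ^ k by rewrite npaths_sym.
have [D2 [a' [b' [d2 f2 c2 ch2 [au s2 E2 h1' h2']]]]] := one v u h'.
have sab' : a' + b' = F.
  by have := sumF _ _ d2 f2 c2 s2; rewrite E2 /= sumn_rcons sumn_nseq mul0n add0n addnC.
exists v, D2; split=> //; rewrite E2 can //.
(* both growths compute the number of paths from [u], as root and as last vertex *)
have W1 := chain_npaths_from_root d1 c1 ch1; have W2 := chain_npaths_from d2 c2 ch2 au.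
rewrite (npaths_from_full u d1 f1 d2 f2) W2 s1 s2 in W1; move/addnI: W1.
rewrite E1 E2 /= chU_zero chV_zero size_rcons size_nseq.
have [z ez] : exists z, 2 ^ (k - 2).+1 = z + 2.
  by exists (2 ^ (k - 2).+1 - 2); have := expn_gt0 2 (k - 2); rewrite expnS; lia.
rewrite ez => W1; apply: contraT; rewrite -ltnNge => lt.
have ea : a' = a by lia.
have eb : b' = b by lia.
by move: W1; rewrite ea eb; move: ab h1 h2 {ez}; clear; nia.
Qed.

End Chain.

(** * Normal form and isomorphism *)

Section Normal.
Variable G : sgraph.
Local Notation e := (@adj G).
Implicit Types (D : seq (G * seq G)) (r p u v x y : G) (s : seq G).

Definition tip r D := if D is b :: _ then last b.1 b.2 else r.
(** In normal form every block is attached at the last vertex listed so far, so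
    that the sizes of the blocks determine the graph. *)
Fixpoint normal r D := if D is b :: D' then (b.1 == tip r D') && normal r D' else true.

Lemma decomp_cons_congr r D r' D' p s : decomp r ((p, s) :: D) -> decomp r' D' ->
  verts r D =i verts r' D' ->
  decomp r' ((p, s) :: D').
Proof.
move=> [_ [pV s0 Us dis A]] d' E; split=> //; split=> //; first by rewrite -E.
  by apply: contra dis => /hasP[x xs xV]; apply/hasP; exists x => //; rewrite /= E.
by move=> x y xs yV; apply: A => //; move: yV; rewrite !mem_cat E.
Qed.

Lemma decomp_reblock r D p s s' : decomp r ((p, s) :: D) -> s =i s' -> uniq s' ->
  cadj (p :: s') =2 cadj (p :: s) ->
  decomp r ((p, s') :: D).
Proof.
move=> [d [pV s0 Us dis A]] E U' C; split=> //; split=> //.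
- have [y ys] : exists y, y \in s by case: (s) s0 => [|y ?] // _; exists y; rewrite mem_head.
  by apply: contraTneq ys => /= s'0; rewrite E s'0.
- by apply: contra dis => /hasP[x xs xV]; apply/hasP; exists x; rewrite ?E.
move=> x y xs yV; rewrite (A x y); first by rewrite /= !inE E C.
  by rewrite /= E.
by move: yV; rewrite /= !mem_cat E.
Qed.

Lemma decomp_single r s r' s' : decomp r [:: (r, s)] -> uniq (r' :: s') -> 0 < size s' ->
  r :: s =i r' :: s' -> cadj (r' :: s') =2 cadj (r :: s) -> decomp r' [:: (r', s')].
Proof.
move=> d U' s0 E C; split=> //; split=> //=; first by rewrite mem_head.
- by case: (s') s0.
- by case/andP: U'.
- by apply/hasPn => x xs; rewrite /= inE; case/andP: U' => h _; apply: contraNneq h => <-.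
move=> x y xs yV; have xE : x \in r :: s by rewrite E inE xs orbT.
have yE : y \in r :: s by rewrite E inE orbC; move: yV; rewrite mem_cat inE.
by rewrite (step_adj d) // -E yE C.
Qed.

Lemma cadj_rev_tail p s : uniq (p :: s) -> cadj (p :: rev s) =2 cadj (p :: s).
Proof.
move=> U x y; have E : rev (rot 1 (p :: s)) = p :: rev s by rewrite rot1_cons rev_rcons.
by rewrite -E cadj_rev ?rot_uniq // cadj_rot.
Qed.

(** The list of a cycle block may be reversed, which with two new vertices is
    enough to bring a chosen one to the end; in the first block the root may be
    changed as well, and any rotation of the cycle is possible. *)
Lemma normalize_tip r D p : decomp r D -> chain r D -> D != [::] -> attach_ok r D p ->
  (forall b, b \in take (size D).-1 D -> size b.2 = 2) ->
  exists r' D', [/\ decomp r' D', normal r' D', [seq size b.2 | b <- D'] = [seq size b.2 | b <- D],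
    verts r D =i verts r' D' & tip r' D' = p].
Proof.
elim: D p => [|[q s] D IH] // p d ch _ ps sz.
rewrite /= in ps; case: D IH d ch sz => [|b0 D] IH d ch sz.
  have qr : q = r by apply/eqP; case/andP: ch.
  subst q; have U := step_uniq d.
  have prs : p \in r :: s by rewrite inE orbC [p \in s]ps.
  have [i w def] := rot_to prs.
  have sw : size (p :: w) = size (r :: s) by rewrite -def size_rot.
  case: w def sw => [|r' w] def sw; first by have := step_size d; move: sw => /=; lia.
  have E : rot 1 (p :: r' :: w) = r' :: rcons w p by rewrite rot1_cons rcons_cons.
  have U' : uniq (r' :: rcons w p) by rewrite -E -def !rot_uniq.
  have M : r :: s =i r' :: rcons w p by move=> x; rewrite -E -def !mem_rot.
  exists r', [:: (r', rcons w p)]; split=> //=.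
  - apply: decomp_single d U' _ M _; first by rewrite size_rcons.
    by move=> x y; rewrite -E -def !cadj_rot ?rot_uniq.
  - by rewrite eqxx.
  - by rewrite size_rcons; move: sw => /= [->].
  - move=> x; rewrite !mem_cat !inE; have := M x; rewrite !inE => h.
    by rewrite orbC h orbC.
  - by rewrite last_rcons.
have /andP[aq ch'] := ch.
have [|r' [D' [d' n' s' v' t']]] := IH q (step_decomp d) ch' isT aq.
  by move=> b bD; apply: sz; rewrite /= inE bD orbT.
have d1 := decomp_cons_congr d d' v'.
have sz2 : size s = 2 by apply: (sz (q, s)); rewrite /= mem_head.
have Us : uniq (q :: s) := step_uniq d.
case: s ps Us sz2 d d1 {IH sz ch aq} => [|a [|b [|]]] // ps Us _ d d1.
have vE (t : seq G) : [:: a; b] =i t -> verts r ((q, [:: a;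
  b]) :: b0 :: D) =i verts r' ((q, t) :: D').
  move=> h x; rewrite -[verts r _]/([:: a; b] ++ verts r (b0 :: D)).
  by rewrite -[verts r' _]/(t ++ verts r' D') mem_cat [RHS]mem_cat v' h.
move: ps; rewrite /= !inE => /orP[]/eqP ep; subst p; last first.
  exists r', ((q, [:: a; b]) :: D'); split=> //=; rewrite ?t' ?eqxx //; first by rewrite s'.
  by apply: (vE [:: a; b]).
exists r', ((q, [:: b; a]) :: D'); split=> //=; rewrite ?t' ?eqxx //; last 2 first.
- by rewrite s'.
- by apply: (vE [:: b; a]) => x; rewrite !inE orbC.
apply: (@decomp_reblock r' D' q [:: a; b] [:: b; a] d1); first by move=> x; rewrite !inE orbC.
  by move: Us; rewrite /= !inE => /and3P[_ h _]; rewrite andbT eq_sym.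
exact: cadj_rev_tail Us.
Qed.

Lemma normalize r D : decomp r D -> chain r D -> 2 <= size D ->
  (forall b, b \in take (size D).-2 (behead D) -> size b.2 = 2) ->
  exists r' D', [/\ decomp r' D', normal r' D', [seq size b.2 | b <- D'] = [seq size b.2 | b <- D] &
    verts r D =i verts r' D'].
Proof.
case: D => [|[p s] D] // d /andP[ap ch] k2 sz.
have D0 : D != [::] by case: (D) k2.
have [r' [D' [d' n' s' v' t']]] := normalize_tip (step_decomp d) ch D0 ap sz.
exists r', ((p, s) :: D'); split=> //=; first exact: decomp_cons_congr d d' v'.
- by rewrite t' eqxx.
- by rewrite s'.
by move=> x; rewrite !mem_cat v'.
Qed.
End Normal.

Section Iso.
Variables G H : sgraph.

(** Both graphs prescribe the same adjacency for the positions in [verts]. *)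
Lemma iso_step (f : G -> H) (r : G) D (r' : H) D' : injective f ->
  decomp r D -> decomp r' D' -> normal r D -> normal r' D' ->
  [seq size b.2 | b <- D] = [seq size b.2 | b <- D'] -> map f (verts r D) = verts r' D' ->
  f (tip r D) = tip r' D' /\ {in verts r D &, forall x y, adj (f x) (f y) = adj x y}.
Proof.
move=> fi; elim: D D' => [|[p s] D IH] [|[p' s'] D'] //.
  move=> _ _ _ _ _ [fr]; split=> // x y; rewrite !inE => /eqP-> /eqP->; by rewrite !adj_irr.
move=> d d' /andP[/= /eqP pt n] /andP[/= /eqP pt' n'] [es esz].
rewrite map_cat => /eqP; rewrite eqseq_cat ?size_map // => /andP[/eqP fs /eqP fV].
have [ft A] := IH D' (step_decomp d) (step_decomp d') n n' esz fV.
have fp : f p = p' by rewrite pt pt' ft.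
have fps : map f (p :: s) = p' :: s' by rewrite /= fp fs.
split; first by rewrite -fp -fs last_map.
have new x y : x \in s -> y \in s ++ verts r D -> adj (f x) (f y) = adj x y.
  move=> xs yV; case: (d) => _ [_ _ _ _ h]; case: (d') => _ [_ _ _ _ h'].
  have fx : f x \in s' by rewrite -fs map_f.
  have fy : f y \in s' ++ verts r' D' by rewrite -fs -fV -map_cat map_f.
  rewrite h // h' // -[(p', s').1 :: _]/(p' :: s') -fps mem_map // /cadj.
  by rewrite !(next_map fi) ?(step_uniq d) // !(inj_eq fi).
move=> x y; rewrite !mem_cat => /orP[xs|xV] yV; first by apply: new; rewrite ?mem_cat.
case/orP: (yV) => [ys|yD]; last exact: A.
by rewrite adj_sym [RHS]adj_sym; apply: new; rewrite ?mem_cat ?xV ?orbT.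
Qed.

Lemma normal_iso (r : G) D (r' : H) D' : decomp r D -> decomp r' D' -> normal r D -> normal r' D' ->
  (forall x, x \in verts r D) -> (forall x, x \in verts r' D') ->
  [seq size b.2 | b <- D] = [seq size b.2 | b <- D'] -> graph_iso G H.
Proof.
move=> d d' n n' full full' es.
have U := verts_uniq d; have U' := verts_uniq d'.
have sz : size (verts r D) = size (verts r' D') by rewrite !size_verts es.
pose f (x : G) := nth r' (verts r' D') (index x (verts r D)).
pose g (y : H) := nth r (verts r D) (index y (verts r' D')).
have fK : cancel f g by move=> x; rewrite /f /g index_uniq ?nth_index // -sz index_mem.
have gK : cancel g f by move=> x; rewrite /f /g index_uniq ?nth_index // sz index_mem.
have fV : map f (verts r D) = verts r' D'.
  apply: (@eq_from_nth _ r'); rewrite size_map // => i lt.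
  by rewrite (nth_map r) // /f index_uniq.
have [_ A] := iso_step (can_inj fK) d d' n n' es fV.
by exists f; [exists g | move=> x y; apply: A].
Qed.
End Iso.

Lemma graph_iso_sym G H : graph_iso G H -> graph_iso H G.
Proof.
move=> [f [g fK gK] A]; exists g; first by exists f.
by move=> x y; rewrite -A !gK.
Qed.

Lemma graph_iso_simple_seqs (G H : sgraph) : graph_iso G H ->
  size (simple_seqs G) <= size (simple_seqs H).
Proof.
move=> [f bf A]; have fi := bij_inj bf.
rewrite -(size_map (map f)); apply: uniq_leq_size.
  by rewrite map_inj_uniq ?undup_uniq //; apply: inj_map.
move=> q' /mapP[q]; rewrite !mem_simple_seqs => /and3P[U S Z] ->.
rewrite /simple_seq map_inj_uniq // U size_map Z andbT /=.
case: q S {U Z} => //= x q; rewrite path_map => h.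
by rewrite -(eq_path (e := @adj G)) // => a b; rewrite /= A.
Qed.

Lemma pn_iso (G H : sgraph) : graph_iso G H -> pn G = pn H.
Proof.
move=> I; have : 2 * pn G = 2 * pn H.
  rewrite !pn_simple_seqs; congr (_ + _); last by case: I => f /bij_eq_card.
  by apply/eqP; rewrite eqn_leq !graph_iso_simple_seqs //; apply: graph_iso_sym.
lia.
Qed.

(** * Bridges *)

Lemma n_comp_gt1 (T : finType) (e : rel T) x y : connect_sym e -> ~~ connect e x y ->
  1 < n_comp e T.
Proof.
move=> sym; rewrite -(root_connect sym) => ne; apply/card_gt1P.
by exists (root e x), (root e y); split; rewrite ?inE //= roots_root.
Qed.

Lemma n_comp_eq1 (T : finType) (e : rel T) (x0 : T) : connect_sym e ->
  (forall x y, connect e x y) -> n_comp e T = 1.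
Proof.
move=> sym h; rewrite -(n_comp_connect sym x0); apply: eq_n_comp_r => x.
by apply/esym/h.
Qed.

Section Bridges.
Variable G : sgraph.
Local Notation e := (@adj G).
Implicit Types (D : seq (G * seq G)) (r p u v x y : G) (s : seq G).

Lemma del_edge_sym f : connect_sym (@del_edge G f).
Proof. by apply: sym_connect_sym => x y; rewrite /del_edge adj_sym setUC. Qed.

Lemma adj_connect_sym : connect_sym e.
Proof. exact/sym_connect_sym/adj_sym. Qed.

(** A deleted edge is bypassed by the rest of a cycle through it. *)
Lemma cyclic_edges_bridgeless : (forall x y, connect e x y) ->
  (forall x y, e x y -> exists2 c, is_cycle_seq c & (x \in c) && cadj c x y) -> bridgeless G.
Proof.
move=> conn cyc; apply/forallP => f; apply/negP => /andP[/imsetP[[x y]]].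
rewrite inE /= => xy -> {f}; have [c Cc /andP[xc cxy]] := cyc x y xy.
have [w [Cw _ _]] := cyc_seq_edge Cc xc cxy.
have yx : connect (del_edge [set x; y]) y x.
  have /and3P[U P S] := Cw; case: w U P S {Cw} => [|z w] // U P _.
  move: P => /= /and3P[_ yz P]; move: U; rewrite /= !inE !negb_or -!andbA.
  move=> /and5P[xy' xz xw yz' /and3P[yw zw Uw]].
  have step a b : e a b -> (a != x) && (a != y) || (b != x) && (b != y) -> del_edge [set x; y] a b.
    move=> ab h; rewrite /del_edge ab /=; apply: contraL h => /eqP/set2_eq[[-> ->]|[-> ->]];
    by rewrite !eqxx /= andbF.
  apply: (@connect_trans _ _ z).
    by apply/connect1/step => //; rewrite orbC eq_sym xz eq_sym yz'.
  apply/connectP; exists (rcons w x); last by rewrite last_rcons.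
  move: P; rewrite !rcons_path => /andP[P l]; apply/andP; split.
    apply: (@path_sub_rel _ e _ (z :: w)) P; last exact/allP.
    move=> a b aw bw ab; apply: step => //; apply/orP; left; move: aw;
      rewrite inE => /orP[/eqP->|aw].
      by rewrite eq_sym xz eq_sym yz'.
    by rewrite (memPn xw) // (memPn yw).
  apply: step => //; apply/orP; left.
  have := mem_last z w; rewrite inE => /orP[/eqP->|aw]; first by rewrite eq_sym xz eq_sym yz'.
  by rewrite (memPn xw) // (memPn yw).
rewrite (n_comp_eq1 x adj_connect_sym conn) (n_comp_eq1 x) //; first exact: del_edge_sym.
move=> a b; have := conn a b; apply: connect_sub => {}a {}b ab.
have [E|ne] := eqVneq [set a; b] [set x; y]; last by apply: connect1; rewrite /del_edge ab.
by case: (set2_eq E) => [[-> ->]|[-> ->]] //; rewrite del_edge_sym.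
Qed.

(** If the ends of a bridge block stayed connected without its edge, a simple
    path between them would close to a cycle through that edge. *)
Lemma bridgeless_all_cyc r D : (forall x y, connect e x y) -> bridgeless G -> decomp r D ->
  bridges_ok D ->
  all (@is_cycle_block _) D.
Proof.
move=> conn /forallP br d ok; apply/allP => b bD; apply: contraT => nb.
have [U A sub s0] := block_facts d bD.
pose p := b.1; pose x := next (block_verts b) p.
have pb : p \in block_verts b by rewrite mem_head.
have px : cadj (block_verts b) p x by rewrite /cadj eqxx.
have epx : e p x by rewrite A // mem_next.
have := br [set p; x]; rewrite /bridge.
have -> /= : [set p; x] \in edges G by apply/imsetP; exists (p, x); rewrite ?inE.
rewrite (n_comp_eq1 p adj_connect_sym conn) => nlt.
have /connectP[q0 pq0 lq0] : connect (del_edge [set p; x]) p x.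
  by apply: contraNT nlt; apply: n_comp_gt1; apply: del_edge_sym.
move: lq0; case/shortenP: pq0 => q pq Uq _ lq.
have Cc : is_cycle_seq (p :: q).
  rewrite /is_cycle_seq Uq /= rcons_path -lq adj_sym epx andbT; apply/andP; split.
    by apply: sub_path pq => a c /andP[].
  case: q pq Uq lq => [|y [|]] //=; last first.
    by move=> + _ yx; rewrite -yx /del_edge eqxx andbF.
  by move=> _ _ xp; rewrite xp adj_irr in epx.
have := ok b p x bD nb pb px _ Cc (mem_head _ _); rewrite /cadj.
have px' : prev (p :: q) p = x by rewrite (@prev_cat _ [::] p q Uq) -lq.
by have := next_prev Uq p; rewrite px' => ->; rewrite eqxx orbT.
Qed.
End Bridges.

(** * Attachment vertices *)

Section Attach.
Variable G : sgraph.
Local Notation e := (@adj G).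
Implicit Types (D E F M : seq (G * seq G)) (b : G * seq G) (r p u v x y : G) (s : seq G).

(** The attachment vertex of the oldest block is the root, where no other block
    of a chain is attached; it is left out. *)
Fixpoint attachments D : seq G := if D is b :: D' then (if D' is [::] then [::] else b.1 ::
  attachments D') else [::].

Lemma attachments_cons b b' D : attachments [:: b, b' & D] = b.1 :: attachments (b' :: D).
Proof. by []. Qed.

Lemma decomp_cat r E D : decomp r (E ++ D) -> decomp r D.
Proof. by elim: E => //= b E IH [/IH]. Qed.

Lemma chain_cat r E D : chain r (E ++ D) -> chain r D.
Proof. by elim: E => //= b E IH /andP[_ /IH]. Qed.

Lemma verts_cat r E D x : x \in verts r D -> x \in verts r (E ++ D).
Proof. by elim: E => //= b E IH h; rewrite mem_cat IH ?orbT. Qed.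

(** A later block meets the earlier vertices in its attachment vertex only; this
    is why two blocks share at most one vertex. *)
Lemma later_block r E b D x b' : decomp r (E ++ b :: D) -> b' \in E -> x \in block_verts b' ->
  x \in verts r (b :: D) -> x = b'.1.
Proof.
elim: E => [|a E IH] // d; rewrite inE => /orP[/eqP->|bE] xb xV; last first.
  by apply: IH => //; case: d.
move: xb; rewrite inE => /orP[/eqP->//|xs]; exfalso.
by case: a d xs => p s d /(step_new d); rewrite verts_cat.
Qed.

Lemma block_sub r D b x : decomp r D -> b \in D -> x \in block_verts b -> x \in verts r D.
Proof. by move=> d bD; have [_ _ sub _] := block_facts d bD; apply: sub. Qed.

Lemma block_share r D b b' x y : decomp r D -> b \in D -> b' \in D -> x != y ->
  x \in block_verts b -> y \in block_verts b -> x \in block_verts b' ->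
    y \in block_verts b' -> b = b'.
Proof.
elim: D => [|a D IH] // d.
have one b1 : b1 \in D -> x != y -> x \in block_verts a -> y \in block_verts a ->
  x \in block_verts b1 -> y \in block_verts b1 -> False.
  move=> bD xy xa ya xb yb; have dD : decomp r D by case: d.
  have key z : z \in block_verts a -> z \in block_verts b1 -> z = a.1.
    move=> za zb; have zV := block_sub dD bD zb.
    move: za; rewrite inE => /orP[/eqP//|zs]; case: a d zs {xa ya} => p s d /(step_new d).
    by rewrite zV.
  by move: xy; rewrite (key x) // (key y) // eqxx.
rewrite !inE => /orP[/eqP->|bD] /orP[/eqP->|bD'] // xy xa ya xb yb.
- by case: (one b').
- by case: (one b).
by apply: IH => //; case: d.
Qed.

Lemma two_blocks_attachments r D b b' v : decomp r D -> b \in D -> b' \in D -> b <> b' ->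
  v \in block_verts b -> v \in block_verts b' -> v \in attachments D.
Proof.
elim: D => [|a D IH] // d; have dD : decomp r D by case: d.
have one b1 : b1 \in D -> v \in block_verts a -> v \in block_verts b1 -> v \in attachments (a :: D).
  move=> bD va vb; have vV := block_sub dD bD vb.
  case: D bD {IH dD} d vV => [|a' D] // _ d vV; rewrite attachments_cons inE.
  by move: va; rewrite inE => /orP[->//|vs]; case: a d vs => p s d /(step_new d); rewrite vV.
rewrite !inE => /orP[/eqP->|bD] /orP[/eqP->|bD'] // ne va vb; first exact: (one b').
  exact: (one b).
have := IH dD bD bD' ne va vb.
by case: (D) => [|a' D'] //; rewrite [attachments (a :: _)]attachments_cons in_cons => ->;
  rewrite orbT.
Qed.

Lemma attachments_split r D v : chain r D -> v \in attachments D ->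
  exists E b b' F, [/\ D = E ++ [:: b, b' & F], b.1 = v & v \in b'.2].
Proof.
elim: D => [|b [|b' D] IH] // /andP[ab ch]; rewrite attachments_cons inE => /orP[/eqP->|h].
  by exists [::], b, b', D.
by have [E [b1 [b2 [F [-> h1 h2]]]]] := IH ch h; exists (b :: E), b1, b2, F.
Qed.

Lemma split_attachments E b b' F : b.1 \in attachments (E ++ [:: b, b' & F]).
Proof.
elim: E => [|a E IH]; first by rewrite attachments_cons mem_head.
by case: E IH => [|a' E] IH; rewrite [_ ++ _]/= attachments_cons in_cons [X in _ || X]IH orbT.
Qed.

Lemma split_att2 r E b b' F : chain r (E ++ [:: b, b' & F]) -> b.1 \in b'.2.
Proof. by move/chain_cat => /andP[]. Qed.

Lemma attachments_two r D v : decomp r D -> chain r D -> v \in attachments D ->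
  exists b b', [/\ b \in D, b' \in D, b <> b', v \in block_verts b & v \in block_verts b'].
Proof.
move=> d ch /(attachments_split ch)[E [b [b' [F [ED bv vb']]]]].
have bD : b \in D by rewrite ED mem_cat inE eqxx orbT.
have bD' : b' \in D by rewrite ED mem_cat !inE eqxx !orbT.
exists b, b'; split=> //; rewrite ?inE ?vb' ?orbT // -?bv ?inE ?eqxx //.
move=> ebb; have [U _ _ _] := block_facts d bD.
by case/andP: U; rewrite bv [in b.2]ebb vb'.
Qed.

Lemma next_mem_neq c v : uniq c -> 1 < size c -> v \in c -> next c v != v.
Proof. by move=> U S vc; apply/negP => /eqP h; have := cadj_irr U S vc; rewrite /cadj h eqxx. Qed.

Lemma next_neq c v : uniq c -> 2 < size c -> v \in c ->
  [/\ next c v != v, prev c v != v & next c v != prev c v].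
Proof.
move=> U S vc; have [i w def] := rot_to vc.
rewrite -(next_rot i U) -(prev_rot i U) def.
have Uw : uniq (v :: w) by rewrite -def rot_uniq.
have : 2 < size (v :: w) by rewrite -def size_rot.
rewrite (@next_cat _ [::] v w) // (@prev_cat _ [::] v w) //=.
case: w Uw {def} => [|x [|y w]] //= /and3P[h1 h2 _] _; split.
- by apply: contraNneq h1 => <-; rewrite mem_head.
- by apply: contraNneq h1 => {1}<-; rewrite inE mem_last orbT.
by apply: contraNneq h2 => ->; rewrite mem_last.
Qed.

Section Full.
Variables (r : G) (D : seq (G * seq G)).
Hypotheses (d : decomp r D) (full : forall x, x \in verts r D) (cyc : all (@is_cycle_block _) D).

Lemma full_block b : b \in D -> [/\ uniq (block_verts b), {in block_verts b &,
  e =2 cadj (block_verts b)} & 2 < size (block_verts b)].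
Proof.
by move=> bD; have [U A _ _] := block_facts d bD; split=> //; have := allP cyc _ bD.
Qed.

Lemma full_edge v y : e v y -> exists b, [/\ b \in D, v \in block_verts b,
  y \in block_verts b & cadj (block_verts b) v y].
Proof. exact: edge_block d (full v) (full y). Qed.

Lemma cycle_sub_block_inj b b' : b \in D -> b' \in D ->
  cycle_sub (block_verts b) = cycle_sub (block_verts b') -> b = b'.
Proof.
move=> bD bD' [/setP E _]; have [U _ S] := full_block bD.
have b1 : b.1 \in block_verts b by rewrite mem_head.
have nb : next (block_verts b) b.1 \in block_verts b by rewrite mem_next.
have m x : x \in block_verts b -> x \in block_verts b' by have := E x; rewrite !inE => ->.
apply: (block_share d bD bD' _ b1 nb (m _ b1) (m _ nb)).
by rewrite eq_sym next_mem_neq // ltnW.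
Qed.

Lemma cycles_block H : reflect (exists2 b, b \in D & H =
  cycle_sub (block_verts b)) (H \in cycles G).
Proof.
apply: (iffP (mem_cycles H)) => [[c Cc ->]|[b bD ->]].
  by have [b [bD _ E]] := cyc_seq_block d Cc (fun x _ => full x); exists b.
by exists (block_verts b) => //; apply: block_cyc_seq d bD (allP cyc _ bD).
Qed.

(** Two cycles through [v] share no other vertex and give at least three
    neighbours, whereas a vertex on one cycle has its two neighbours there. *)
Lemma degree_attachments v : chain r D -> (2 < degree v) = (v \in attachments D).
Proof.
move=> ch; apply/idP/idP => [|va]; last first.
  have [b [b' [bD bD' ne vb vb']]] := attachments_two d ch va.
  have [U A S] := full_block bD; have [U' A' S'] := full_block bD'.
  have [n1 n2 n3] := next_neq U S vb.
  have n1' : next (block_verts b') v != v by rewrite next_mem_neq // ltnW.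
  have out x : x \in block_verts b -> x != v -> next (block_verts b') v != x.
    move=> xb xv; apply: contra_notN ne => /eqP E.
    by apply: (block_share d bD bD' xv xb vb) => //; rewrite -E mem_next.
  apply/card_gt2P; exists (next (block_verts b) v), (prev (block_verts b) v),
    (next (block_verts b') v).
  split; split; rewrite ?inE //.
  - by rewrite A ?mem_next // /cadj eqxx.
  - by rewrite A ?mem_prev // /cadj next_prev // eqxx orbT.
  - by rewrite A' ?mem_next // /cadj eqxx.
  - by rewrite eq_sym out // mem_prev.
  - by rewrite out // mem_next.
apply: contraTT => nva; rewrite -leqNgt.
rewrite /degree; have [->|[y0]] := set_0Vmem [set y | e v y]; first by rewrite cards0.
rewrite inE => /full_edge[b [bD vb _ _]].
have [U _ _] := full_block bD.
apply: (@leq_trans #|[set next (block_verts b) v; prev (block_verts b) v]|);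
  last by rewrite cards2; case: (_ != _).
apply/subset_leq_card/subsetP => y; rewrite inE => /full_edge[b' [bD' vb' _ cy]].
have eb : b' = b.
  by apply/eqP; apply: contraNT nva => /eqP ne; apply: (two_blocks_attachments d bD' bD ne).
move: cy; rewrite eb /cadj !inE => /orP[->//|/eqP {2}->].
by rewrite prev_next // eqxx orbT.
Qed.

Lemma inter_attachments v : chain r D -> (v \in inter_vertices G) = (v \in attachments D).
Proof.
move=> ch; rewrite inE.
have memc H : (H \in [set C in cycles G | v \in C.1]) =
  (H \in cycles G) && (v \in H.1) by rewrite in_set.
apply/card_gt1P/idP => [[H [H' []]]|va].
  rewrite !memc => /andP[/cycles_block[b bD ->] vb] /andP[/cycles_block[b' bD' ->] vb'] ne.
  rewrite !inE in vb vb'; apply: (two_blocks_attachments d bD bD') => // ebb.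
  by rewrite ebb eqxx in ne.
have [b [b' [bD bD' ne vb vb']]] := attachments_two d ch va.
exists (cycle_sub (block_verts b)), (cycle_sub (block_verts b')); split.
- by rewrite memc; apply/andP; split; [apply/cycles_block; exists b | rewrite inE].
- by rewrite memc; apply/andP; split; [apply/cycles_block; exists b' | rewrite inE].
by apply: contra_notN ne => /eqP; apply: cycle_sub_block_inj.
Qed.

Lemma full_connect x y : connect e x y.
Proof.
have [t /and4P[pt /eqP lt _ _]] := decomp_connect d (full x) (full y).
by apply/connectP; exists t.
Qed.

Lemma full_cactus : cactus G.
Proof.
apply/andP; split; first by rewrite /connected (n_comp_eq1 r (@adj_connect_sym G) full_connect).
apply/forallP => f; apply/implyP => /imsetP[[x y]]; rewrite inE /= => xy -> {f}.
have memc H : (H \in [set C in cycles G | [set x; y] \in C.2]) = (H \in cycles G) && ([set x;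
  y] \in H.2) by rewrite in_set.
apply/card_le1_eqP => H H'; rewrite !memc.
move=> /andP[/cycles_block[b bD ->] h] /andP[/cycles_block[b' bD' ->] h'].
have [U A _] := full_block bD; have [U' A' _] := full_block bD'.
rewrite /= !mem_cycle_edges // in h h'.
have nxy : x != y by apply: contraTneq xy => ->; rewrite adj_irr.
case/andP: h => _ /cadj_mem/(_ nxy)/andP[xb yb]; case/andP: h' => _ /cadj_mem/(_ nxy)/andP[xb' yb'].
by rewrite (block_share d bD bD' nxy).
Qed.

Lemma full_bridgeless : bridgeless G.
Proof.
apply: cyclic_edges_bridgeless; first exact: full_connect.
move=> x y /full_edge[b [bD xb yb xy]]; exists (block_verts b); last by rewrite xb.
exact: block_cyc_seq d bD (allP cyc _ bD).
Qed.

Section Positions.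
Variables (b0 b1 : G * seq G) (M : seq (G * seq G)).
Hypotheses (ED : D = b0 :: rcons M b1) (ch : chain r D).

(** The two end blocks of a chain contain one attachment vertex each, and the
    middle ones two; this distinguishes end-cycles from interior cycles. *)
Lemma attachments_newest v : v \in attachments D -> v \in block_verts b0 -> v = b0.1.
Proof.
move=> va; rewrite inE => /orP[/eqP//|vs]; exfalso.
have b0D : b0 \in D by rewrite ED mem_head.
have [E [b [b' [F [ED' bv vb']]]]] := attachments_split ch va.
have vF : v \in verts r (b' :: F) by rewrite /= mem_cat vb'.
case: E ED' => [|c E] ED'.
  move: ED'; rewrite ED => -[eb _]; have [U _ _] := full_block b0D.
  by case/andP: U; rewrite eb bv -eb vs.
move: d; rewrite ED' => d'; have [ec _] : c = b0 /\ True by move: ED'; rewrite ED => -[-> _].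
have := later_block (E := c :: E) d' (mem_head _ _) (x := v).
rewrite ec inE vs orbT => /(_ isT) H.
have {H} vb : v = b0.1 by apply: H; exact: (verts_cat [:: b] vF).
have [U _ _] := full_block b0D.
by case/andP: U; rewrite -vb vs.
Qed.

Lemma attachments_oldest v w : v \in attachments D -> w \in attachments D ->
  v \in block_verts b1 -> w \in block_verts b1 -> v = w.
Proof.
have key u : u \in attachments D -> u \in block_verts b1 -> u = (last b0 M).1.
  move=> ua ub; have [E [b [b' [F [ED' bv vb']]]]] := attachments_split ch ua.
  case/lastP: F ED' => [|F b2] ED'.
    move: ED'; rewrite ED -rcons_cons -cat_rcons cats1 => /rcons_inj[e1 _].
    by rewrite -bv; move/(congr1 (last b0)): e1; rewrite /= last_rcons => ->.
  exfalso; have eb : b2 = b1.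
    move/(congr1 (last b0)): ED'; rewrite ED /= last_rcons last_cat /= last_rcons; by move=> ->.
  have dF : decomp r (b' :: rcons F b2) by apply: (@decomp_cat r (rcons E b));
    rewrite cat_rcons -ED'.
  case: b' vb' dF {ED'} => p s /= us dF; have /negP := step_new dF us; apply.
  by apply: (block_sub (step_decomp dF) (_ : b2 \in _)); rewrite ?mem_rcons ?mem_head ?eb.
by move=> va wa vb wb; rewrite (key v) // (key w).
Qed.

Lemma attachments_middle b : b \in M -> exists v w, [/\ v \in attachments D,
  w \in attachments D, v \in block_verts b, w \in block_verts b & v != w].
Proof.
move=> bM; have [M1 [M2 EM]] : exists M1 M2, M = M1 ++ b :: M2 by case/splitPr: bM => M1 M2;
  exists M1, M2.
have E1 : D = (b0 :: M1) ++ b :: rcons M2 b1 by rewrite ED EM rcons_cat rcons_cons.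
have bD : b \in D by rewrite E1 mem_cat mem_head orbT.
exists b.1, (last b0 M1).1; have [U _ _] := full_block bD.
have E2 : D = belast b0 M1 ++ [:: last b0 M1, b & rcons M2 b1] by rewrite E1 lastI cat_rcons.
have lb : (last b0 M1).1 \in b.2 by apply: (@split_att2 r (belast b0 M1) _ _ (rcons M2 b1));
  rewrite -E2.
split; rewrite ?inE ?eqxx ?lb ?orbT //.
- case: (M2) E1 => [|c M3] /= E1; first by rewrite E1 -cat_cons; apply: split_attachments.
  by rewrite E1 -cat_cons; apply: split_attachments.
- by rewrite E2 split_attachments.
by case/andP: U => h _; apply: contraNneq h => ->.
Qed.
End Positions.
End Full.
End Attach.

(** * Cacti whose incidence graph is a path *)

Lemma path_edges_nbr (G : sgraph) (a b : seq G) (t u : G) : uniq (a ++ t :: b) ->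
  [set t; u] \in path_edges (a ++ t :: b) -> (a != [::] /\ u = last t a) \/ u = head t b.
Proof.
elim: a => [|z a IH].
  case: b => [|w b] /=; first by rewrite path_edges1 inE.
  move=> /andP[tb _]; rewrite path_edges_cons inE => /orP[|/path_edges_sub/(_ (set21 _ _))];
    last by rewrite (negPf tb).
  by move=> /set1P/set2_eq[[]|[e _]]; [right|move: tb; rewrite -e mem_head].
have E c (q : seq G) : path_edges (z :: c :: q) = [set z;
  c] |: path_edges (c :: q) by exact: path_edges_cons.
case: a IH => [|w a] IH /andP[za U].
  rewrite [_ ++ _]/= E inE => /orP[/set1P/set2_eq|h].
    by move=> [[e _]|[_ ->]]; [move: za; rewrite -e mem_head|left].
  by have [[]|] := IH U h; [|right].
rewrite [_ ++ _]/= E inE => /orP[/set1P/set2_eq|h].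
  move=> [[e _]|[e _]]; first by move: za; rewrite -e inE mem_cat mem_head !orbT.
  by move: U; rewrite e /= mem_cat mem_head orbT.
by have [[_ ->]|->] := IH U h; [left|right].
Qed.

Lemma path_graphP (H : sgraph) : path_graph H -> exists q : seq H,
  [/\ uniq q, 0 < size q, forall t, t \in q & forall t t', adj t t' ->
    [set t; t'] \in path_edges q].
Proof.
move=> pH; have [q [U _ S [E1 E2]]] := is_pathP _ pH; exists q; split=> // [t|t t' h].
  by have := in_setT t; rewrite E1 inE.
by rewrite -E2; apply/imsetP; exists (t, t'); rewrite ?inE.
Qed.

Lemma path_graph_two (H : sgraph) (t : H) : path_graph H -> exists u1 u2, forall u, adj t u ->
  u = u1 \/ u = u2.
Proof.
move=> /path_graphP[q [U _ a E]]; case/splitPr: (a t) U E => [q1 q2] U E.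
by exists (last t q1), (head t q2) => u /E /(path_edges_nbr U)[[]|]; auto.
Qed.

Lemma path_graph_end (H : sgraph) : path_graph H -> exists (t : H) u1, forall u, adj t u -> u = u1.
Proof.
move=> /path_graphP[[|t q] [U // _ a E]]; exists t, (head t q) => u /E h.
by case: (@path_edges_nbr _ [::] q t u U h) => [[]|].
Qed.

(** In a path graph every vertex has at most two neighbours. Read in the
    incidence graph, this bounds the cycles through a vertex and the intersection
    vertices on a cycle. *)
Section FromPath.
Variable G : sgraph.
Local Notation T := (incidence_graph G).
Hypothesis pT : path_graph T.

Definition inc_v v (vi : v \in inter_vertices G) : T := inl (exist _ v vi).
Definition inc_c C (Cc : C \in cycles G) : T := inr (exist _ C Cc).

Lemma inc_c_inj C C' (Cc : C \in cycles G) (Cc' : C' \in cycles G) : inc_c Cc = inc_c Cc' -> C = C'.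
Proof. by case. Qed.

Lemma inc_v_inj v v' (vi : v \in inter_vertices G) (vi' : v' \in inter_vertices G) : inc_v vi =
  inc_v vi' -> v = v'.
Proof. by case. Qed.

Lemma mem_inter v C C' : C \in cycles G -> C' \in cycles G -> C != C' -> v \in C.1 -> v \in C'.1 ->
  v \in inter_vertices G.
Proof.
move=> Cc Cc' ne vC vC'; rewrite in_set; apply/card_gt1P; exists C, C'.
by split=> //; rewrite in_set ?Cc ?Cc' ?vC ?vC'.
Qed.

Lemma pigeon3 (X : Type) (u1 u2 x y z : X) : x = u1 \/ x = u2 -> y = u1 \/ y = u2 ->
  z = u1 \/ z = u2 ->
  [\/ x = y, x = z | y = z].
Proof. by case=> -> [] -> [] ->; do ?[by constructor 1|by constructor 2|by constructor 3]. Qed.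

Lemma no_three_cycles v C1 C2 C3 : C1 \in cycles G -> C2 \in cycles G -> C3 \in cycles G ->
  C1 <> C2 -> C1 <> C3 -> C2 <> C3 -> v \in C1.1 -> v \in C2.1 -> v \in C3.1 -> False.
Proof.
move=> c1 c2 c3 n12 n13 n23 v1 v2 v3.
have vi : v \in inter_vertices G by apply: (mem_inter c1 c2) => //; apply/eqP.
have [u1 [u2 h]] := path_graph_two (inc_v vi) pT.
have [] := pigeon3 (h (inc_c c1) v1) (h (inc_c c2) v2) (h (inc_c c3) v3) => /inc_c_inj; auto.
Qed.

Lemma no_three_vertices C v1 v2 v3 : C \in cycles G -> v1 \in inter_vertices G ->
  v2 \in inter_vertices G ->
  v3 \in inter_vertices G -> v1 <> v2 -> v1 <> v3 -> v2 <> v3 -> v1 \in C.1 -> v2 \in C.1 ->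
    v3 \in C.1 -> False.
Proof.
move=> Cc i1 i2 i3 n12 n13 n23 h1 h2 h3.
have [u1 [u2 h]] := path_graph_two (inc_c Cc) pT.
have [] := pigeon3 (h (inc_v i1) h1) (h (inc_v i2) h2) (h (inc_v i3) h3) => /inc_v_inj; auto.
Qed.

(** An intersection vertex has two neighbours in the incidence graph, so an end
    of the path is a cycle. *)
Lemma path_end_cycle : exists2 C, C \in cycles G &
  forall v w, v \in inter_vertices G -> w \in inter_vertices G -> v \in C.1 -> w \in C.1 -> v = w.
Proof.
have [[[v vi]|[C Cc]] [u1 h]] := path_graph_end pT; last first.
  exists C => // v w vi wi vC wC.
  by apply: (inc_v_inj (vi := vi) (vi' := wi)); rewrite (h (inc_v vi) vC) (h (inc_v wi) wC).
have memc H : (H \in [set C in cycles G | v \in C.1]) =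
  (H \in cycles G) && (v \in H.1) by rewrite in_set.
exfalso; have := vi; rewrite in_set => /card_gt1P[C [C' []]]; rewrite !memc.
move=> /andP[Cc vC] /andP[Cc' vC'] /eqP; apply.
apply: (inc_c_inj (Cc := Cc) (Cc' := Cc')).
by rewrite (h (inc_c Cc) vC) (h (inc_c Cc') vC').
Qed.
End FromPath.

(** * Balanced chains are the pseudo triangle chains *)

Lemma map_surj (A : Type) (B : eqType) (f : A -> B) (s : seq B) :
  (forall b, b \in s -> exists a, f a = b) -> exists q, map f q = s.
Proof.
elim: s => [|b s IH] h; first by exists [::].
have [|q <-] := IH; first by move=> c cs; apply: h; rewrite inE cs orbT.
by have [a <-] := h b (mem_head _ _); exists (a :: q).
Qed.

Lemma map_split2 (A B : Type) (f : A -> B) q s1 b b' s2 : map f q = s1 ++ [:: b, b' & s2] ->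
  exists q1 a a' q2, [/\ q = q1 ++ [:: a, a' & q2], f a = b & f a' = b'].
Proof.
elim: s1 q => [|c s1 IH] [|a q] //=.
  by case: q => [|a' q] //= [e1 e2 _]; exists [::], a, a', q.
by move=> [_ /IH[q1 [x [y [q2 [-> h1 h2]]]]]]; exists (a :: q1), x, y, q2.
Qed.

Lemma path_edges_adj (G : sgraph) (q : seq G) f : sorted (@adj G) q -> f \in path_edges q ->
  f \in edges G.
Proof.
elim: q => [|x [|y q] IH]; first by move=> _ /imsetP[].
  by rewrite path_edges1 inE.
move=> /= /andP[xy pq]; rewrite path_edges_cons in_setU1 => /orP[/eqP->|]; last exact: IH.
by apply/imsetP; exists (x, y); rewrite ?inE.
Qed.

Section ChainIncidence.
Variable G : sgraph.
Local Notation e := (@adj G).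
Local Notation T := (incidence_graph G).
Implicit Types (D F : seq (G * seq G)) (b : G * seq G) (r v : G).

(** The path C_k, p_k, C_(k-1), ..., p_2, C_1 of a chain. It lives in a plain sum
    type; the membership proofs of [incidence_graph] are supplied afterwards
    through [map_surj]. *)
Fixpoint inc_seq D : seq (G + subgraph G) := if D is b :: D' then
  inr (cycle_sub (block_verts b)) :: (if D' is [::] then [::] else inl b.1 :: inc_seq D') else [::].

Definition inc_val (t : T) : G + subgraph G :=
  match t with inl v => inl (val v) | inr C => inr (val C) end.

Definition inc_rel (a b : G + subgraph G) := match a, b with
  | inl v, inr C | inr C, inl v => v \in C.1 | _, _ => false end.

Lemma inc_val_inj : injective inc_val.
Proof. by move=> [x|x] [y|y] // [/val_inj ->]. Qed.

Lemma inc_rel_val t t' : inc_rel (inc_val t) (inc_val t') = adj t t'.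
Proof. by case: t; case: t'. Qed.

Lemma inc_seq_cons2 b b' D : inc_seq [:: b, b' & D] = [:: inr (cycle_sub (block_verts b)),
  inl b.1 & inc_seq (b' :: D)].
Proof. by []. Qed.

Lemma mem_inc_seq_v D v : (inl v \in inc_seq D) = (v \in attachments D).
Proof.
elim: D => [|b [|b' D] IH] //; rewrite inc_seq_cons2 attachments_cons [RHS]in_cons -IH.
by rewrite [LHS]in_cons [X in _ || X]in_cons.
Qed.

Lemma mem_inc_seq_c D C : (inr C \in inc_seq D) = (C \in [seq cycle_sub (block_verts b) | b <- D]).
Proof.
elim: D => [|b [|b' D] IH] //.
by rewrite inc_seq_cons2 map_cons [RHS]in_cons -IH [LHS]in_cons [X in _ || X]in_cons.
Qed.

Lemma attachments_old r b D v : decomp r (b :: D) -> v \in attachments (b :: D) -> v \in verts r D.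
Proof.
elim: D b => [|b' D IH] b d; first by [].
have d' : decomp r (b' :: D) by case: d.
rewrite attachments_cons in_cons => /orP[/eqP->|/(IH _ d') h]; first by case: d => _ [].
by rewrite (verts_cat [:: b']).
Qed.

Lemma new_not_old r b D v : decomp r (b :: D) -> v \in b.2 -> v \notin verts r D.
Proof. by case: b => p s d /(step_new d). Qed.

Lemma inc_seq_uniq r D : decomp r D -> chain r D -> uniq (inc_seq D).
Proof.
elim: D => [|b [|b' D] IH] // d ch; have d' : decomp r (b' :: D) by case: d.
have /andP[ab ch'] := ch; rewrite /= in ab.
rewrite inc_seq_cons2 cons_uniq [X in _ && X]cons_uniq (IH d' ch') andbT in_cons negb_or
  mem_inc_seq_v mem_inc_seq_c /=.
apply/andP; split; first by have /andP[] := cycle_sub_block_uniq d.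
by apply: contraTN ab => /(attachments_old d') h; apply: contraL h; apply: new_not_old.
Qed.

Lemma inc_seq_sorted r D : chain r D -> sorted inc_rel (inc_seq D).
Proof.
elim: D => [|b [|b' D] IH] // ch; have /andP[ab ch'] := ch; rewrite /= in ab.
rewrite inc_seq_cons2; have := IH ch'; rewrite [inc_seq (b' :: D)]/= /= => ->.
by rewrite !inE eqxx ab orbT.
Qed.

(** An attachment vertex lies only on the block attached there and on the block
    before it, its two neighbours in the sequence. *)
Lemma inc_seq_consec r D b v : decomp r D -> chain r D -> v \in attachments D -> b \in D ->
  v \in block_verts b ->
  exists s1 s2, inc_seq D = s1 ++ [:: inl v, inr (cycle_sub (block_verts b)) & s2] \/
                inc_seq D = s1 ++ [:: inr (cycle_sub (block_verts b)), inl v & s2].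
Proof.
elim: D b => [|b0 [|b' D] IH] b // d ch; have d' : decomp r (b' :: D) by case: d.
have /andP[ab ch'] := ch; rewrite /= in ab.
have top : v = b0.1 -> b \in [:: b0, b' & D] -> v \in block_verts b ->
  exists s1 s2, inc_seq [:: b0, b' & D] = s1 ++ [:: inl v, inr (cycle_sub (block_verts b)) & s2] \/
                inc_seq [:: b0, b' & D] = s1 ++ [:: inr (cycle_sub (block_verts b)), inl v & s2].
  move=> ev; rewrite in_cons => /orP[/eqP->|bD] vb.
    by exists [::], (inc_seq (b' :: D)); right; rewrite inc_seq_cons2 ev.
  have -> : b = b'.
    move: bD; rewrite in_cons => /orP[/eqP//|bF]; exfalso; move: ab;
      rewrite -ev => /(new_not_old d')/negP; apply.
    by apply: (@block_sub _ r D b) => //; case: d'.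
  by exists [:: inr (cycle_sub (block_verts b0))]; eexists; left; rewrite inc_seq_cons2 ev.
rewrite attachments_cons in_cons => /orP[/eqP|va]; first exact: top.
rewrite in_cons => /orP[/eqP eb|bD] vb.
  apply: top => //; last by rewrite in_cons eb eqxx.
  have vV := verts_cat [:: b'] (attachments_old d' va).
  move: vb; rewrite eb in_cons => /orP[/eqP//|vs]; have := new_not_old d vs.
  by rewrite vV.
have [s1 [s2 [E|E]]] := IH b d' ch' va bD vb; exists [:: inr (cycle_sub (block_verts b0)),
  inl b0.1 & s1], s2;
  by [left; rewrite inc_seq_cons2 E|right; rewrite inc_seq_cons2 E].
Qed.

Section Full.
Variables (r : G) (D : seq (G * seq G)).
Hypotheses (d : decomp r D) (full : forall x, x \in verts r D) (cyc : all (@is_cycle_block _) D)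
  (ch : chain r D).
Hypothesis D0 : 0 < size D.

Lemma chain_path_graph : path_graph T.
Proof.
have [q Eq] : exists q, map inc_val q = inc_seq D.
  apply: map_surj => -[v|C].
    rewrite mem_inc_seq_v -(inter_attachments d full cyc v ch) => vi.
    by exists (inl (exist _ v vi)).
  rewrite mem_inc_seq_c => /mapP[b bD EC].
  have Cc : C \in cycles G by apply/(cycles_block d full cyc); exists b.
  by exists (inr (exist _ C Cc)).
have all_q t : t \in q.
  rewrite -(mem_map inc_val_inj) Eq; case: t => [[v vi]|[C Cc]] /=.
    by rewrite mem_inc_seq_v -(inter_attachments d full cyc v ch).
  by rewrite mem_inc_seq_c; have /(cycles_block d full cyc)[b bD ->] := Cc; apply: map_f.
have Uq : uniq q by rewrite -(map_inj_uniq inc_val_inj) Eq (inc_seq_uniq d ch).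
have Sq : sorted (@adj T) q.
  have := inc_seq_sorted ch; rewrite -Eq sorted_map; congr is_true; apply: eq_sorted => t t'.
  exact: inc_rel_val.
apply/is_pathP; exists q; split=> //.
  rewrite -(size_map inc_val) Eq; by case: (D) D0.
congr (_, _); first by apply/setP => t; rewrite !inE all_q.
apply/setP => f; apply/idP/idP; last exact: path_edges_adj.
move=> /imsetP[[t t']]; rewrite inE /= => tt' ->.
wlog [v [b [va bD vb [ev eb]]]] : t t' tt' / exists v b, [/\ v \in attachments D, b \in D,
  v \in block_verts b &
   inc_val t = inl v /\ inc_val t' = inr (cycle_sub (block_verts b))].
  move=> H; have : (exists v, inc_val t = inl v) \/ (exists v, inc_val t' = inl v).
    by case: t tt' {H} => [v|C]; case: t' => [v'|C'] //; [left; exists (val v)|right;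
      exists (val v')].
  have K x y : adj x y -> (exists v, inc_val x = inl v) ->
    exists v b, [/\ v \in attachments D, b \in D, v \in block_verts b &
      inc_val x = inl v /\ inc_val y = inr (cycle_sub (block_verts b))].
    case: x => [[v vi]|C]; last by move=> _ [v].
    case: y => [v'|[C Cc]] //= vC _.
    have /(cycles_block d full cyc)[b bD EC] := Cc; exists v, b; rewrite -EC; split=> //.
      by rewrite -(inter_attachments d full cyc v ch).
    by move: vC; rewrite EC inE.
  case=> h; first by apply: H => //; apply: K.
  have t't : adj t' t by rewrite adj_sym.
  by rewrite setUC; apply: H => //; apply: K.
have [s1 [s2 [E|E]]] := inc_seq_consec d ch va bD vb; rewrite -Eq in E.
  have [q1 [a [a' [q2 [-> h1 h2]]]]] := map_split2 E.
  have -> : t = a by apply: inc_val_inj; rewrite ev h1.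
  have -> : t' = a' by apply: inc_val_inj; rewrite eb h2.
  exact: (@path_edges_mid T).
have [q1 [a [a' [q2 [-> h1 h2]]]]] := map_split2 E.
have -> : t = a' by apply: inc_val_inj; rewrite ev h2.
have -> : t' = a by apply: inc_val_inj; rewrite eb h1.
by rewrite setUC; exact: (@path_edges_mid T).
Qed.

Lemma card_block b : b \in D -> #|(cycle_sub (block_verts b)).1| = (size b.2).+1.
Proof.
by move=> bD; have [U _ _] := full_block d cyc bD; rewrite /= cardsE (card_uniqP U).
Qed.

Section Ends.
Variables (b0 b1 : G * seq G) (M : seq (G * seq G)).
Hypotheses (ED : D = b0 :: rcons M b1).

Lemma end_block b : b \in D -> b = b0 \/ b = b1 -> end_cycle (cycle_sub (block_verts b)).
Proof.
move=> bD eb; apply/andP; split; first by apply/(cycles_block d full cyc); exists b.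
apply/card_le1_eqP => v w; rewrite !in_set /= !(degree_attachments d full cyc _ ch) !inE.
move=> /andP[vb va] /andP[wb wa]; case: eb vb wb => ->; rewrite -!in_cons => vb wb.
  by rewrite (attachments_newest d cyc ED ch va vb) (attachments_newest d cyc ED ch wa wb).
exact: (attachments_oldest d ED ch wa va wb vb).
Qed.

Lemma middle_block b : b \in M -> ~~ end_cycle (cycle_sub (block_verts b)).
Proof.
move=> bM; have [v [w [va wa vb wb vw]]] := attachments_middle d cyc ED ch bM.
rewrite negb_and -ltnNge; apply/orP; right; apply/card_gt1P; exists v, w.
by split=> //; rewrite in_set (degree_attachments d full cyc _ ch) ?va ?wa andbT /= in_set.
Qed.

Lemma chain_ptc : (forall b, b \in M -> size b.2 = 2) -> size b0.2 <= (size b1.2).+1 ->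
  size b1.2 <= (size b0.2).+1 -> is_PTC #|G| (size D) G.
Proof.
move=> hM h1 h2.
have inD b : b \in D -> [\/ b = b0, b = b1 | b \in M].
  by rewrite ED in_cons mem_rcons in_cons => /or3P[/eqP->|/eqP->|];
    [constructor 1|constructor 2|constructor 3].
have cac := full_cactus d full cyc.
split.
- by rewrite /cactus_chain cac (full_bridgeless d full cyc) chain_path_graph.
- by rewrite /in_class cac (ncycles_card d full) ncycles_all // !eqxx.
- move=> C /andP[/(cycles_block d full cyc)[b bD ->] ne].
  case: (inD b bD) => [eb|eb|bM]; last by rewrite card_block // hM.
    by case/negP: ne; apply: end_block => //; left.
  by case/negP: ne; apply: end_block => //; right.
have ends (C : subgraph G) : end_cycle C -> #|C.1| = (size b0.2).+1 \/ #|C.1| = (size b1.2).+1.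
  move=> EC; have [Cc _] := andP EC; have [b bD eC] := cycles_block d full cyc _ Cc; subst C.
  case: (inD b bD) => [eb|eb|/middle_block]; last by rewrite EC.
    by left; rewrite card_block // eb.
  by right; rewrite card_block // eb.
by move=> C C' /ends h /ends h'; case: h => ->; case: h' => ->; lia.
Qed.
End Ends.
End Full.

(** The growth starts at a vertex of the end of the incidence path that lies on no
    other cycle. A block attached elsewhere than in the latest block would create
    a vertex on three cycles, a cycle with three intersection vertices, or a
    second intersection vertex on the end cycle. *)
Lemma ptc_chain n k : 2 <= k -> is_PTC n k G ->
  exists r D, [/\ decomp r D, forall x, x \in verts r D, all (@is_cycle_block _) D,
   chain r D & size D = k /\ exists x y, [/\ extras D = y :: rcons (nseq (k - 2) 0) x,
     x <= y.+1 & y <= x.+1]].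
Proof.
move=> k2 [/and3P[cac br pT] /and3P[_ /eqP _ /eqP ck] intr ends].
have conn := cactus_connect cac; have cact := cactus_uniq cac.
have [C0 C0c hC0] := path_end_cycle pT.
have [c0 Cc0 EC0] := mem_cycles _ C0c.
have [r [rC rni]] : exists r, r \in C0.1 /\ r \notin inter_vertices G.
  have /and3P[U _ S] := Cc0; case: c0 U S EC0 {Cc0} => [|a [|b w]] // U _ EC0.
  have ab : a != b by case/andP: U => h _; apply: contraNneq h => ->; rewrite mem_head.
  have aC : a \in C0.1 by rewrite EC0 inE mem_head.
  have bC : b \in C0.1 by rewrite EC0 !inE eqxx orbT.
  have [ai|] := boolP (a \in inter_vertices G); last by exists a.
  have [bi|] := boolP (b \in inter_vertices G); last by exists b.
  by have := hC0 a b ai bi aC bC; move/eqP; rewrite (negPf ab).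
have rc : exists2 c, is_cycle_seq c & r \in c by exists c0 => //; move: rC; rewrite EC0 inE.
have [E [s [d ok full s1]]] := grow_from conn cact rc; set D := rcons E (r, s) in d ok full.
have cyc := bridgeless_all_cyc conn br d ok.
have szD : size D = k by rewrite -(ncycles_all cyc) -(ncycles_card d full).
have cb b : b \in D -> cycle_sub (block_verts b) \in cycles G by move=> bD;
  apply/(cycles_block d full cyc); exists b.
have cne b b' : b \in D -> b' \in D -> b <> b' ->
  cycle_sub (block_verts b) <> cycle_sub (block_verts b').
  by move=> bD bD' ne /(cycle_sub_block_inj d cyc bD bD').
have vc (b : G * seq G) v : v \in block_verts b ->
  v \in (cycle_sub (block_verts b)).1 by rewrite /= in_set.
have interP v b b' : b \in D -> b' \in D -> b <> b' -> v \in block_verts b ->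
  v \in block_verts b' -> v \in inter_vertices G.
  by move=> bD bD' ne vb vb'; apply: (mem_inter (cb _ bD) (cb _ bD'));
    [apply/eqP/cne|exact: vc|exact: vc].
have C0E : C0 = cycle_sub (block_verts (r, s)).
  have /(cycles_block d full cyc)[b bD Eb] := C0c.
  have [eb|/eqP ne] := eqVneq b (r, s).
    by rewrite Eb eb.
  case/negP: rni; apply: (interP r b (r, s)) => //; rewrite ?mem_head ?mem_rcons ?mem_head //.
  by move: rC; rewrite Eb inE.
have chD : chain r D.
  suff gen D1 D2 : D = D1 ++ D2 -> chain r D2 by apply: (gen [::]).
  elim: D2 D1 => [|[p t] D2 IH] D1 // ED.
  have ED' : D = rcons D1 (p, t) ++ D2 by rewrite cat_rcons.
  rewrite /= (IH _ ED') andbT.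
  have d2 : decomp r ((p, t) :: D2) by apply: (@decomp_cat _ r D1); rewrite -ED.
  have bD : (p, t) \in D by rewrite ED mem_cat mem_head orbT.
  have sub2 b : b \in D2 -> b \in D by move=> h; rewrite ED' mem_cat h orbT.
  have ne2 b : b \in D2 -> (p, t) <> b.
    move=> bD2 eb; have [x xt] : exists x, x \in t by case: (t) (step_size d2) => [|w ?] // _;
      exists w; rewrite mem_head.
    have /negP := step_new d2 xt; apply; apply: (@block_sub _ r D2 b) => //;
      first exact: step_decomp d2.
    by rewrite -eb inE xt orbT.
  have pp : p \in block_verts (p, t) by rewrite mem_head.
  case: D2 ED ED' IH d2 sub2 ne2 => [|[p' t'] F] ED ED' IH d2 sub2 ne2 /=.
    by have := step_p d2; rewrite inE.
  have chF := IH _ ED'; apply: contraT => npt'.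
  have d3 := step_decomp d2.
  have pF : p \in verts r F by have := step_p d2; rewrite /= mem_cat (negPf npt').
  (* the attachment vertex is the root, or new in an older block [b] *)
  have old (F1 : seq (G * seq G)) : p \in verts r F1 ->
    p = r \/ exists b F2 F3, F1 = F2 ++ b :: F3 /\ p \in b.2.
    elim: F1 => [|b F1 IH1]; first by rewrite inE => /eqP; left.
    rewrite /= mem_cat => /orP[pb|/IH1[|[b' [F2 [F3 [-> h]]]]]]; first by right; exists b, [::], F1.
      by left.
    by right; exists b', (b :: F2), F3.
  case: (old F pF) => [pr|[b [F2 [F3 [EF pb]]]]].
    case/negP: rni; apply: (interP r (r, s) (p, t)) => //; rewrite ?mem_rcons ?mem_head //.
      move=> /esym; apply: ne2; move: ED; rewrite /D.
      case/lastP: F {chF d3 pF d2 sub2 IH ED'} => [|F f]; rewrite ?cats1.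
        by move=> ED; have := congr1 (last (r, s)) ED; rewrite last_rcons last_cat /= => ->;
          rewrite mem_head.
      move=> ED; have := congr1 (last (r, s)) ED; rewrite last_rcons last_cat /= last_rcons => ->.
      by rewrite in_cons mem_rcons mem_head orbT.
    by rewrite -pr.
  (* [c] is the block just after [b], so its attachment vertex is new in [b] *)
  subst F; pose c := last (p', t') F2.
  have Ec : (p', t') :: F2 ++ b :: F3 = belast (p', t') F2 ++ [:: c, b & F3].
    by rewrite -cat_cons lastI cat_rcons.
  have cD : c \in (p', t') :: F2 ++ b :: F3 by rewrite Ec mem_cat mem_head orbT.
  have bD2 : b \in (p', t') :: F2 ++ b :: F3 by rewrite Ec mem_cat !in_cons eqxx !orbT.
  have db : decomp r [:: c, b & F3] by apply: (@decomp_cat _ r (belast (p', t') F2)); rewrite -Ec.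
  have chb : chain r [:: c, b & F3] by apply: (@chain_cat _ r (belast (p', t') F2)); rewrite -Ec.
  have cb2 : c.1 \in b.2 by case/andP: chb.
  have cb1 : c.1 \in block_verts b by rewrite in_cons cb2 orbT.
  have pb1 : p \in block_verts b by rewrite in_cons pb orbT.
  have ncb : c <> b.
    move=> ecb; have /= [U _ _ _] := block_facts db (mem_head _ _).
    by case/andP: U; rewrite [in c.2]ecb cb2.
  have cc : c.1 \in block_verts c by rewrite mem_head.
  have [ecp|ncp] := eqVneq c.1 p.
    exfalso; rewrite ecp in cc cb1.
    apply: (no_three_cycles pT (v := p) (cb _ bD) (cb _ (sub2 _ cD)) (cb _ (sub2 _ bD2))).
    - by apply: cne => //; [apply: sub2 | apply: ne2].
    - by apply: cne => //; [apply: sub2 | apply: ne2].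
    - by apply: cne => //; apply: sub2.
    - exact: vc.
    - exact: vc.
    - exact: vc.
  have pint : p \in inter_vertices G by apply: (interP p (p, t) b) => //; [apply: sub2|apply: ne2].
  have cint : c.1 \in inter_vertices G by apply: (interP c.1 c b) => //; apply: sub2.
  case: F3 ED ED' IH d2 sub2 ne2 chF d3 pF Ec cD bD2 db chb =>
    [|b2 F3] ED ED' IH d2 sub2 ne2 chF d3 pF Ec cD bD2 db chb.
    have eb : b = (r, s).
      by have := congr1 (last (r, s)) ED; rewrite /D last_rcons last_cat /= last_cat.
    by move/eqP: ncp; case; apply: hC0; rewrite // C0E -eb; apply: vc.
  exfalso; have b2D : b2 \in D.
    by apply: sub2; rewrite Ec mem_cat !in_cons eqxx !orbT.
  have bb2 : b.1 \in b2.2 by case/and3P: chb.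
  have bb2' : b.1 \in block_verts b2 by rewrite in_cons bb2 orbT.
  have nbb2 : b <> b2.
    move=> eb; have d4 : decomp r [:: b, b2 & F3] by case: db.
    have /= [U _ _ _] := block_facts d4 (mem_head _ _).
    by case/andP: U; rewrite [in b.2]eb bb2.
  have bint : b.1 \in inter_vertices G.
    by apply: (interP b.1 b b2) => //; [apply: sub2|rewrite mem_head].
  have [U _ _] := full_block d cyc (sub2 _ bD2).
  have /andP[nb _] := U.
  apply: (no_three_vertices pT (cb _ (sub2 _ bD2)) bint cint pint).
  - by move=> eb; case/negP: nb; rewrite eb.
  - by move=> eb; case/negP: nb; rewrite eb.
  - exact/eqP.
  - by apply: vc; rewrite mem_head.
  - exact: vc.
  - exact: vc.
have [|y [mid [x El]]] := @seq_ends _ (extras D); first by rewrite size_extras szD.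
exists r, D; split=> //; split=> //.
have [|b0 [M [b1 ED]]] := @seq_ends _ D; first by rewrite szD.
have memD b : b \in b0 :: rcons M b1 -> b \in D by rewrite ED.
have size2 b : b \in M -> size b.2 = 2.
  move=> bM; have bD : b \in D by apply: memD; rewrite in_cons mem_rcons in_cons bM !orbT.
  have := intr (cycle_sub (block_verts b)); rewrite /interior_cycle (cb b bD) (middle_block d
    full cyc chD ED bM) (card_block d cyc bD).
  by case/(_ isT).
have b0D : b0 \in D by apply: memD; rewrite mem_head.
have b1D : b1 \in D by apply: memD; rewrite in_cons mem_rcons mem_head orbT.
have E0 : end_cycle (cycle_sub (block_verts b0)) by apply: (end_block d full cyc chD ED b0D); left.
have E1 : end_cycle (cycle_sub (block_verts b1)) by apply: (end_block d full cyc chD ED b1D); right.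
have h01 := ends _ _ E0 E1; have h10 := ends _ _ E1 E0.
rewrite !(card_block d cyc) // in h01 h10.
have s0 := allP cyc _ b0D; have s1' := allP cyc _ b1D; rewrite /is_cycle_block in s0 s1'.
have [h1 h2] : size b1.2 - 2 <= (size b0.2 - 2).+1 /\ size b0.2 - 2 <= (size b1.2 - 2).+1.
  by move: s0 s1' h01 h10; clear; lia.
exists (size b1.2 - 2), (size b0.2 - 2); split=> //.
rewrite /extras {1}ED /= map_rcons; congr (_ :: rcons _ _).
have sM : size M = k - 2 by rewrite -szD ED /= size_rcons; clear; lia.
rewrite -sM -(size_map (fun b => size b.2 - 2)); apply/all_pred1P/allP => j /mapP[b bM ->].
by rewrite /= size2.
Qed.
End ChainIncidence.

(** * Existence of pseudo triangle chains *)

Section BlockGraph.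
Variable T : finType.
Implicit Types (D E F : seq (T * seq T)) (b : T * seq T) (x y r : T).

(** The part of [decomp] that does not mention a graph; [block_graph] is the graph
    that such a list describes. *)
Fixpoint fresh_blocks r D : bool := if D is b :: D' then
  [&& fresh_blocks r D', b.1 \in verts r D', 0 < size b.2,
    uniq b.2 & ~~ has (mem (verts r D')) b.2] else true.

Definition block_adj D x y :=
  (x != y) && has (fun b => [&& x \in block_verts b,
    y \in block_verts b & cadj (block_verts b) x y]) D.

Lemma block_adj_sym D : symmetric (block_adj D).
Proof.
move=> x y; rewrite /block_adj eq_sym; congr (_ && _); apply: eq_has => b /=.
by rewrite cadj_sym andbCA.
Qed.

Lemma block_adj_irr D : irreflexive (block_adj D).
Proof. by move=> x; rewrite /block_adj eqxx. Qed.

Definition block_graph D : sgraph := SGraph (@block_adj_sym D) (@block_adj_irr D).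

Lemma fresh_sub r D b x : fresh_blocks r D -> b \in D -> x \in block_verts b -> x \in verts r D.
Proof.
elim: D => [|a D IH] //= /and5P[fD aV _ _ _]; rewrite mem_cat !in_cons => /orP[/eqP->|bD].
  by case/orP=> [/eqP->|->]; rewrite ?aV ?orbT.
by move=> xb; rewrite (IH fD bD xb) orbT.
Qed.

Lemma fresh_later r E F b x : fresh_blocks r (E ++ F) -> b \in E -> x \in block_verts b ->
  x \in verts r F -> x = b.1.
Proof.
elim: E => [|a E IH] //= /and5P[fD aV _ _ dis]; rewrite in_cons => /orP[/eqP->|bE]; last exact: IH.
rewrite in_cons => /orP[/eqP->//|xa] xF; case/negP: dis; apply/hasP; exists x => //=.
by elim: (E) => //= c E' h; rewrite mem_cat h orbT.
Qed.

Lemma fresh_cat r E F : fresh_blocks r (E ++ F) -> fresh_blocks r F.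
Proof. by elim: E => //= a E IH /andP[/IH]. Qed.

Lemma block_graph_decomp r D : fresh_blocks r D -> decomp (G := block_graph D) r D.
Proof.
move=> fD; suff gen E F : D = E ++ F -> decomp (G := block_graph D) r F by apply: (gen [::]).
elim: F E => [|[p s] F IH] E ED //.
have ED' : D = rcons E (p, s) ++ F by rewrite cat_rcons.
have fF : fresh_blocks r ((p, s) :: F) by apply: (@fresh_cat r E); rewrite -ED.
have /= /and5P[fF' pV s0 Us dis] := fF.
have new x : x \in s -> x \notin verts r F.
  by move=> xs; apply: contra dis => xV; apply/hasP; exists x.
have U : uniq (p :: s) by rewrite /= Us andbT; apply/negP => /new; rewrite pV.
split; first exact: IH ED'.
split=> //=; first by case: (s) s0.
move=> x y xs yV; have ns : x \notin verts r F := new _ xs.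
have xps : x \in p :: s by rewrite in_cons xs orbT.
have memV z : z \in s ++ verts r F -> z \in verts r ((p, s) :: F) by [].
rewrite /block_adj; apply/andP/andP => [[xy /hasP[b bD /and3P[xb yb cb]]]|[yb cb]].
  move: bD; rewrite {1}ED mem_cat in_cons => /or3P[bE|/eqP eb|bF].
  - have H := @fresh_later r E ((p, s) :: F) b; rewrite -ED in H.
    have xV : x \in verts r ((p, s) :: F) by apply: memV; rewrite mem_cat xs.
    by move: xy; rewrite (H x fD bE xb xV) (H y fD bE yb (memV _ yV)) eqxx.
  - by rewrite eb in yb cb.
  by have := fresh_sub fF' bF xb; rewrite (negPf ns).
split; last by apply/hasP; exists (p, s); rewrite ?ED ?mem_cat ?mem_head ?orbT //; apply/and3P.
by apply: contraTneq cb => <-; rewrite cadj_irr.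
Qed.
End BlockGraph.

Section Intervals.
Variable n : nat.
Local Notation T := 'I_n.+1.
Implicit Types (ss : seq nat).

(** Blocks on consecutive integers, each attached to the last vertex before it. *)
Fixpoint int_blocks ss : seq (T * seq T) := if ss is m :: ss' then
  (inord (sumn ss'), map inord (iota (sumn ss').+1 m)) :: int_blocks ss' else [::].

Lemma mem_inord_iota a m (x : T) : a + m <= n.+1 -> (x \in map inord (iota a m)) = (a <= x < a + m).
Proof.
move=> le; apply/mapP/idP => [[i]|h]; last by exists (x : nat); rewrite ?mem_iota ?inord_val.
rewrite mem_iota => /andP[h1 h2] ->; rewrite inordK ?h1 //.
exact: leq_trans h2 le.
Qed.

Lemma int_blocks_verts ss (x : T) : sumn ss <= n ->
  (x \in verts ord0 (int_blocks ss)) = (x <= sumn ss).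
Proof.
elim: ss => [|m ss IH] /= le; first by rewrite inE -val_eqE /= leqn0.
rewrite mem_cat IH; last by lia.
rewrite mem_inord_iota; lia.
Qed.

Lemma int_blocks_fresh ss : sumn ss <= n -> all (leq 1) ss -> fresh_blocks ord0 (int_blocks ss).
Proof.
elim: ss => [|m ss IH] //= le /andP[m1 a1].
have le' : sumn ss <= n by lia.
apply/and5P; split; first exact: IH.
- by rewrite int_blocks_verts // inordK //; lia.
- by rewrite size_map size_iota.
- rewrite map_inj_in_uniq ?iota_uniq // => i j;
  rewrite !mem_iota => hi hj /(congr1 (@nat_of_ord _)).
  by rewrite !inordK //; lia.
apply/hasPn => x; rewrite mem_inord_iota; last by lia.
by rewrite /= int_blocks_verts // -ltnNge => /andP[].
Qed.

Lemma int_blocks_sizes ss : [seq size b.2 | b <- int_blocks ss] = ss.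
Proof. by elim: ss => //= m ss ->; rewrite size_map size_iota. Qed.

Lemma int_blocks_chain D ss : sumn ss <= n -> all (leq 1) ss ->
  chain (G := block_graph D) ord0 (int_blocks ss).
Proof.
elim: ss => [|m ss IH] //= le /andP[m1 a1]; rewrite IH // ?andbT; last by lia.
case: ss le a1 {IH} => [|m' ss] /= le a1; first by rewrite -val_eqE /= inordK.
have e : (inord (m' + sumn ss) : T) = m' + sumn ss :> nat by rewrite inordK //; lia.
case/andP: a1 => m1' _; rewrite mem_inord_iota; last by lia.
by apply/andP; rewrite [nat_of_ord _]e; split; lia.
Qed.
End Intervals.

(** The two end cycles share the [n - (2 * k + 1)] vertices that are left when
    every cycle is a triangle. *)
Lemma exists_ptc n k : 2 <= k -> 2 * k + 1 <= n -> exists P : sgraph, is_PTC n k P.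
Proof.
move=> k2 nk; pose F := n - (2 * k + 1).
pose a := uphalf F + 2; pose b := F./2 + 2.
pose ss := b :: rcons (nseq (k - 2) 2) a.
have sF : F./2 + uphalf F = F by rewrite addnC uphalf_half -addnA addnn; exact: odd_double_half.
have sums : (sumn ss).+1 = n.
  by rewrite /ss /= sumn_rcons sumn_nseq /a /b; move: sF nk k2; rewrite /F; lia.
have a1 : all (leq 1) ss by rewrite /ss /= all_rcons all_nseq /= /a /b !addn2 /= orbT.
pose D := int_blocks (sumn ss) ss.
pose P := block_graph D.
have d : decomp (G := P) ord0 D by apply/block_graph_decomp/int_blocks_fresh.
have full (x : P) : x \in verts ord0 D by rewrite int_blocks_verts // -ltnS ltn_ord.
have ch : chain (G := P) ord0 D by apply: int_blocks_chain.
have szs : [seq size c.2 | c <- D] = ss := int_blocks_sizes _ _.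
have szD : size D = k by rewrite -(size_map (fun c => size c.2)) szs /= size_rcons size_nseq; lia.
have cyc : all (@is_cycle_block _) D.
  have : all (leq 2) [seq size c.2 | c <- D].
    by rewrite szs /ss /= all_rcons all_nseq /= /a /b !addn2 /= orbT.
  by rewrite all_map.
have [|b0 [M [b1 ED]]] := @seq_ends _ D; first by rewrite szD.
have [e0 eM e1] : [/\ size b0.2 = b, [seq size c.2 | c <- M] = nseq (k - 2) 2 & size b1.2 = a].
  by move: szs; rewrite ED /= map_rcons => -[-> /rcons_inj[-> ->]].
have cardP : #|P| = n by rewrite card_ord sums.
exists P; rewrite -cardP -szD; apply: (@chain_ptc P ord0 D d full cyc ch _ b0 b1 M ED).
- by rewrite szD; lia.
- move=> c cM; have : size c.2 \in nseq (k - 2) 2 by rewrite -eM;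
  apply: (map_f (fun c => size c.2)) cM.
  by rewrite mem_nseq => /andP[_ /eqP].
- by rewrite e0 e1 /a /b; clear; lia.
by rewrite e0 e1 /a /b; clear; lia.
Qed.

(** * Extremality and uniqueness *)

(** In the case of equality the sizes of the blocks are the same for all graphs
    of the class, so the normal form no longer depends on the graph. *)
Lemma cactus_top (G : sgraph) n k : 2 <= k -> in_class G n k ->
  let F := n - (2 * k + 1) in
  [/\ 2 * k + 1 <= n, 2 * pn G + 30 + 16 * k + 4 * F <= double_top F k &
   2 * pn G + 30 + 16 * k + 4 * F = double_top F k ->
     exists r D, [/\ decomp (G := G) r D, normal r D,
     forall x, x \in verts r D & [seq size b.2 | b <- D] =
       F./2 + 2 :: rcons (nseq (k - 2) 2) (uphalf F + 2)]].
Proof.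
move=> k2 /and3P[cac /eqP cn /eqP ck] F.
have conn := cactus_connect cac; have cact := cactus_uniq cac.
have [C Cc] : exists C, C \in cycles G by apply/card_gt0P; rewrite ck; lia.
have [c Cc' _] := mem_cycles _ Cc.
have [x xc] : exists x, x \in c.
  by case: c Cc' => [/and3P[]//|x c] _; exists x; rewrite mem_head.
have [E [s [d ok full s1]]] := grow_from conn cact (ex_intro2 _ _ c Cc' xc).
have kE : ncycles (rcons E (x, s)) = k by rewrite -(ncycles_card d full) ck.
have [|h1 [h2 h3]] := pn_top s1 d full; first by rewrite kE.
rewrite kE cn -/F in h1 h2 h3; split=> // /[dup] eqT /h3[cyc full_pair].
set D := rcons E (x, s) in d ok full kE cyc full_pair.
have szD : size D = k by rewrite -ncycles_all.
have sF : sumn (extras D) = F.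
  by have := verts_card d full; rewrite (size_verts_extras x cyc) szD cn /F; lia.
have [|||r [D' [d' full' cyc' ch' EX]]] := eq_chain conn cact d full cyc; rewrite ?szD ?sF //.
have szD' : size D' = k by rewrite -size_extras EX szD /= size_rcons size_nseq; lia.
have szs : [seq size b.2 | b <- D'] = F./2 + 2 :: rcons (nseq (k - 2) 2) (uphalf F + 2).
  have -> : [seq size b.2 | b <- D'] = [seq f + 2 | f <- extras D'].
    rewrite -map_comp; apply/eq_in_map => b bD /=; have := allP cyc' b bD;
      rewrite /is_cycle_block; lia.
  by rewrite EX /canon_extras /= map_rcons map_nseq szD sF.
have [|b bM|r' [D'' [d'' n'' s'' v'']]] := normalize d' ch'; first by rewrite szD'.
  have [|b0 [M [b1 ED]]] := @seq_ends _ D'; first by rewrite szD'.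
  move: bM szs; rewrite ED /= size_rcons /= -cats1 take_size_cat // => bM.
  rewrite cats1 map_rcons => -[_ /rcons_inj[eM _]].
  have : size b.2 \in nseq (k - 2) 2 by rewrite -eM; apply: (map_f (fun c => size c.2)) bM.
  by rewrite mem_nseq => /andP[_ /eqP].
by exists r', D''; split; [|by []|move=> y; rewrite -v''|rewrite s''].
Qed.

(** A pseudo triangle chain is a balanced chain, for which the bound is attained. *)
Lemma ptc_top (P : sgraph) n k : 2 <= k -> is_PTC n k P ->
  let F := n - (2 * k + 1) in 2 * pn P + 30 + 16 * k + 4 * F = double_top F k.
Proof.
move=> k2 ptc F; have [r [D [d full cyc ch [szD [x [y [EX h1 h2]]]]]]] := ptc_chain k2 ptc.
have cn : #|P| = n by case: ptc => _ /and3P[_ /eqP].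
have sF : sumn (extras D) = F.
  by have := verts_card d full; rewrite (size_verts_extras r cyc) szD cn /F; lia.
have E := chain_pn d full cyc ch; rewrite szD sF in E.
rewrite E top2E; congr (_ + _).
have := (chain_top_zero (k - 2) x y).2; rewrite h1 h2 -EX size_extras szD sF; exact.
Qed.

Theorem theorem10 (n k : nat) (hk : 2 <= k) (G : sgraph)
    (hG : in_class G n k) :
  (exists P : sgraph, is_PTC n k P) /\
  (forall P : sgraph, is_PTC n k P ->
     pn G <= pn P /\ (pn G = pn P <-> graph_iso G P)).
Proof.
have [nk leG eqG] := cactus_top hk hG; split; first exact: exists_ptc.
move=> P ptc; have topP := ptc_top hk ptc; have hP : in_class P n k by case: ptc.
have [_ _ eqP] := cactus_top hk hP.
split; first lia.
split=> [e|]; last exact: pn_iso.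
have [|r [D [d nD full s]]] := eqG; first by rewrite e.
have [r' [D' [d' nD' full' s']]] := eqP topP.
by apply: (normal_iso d d' nD nD' full full'); rewrite s s'.
Qed.
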